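(* Consider the one-dimensional Kalman filter scheduling problem with identical sensors (described in the context). Then every system $i\in\{1,\dots,N\}$ is indexable, and its Whittle index $\lambda_i(\Sigma_i)$, $\Sigma_i\in\mathbb{R}_+=[0,\infty)$, is given as follows. (a) If $C_i=0$ or $T_i=0$: $\lambda_i(\Sigma_i)=-\kappa_i$ for all $\Sigma_i\in\mathbb{R}_+$. (b) If $C_i\neq 0$ and $T_i\neq 0$: $$\lambda_i(\Sigma_i)=\begin{cases} -\kappa_i+\dfrac{T_i\Sigma_i^2}{\Sigma_i-x_{1,i}} & \text{if } \Sigma_i\le x_{2,i},\\[2mm] -\kappa_i+\dfrac{C_i^2}{2V_i}\,\dfrac{T_i\Sigma_i^3}{A_i\Sigma_i+W_i} & \text{if } x_{2,i}<\Sigma_i<x_{e,i},\\[2mm] -\kappa_i+\dfrac{T_iC_i^2\Sigma_i^2}{2|A_i|V_i} & \text{if } x_{e,i}\le\Sigma_i, \end{cases}$$ with the convention $x_{e,i}=+\infty$ if $A_i\ge 0$. Moreover, a lower bound on the achievable performance $J$ is obtained by maximizing over $\lambda\in\mathbb{R}$ the concave function $$\gamma(\lambda)=\sum_{i=1}^N\gamma^i(\lambda)-\lambda M,$$ i.e. $J\ge\sup_{\lambda\in\mathbb{R}}\gamma(\lambda)$, where the optimal values $\gamma^i(\lambda)$ of the single-site problems are given by: (c) If $T_i=0$: $\gamma^i(\lambda)=\min\{\lambda+\kappa_i,0\}$. (d) If $T_i\ne0$ and $C_i=0$: $\gamma^i(\lambda)=\dfrac{T_iW_i}{2|A_i|}+\min\{\lambda+\kappa_i,0\}$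 if $A_i<0$, and $\gamma^i(\lambda)=+\infty$ if $A_i\ge0$. (e) If $C_i\ne0$ and $T_i\ne0$: $$\gamma^i(\lambda)=\begin{cases} T_i x_{2,i}+\kappa_i+\lambda & \text{if }\lambda\le\lambda_i(x_{2,i}),\\[1mm] T_i\Sigma_i^*(\lambda)+\dfrac{V_i(\kappa_i+\lambda)\,(2A_i\Sigma_i^*(\lambda)+W_i)}{C_i^2(\Sigma_i^*(\lambda))^2} & \text{if }\lambda_i(x_{2,i})<\lambda<\lambda_i(x_{e,i}),\\[2mm] T_i x_{e,i} & \text{if }\lambda_i(x_{e,i})\le\lambda, \end{cases}$$ where, in the second case, $\Sigma_i^*(\lambda)$ is the unique positive root $X$ of the cubic equation $$X^3-\frac{2V_i(\lambda+\kappa_i)}{T_iC_i^2}A_i\,X-\frac{2V_i(\lambda+\kappa_i)}{T_iC_i^2}W_i=0,$$ and when $A_i\ge 0$ (so $x_{e,i}=+\infty$) the second case is $\lambda>\lambda_i(x_{2,i})$ and the third case does not occur.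
   Context: Setting. There are $N$ independent scalar linear systems $\dot x_i=A_ix_i+B_iu_i+w_i$ with known deterministic inputs $u_i$, and $M<N$ identical sensors; $w_i$ is white Gaussian noise of intensity $W_i$. If a sensor observes system $i$ it yields $y_i=C_ix_i+v_i$, with $v_i$ white Gaussian noise of intensity $V_i>0$. All noises and Gaussian initial conditions are independent. Put $\pi_i(t)=1$ if system $i$ is observed at time $t$ and $\pi_i(t)=0$ otherwise. With the optimal (Kalman-Bucy) estimator, the error variance $\Sigma_i(t)$ of system $i$ satisfies $$\dot\Sigma_i=2A_i\Sigma_i+W_i-\pi_i(t)\frac{C_i^2}{V_i}\Sigma_i^2,\qquad \Sigma_i(0)=\Sigma_{i,0}.$$ Standing assumptions: $\Sigma_{i,0}>0$; $(A_i,W_i^{1/2})$ is controllable, i.e. $W_i>0$; $(A_i,C_i)$ is detectable (i.e. $A_i<0$ or $C_i\neq0$). The weights satisfy $T_i\ge0$, and $\kappa_i\in\mathbb{R}$ is a cost per unit time of observing system $i$. Achievable performance. $J$ is the minimum (infimum) over (measurable) schedules $\pi_i(t)\in\{0,1\}$ with $\sum_{i=1}^N\pi_i(t)=M$ for all $t$ of $$\limsup_{T\to\infty}\frac1T\int_0^T\sum_{i=1}^N\big(T_i\Sigma_i(t)+\kappa_i\pi_i(t)\big)\,dt.$$ Single-site problem. For $\lambda\in\mathbb{R}$, $$\gamma^i(\lambda)=\min_{\pi_i}\ \limsup_{T\to\infty}\frac1T\int_0^T\big(T_i\Sigma_i(t)+(\kappa_i+\lambda)\pi_i(t)\big)\,dt,$$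 over all (measurable) $\pi_i:[0,\infty)\to\{0,1\}$ with no coupling constraint. Its Hamilton-Jacobi-Bellman equation, for $\Sigma\in\mathbb{R}_+$, is $$\gamma^i(\lambda)=\min\Big\{T_i\Sigma+(2A_i\Sigma+W_i)h'(\Sigma;\lambda),\ T_i\Sigma+\kappa_i+\lambda+\big(2A_i\Sigma+W_i-\tfrac{C_i^2}{V_i}\Sigma^2\big)h'(\Sigma;\lambda)\Big\},$$ where $h(\cdot;\lambda)$ is the relative value function (with $h'$ continuous). The first term corresponds to the passive action (not measuring, $\pi_i=0$), the second to the active action (measuring, $\pi_i=1$); an action is optimal at $\Sigma$ if the corresponding term attains the minimum. Indexability and Whittle index. Let $\mathcal{P}^i(\lambda)\subset\mathbb{R}_+$ be the set of variances $\Sigma$ at which the passive action is optimal for the single-site problem with parameter $\lambda$. System $i$ is indexable if $\mathcal{P}^i(\lambda)$ is monotonically increasing (for set inclusion) from $\emptyset$ to $\mathbb{R}_+$ as $\lambda$ increases from $-\infty$ to $+\infty$. Its Whittle index is then $\lambda_i(\Sigma)=\inf\{\lambda\in\mathbb{R}:\Sigma\in\mathcal{P}^i(\lambda)\}$. Notation. If $C_i\ne0$, $x_{1,i}<0<x_{2,i}$ are the two roots of $2A_ix+W_i-\frac{C_i^2}{V_i}x^2=0$, i.e. $$x_{1,i}=\frac{A_i-\sqrt{A_i^2+C_i^2W_i/V_i}}{C_i^2/V_i},\qquad x_{2,i}=\frac{A_i+\sqrt{A_i^2+C_i^2W_i/V_i}}{C_i^2/V_i}.$$ If $A_i<0$,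 $x_{e,i}=-\frac{W_i}{2A_i}$ is the solution of $2A_ix+W_i=0$. *)

(* Defs.v *)
From mathcomp Require Import all_boot all_order all_algebra.
From mathcomp Require Import all_classical all_reals all_analysis.

Set Implicit Arguments.
Unset Strict Implicit.
Unset Printing Implicit Defensive.

Import Order.TTheory GRing.Theory Num.Theory.
Import numFieldNormedType.Exports.
Local Open Scope classical_set_scope.
Local Open Scope ring_scope.

(* Data of one scalar system: dynamics A, process noise intensity W,
   observation gain C, measurement noise intensity V, variance weight T,
   measurement cost kappa and initial error variance Sigma_0.  The known input
   B u does not enter the error variance. *)
Record site (R : realType) := Site {
  dynA : R;
  noiseW : R;
  gainC : R;
  noiseV : R;
  weightT : R;
  kappa : R;
  Sigma0 : R }.

(* W > 0 is controllability of (A, W^(1/2)), and the last conjunct is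
   detectability of (A, C), for scalar systems. *)
Definition standing_assumptions (R : realType) (s : site R) : Prop :=
  [/\ 0 < Sigma0 s, 0 < noiseW s, 0 < noiseV s, 0 <= weightT s &
      dynA s < 0 \/ gainC s != 0].

Definition passive_drift (R : realType) (s : site R) (S : R) : R :=
  2 * dynA s * S + noiseW s.

Definition active_drift (R : realType) (s : site R) (S : R) : R :=
  2 * dynA s * S + noiseW s - gainC s ^+ 2 / noiseV s * S ^+ 2.

Definition schedule (R : realType) (pi : R -> bool) : Prop :=
  measurable_fun (`[0, +oo[ : set R) pi.

(* The Riccati equation is understood in the sense of Caratheodory (integral
   form), since the schedule pi is only measurable. *)
Definition error_variance (R : realType) (s : site R)
    (pi : R -> bool) (Sig : R -> R) : Prop :=
  {within `[0, +oo[, continuous Sig} /\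
  forall t : R, 0 <= t ->
    Sig t = Sigma0 s +
      \int[@lebesgue_measure R]_(r in `[0, t])
        (2 * dynA s * Sig r + noiseW s
         - (pi r)%:R * (gainC s ^+ 2 / noiseV s) * Sig r ^+ 2).

Definition average_cost (R : realType) (c : R -> R) : \bar R :=
  limf_esup
    (fun T : R => (T^-1 * \int[@lebesgue_measure R]_(t in `[0, T]) c t)%:E)
    (pinfty_nbhs R).

Definition achievable_performance (R : realType) (N M : nat)
    (s : 'I_N -> site R) : \bar R :=
  ereal_inf [set J | exists (pi : 'I_N -> R -> bool) (Sig : 'I_N -> R -> R),
    [/\ forall i, schedule (pi i),
        forall t, 0 <= t -> (\sum_(i < N) pi i t)%N = M,
        forall i, error_variance (s i) (pi i) (Sig i) &
        J = average_cost (fun t => \sum_(i < N)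
              (weightT (s i) * Sig i t + kappa (s i) * (pi i t)%:R))]].

(* gamma^i(lambda) *)
Definition single_site_value (R : realType) (s : site R) (lam : R) : \bar R :=
  ereal_inf [set J | exists (pi : R -> bool) (Sig : R -> R),
    [/\ schedule pi,
        error_variance s pi Sig &
        J = average_cost (fun t =>
              weightT s * Sig t + (kappa s + lam) * (pi t)%:R)]].

Definition passive_term (R : realType) (s : site R) (dh : R -> R) (S : R) : R :=
  weightT s * S + passive_drift s S * dh S.

Definition active_term (R : realType) (s : site R) (lam : R) (dh : R -> R)
    (S : R) : R :=
  weightT s * S + kappa s + lam + active_drift s S * dh S.

(* h is a relative value function with derivative dh.  At the endpoint 0, the
   two continuity conditions make dh 0 the right derivative of h.
   Boundedness from below is the usual normalization of the ergodic HJB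
   equation: when A >= 0, C <> 0, T <> 0 and lam is large enough, the equation
   alone has a second C^1 solution, tending to -oo, for which not measuring is
   optimal at every variance although the error variance then diverges. *)
Definition relative_value_function (R : realType) (s : site R) (lam : R)
    (h dh : R -> R) : Prop :=
  [/\ {within `[0, +oo[, continuous h},
      {within `[0, +oo[, continuous dh},
      forall S : R, 0 < S -> is_derive S (1 : R) h (dh S),
      exists m : R, forall S : R, 0 <= S -> m <= h S &
      forall S : R, 0 <= S ->
        single_site_value s lam =
          (Num.min (passive_term s dh S) (active_term s lam dh S))%:E].

(* Existence of "the" relative value function, and its uniqueness up to an
   additive constant. *)
Definition has_relative_value_function (R : realType) (s : site R) (lam : R)
    : Prop :=
  (exists h dh : R -> R, relative_value_function s lam h dh) /\
  (forall h1 dh1 h2 dh2 : R -> R,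
     relative_value_function s lam h1 dh1 ->
     relative_value_function s lam h2 dh2 ->
     exists c : R, forall S : R, 0 <= S ->
       h1 S = h2 S + c /\ dh1 S = dh2 S).

(* P^i(lambda) *)
Definition passive_set (R : realType) (s : site R) (lam : R) : set R :=
  [set S : R | 0 <= S /\
    exists h dh : R -> R, relative_value_function s lam h dh /\
      passive_term s dh S <= active_term s lam dh S].

(* "From the empty set to R_+" is in the sense of monotone limits: for finite
   lambda the passive set may be bounded and nonempty. *)
Definition indexable (R : realType) (s : site R) : Prop :=
  [/\ forall lam1 lam2 : R, lam1 <= lam2 ->
        passive_set s lam1 `<=` passive_set s lam2,
      \bigcap_(lam in [set: R]) passive_set s lam = set0 &
      \bigcup_(lam in [set: R]) passive_set s lam = [set S : R | 0 <= S]].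

Definition whittle_index (R : realType) (s : site R) (S : R) : \bar R :=
  ereal_inf [set lam%:E | lam in [set lam : R | passive_set s lam S]].

Definition root_x1 (R : realType) (s : site R) : R :=
  (dynA s - Num.sqrt (dynA s ^+ 2 + gainC s ^+ 2 * noiseW s / noiseV s))
    / (gainC s ^+ 2 / noiseV s).

Definition root_x2 (R : realType) (s : site R) : R :=
  (dynA s + Num.sqrt (dynA s ^+ 2 + gainC s ^+ 2 * noiseW s / noiseV s))
    / (gainC s ^+ 2 / noiseV s).

(* Meaningful only for A < 0; the convention x_e = +oo for A >= 0 is rendered by
   guarding "_ < x_e" as "A < 0 -> _ < x_e" and "x_e <= _" by "A < 0". *)
Definition point_xe (R : realType) (s : site R) : R :=
  - (noiseW s / (2 * dynA s)).

Definition threshold_cubic (R : realType) (s : site R) (lam X : R) : R :=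
  X ^+ 3
  - 2 * noiseV s * (lam + kappa s) / (weightT s * gainC s ^+ 2) * dynA s * X
  - 2 * noiseV s * (lam + kappa s) / (weightT s * gainC s ^+ 2) * noiseW s.

Definition dual_function (R : realType) (N M : nat) (s : 'I_N -> site R)
    (lam : R) : \bar R :=
  (\sum_(i < N) single_site_value (s i) lam - (lam * M%:R)%:E)%E.

Definition econcave (R : realType) (g : R -> \bar R) : Prop :=
  forall a b t : R, 0 <= t -> t <= 1 ->
    (t%:E * g a + (1 - t)%:E * g b <= g (t * a + (1 - t) * b)%R)%E.

(* Main.v *)
(* The value of a single site is the infimum, over the levels X between x2 and
   xe, of the average cost F(X) of holding the variance near X by switching
   rapidly between the two actions.  Along any trajectory the drift averages to
   zero, so that the average cost of a trajectory staying near X is close to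
   F(X); such trajectories are built by a sampled bang-bang control from the
   explicit flows of the two equations.  Conversely, a relative value function h
   with h' >= 0 bounds the average cost of every schedule from below, by the
   chain rule along the Caratheodory trajectory.

   The value function is explicit: on [x2, xe] the HJB equation has a passive
   branch (gamma - T S) / (2 A S + W) and an active one, which meet only at a
   minimizer of F, and the solution passes from the first to the second there.
   An action is thus optimal according to the sign of lambda - lambda_i(S), with
   lambda_i strictly increasing, which gives indexability and the index.

   The dual function is concave because F(X) is affine in lambda, and it bounds
   the coupled problem by adding up the certificates of the sites. *)

Require Import Defs.
From mathcomp Require Import all_boot all_order all_algebra.
From mathcomp Require Import all_classical all_reals all_analysis measurable_realfun.
From mathcomp Require Import ring lra.

Set Implicit Arguments.
Unset Strict Implicit.
Unset Printing Implicit Defensive.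

Import Order.TTheory GRing.Theory Num.Theory.
Import numFieldNormedType.Exports.
Local Open Scope classical_set_scope.
Local Open Scope ring_scope.

(** * Integrals of locally bounded measurable functions *)

Section LocallyBounded.
Context {R : realType}.
Implicit Types (f g : R -> R) (a b t : R).
Local Notation mu := (@lebesgue_measure R).

(** At a level strictly between [x2] and [xe] neither action has zero drift, so no 0/1 schedule
    keeps the variance there: the value is only approached, and at the ends of the interval the
    levels themselves are only approached. With [m = kappa + lambda] and [g = C^2 / V], the passive
    action is optimal at [S] iff [g S^2 h'(S) <= m], so each formula of the index is the equation
    [g S^2 h'(S) = m]. Below [x2], [h'] is the active branch with the factor [S - x2] cancelled,
    [T / (g (S - x1))]. Above [xe] it is the passive branch with [xe - S] cancelled, [T / (2 |A|)].
    In between, the two branches meet at [X] only if [F'(X) = 0], which gives the middle formula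
    and, after clearing denominators, the cubic. The remaining difficulty of the lower bound is the
    boundary term [h(Sigma(t))], which may be large. Since [h] is nondecreasing it is controlled
    whenever [Sigma(t)] is; if the variance stays large, the cost itself is large. *)

Definition locally_bounded_measurable f :=
  measurable_fun (`[0, +oo[ : set R) f /\
  forall b, exists B, forall t, 0 <= t <= b -> `|f t| <= B.

Local Notation lbm := locally_bounded_measurable.

(** Local boundedness, unlike integrability, survives products. This makes the class suitable for
    the quadratic Riccati term and for the integrand of the chain rule. *)
Lemma lbm_integrable f a b : lbm f -> 0 <= a ->
  mu.-integrable `[a, b] (EFin \o f).
Proof.
move=> [mf bf] a0; apply: measurable_bounded_integrable => //.
- exact: compact_finite_measure (@segment_compact _ _ _).
- apply: measurable_funS mf => // t /=; rewrite !in_itv/= => /andP[at_ _].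
  by rewrite (le_trans a0).
- have [B HB] := bf b.
  exists B; split; rewrite ?num_real// => M BM t /=; rewrite in_itv/= => /andP[at_ tb].
  by rewrite (le_trans _ (ltW BM))// HB// (le_trans a0 at_).
Qed.

Lemma lbm_cst (c : R) : lbm (fun=> c).
Proof. by split => [|b]; [exact: measurable_cst | exists `|c|]. Qed.

Lemma lbmD f g : lbm f -> lbm g -> lbm (fun t => f t + g t).
Proof.
move=> [mf bf] [mg bg]; split=> [|b]; first exact: measurable_funD.
have [B HB] := bf b; have [D HD] := bg b; exists (B + D) => t tb.
by rewrite (le_trans (ler_normD _ _))// lerD ?HB ?HD.
Qed.

Lemma lbmM f g : lbm f -> lbm g -> lbm (fun t => f t * g t).
Proof.
move=> [mf bf] [mg bg]; split=> [|b]; first exact: measurable_funM.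
have [B HB] := bf b; have [D HD] := bg b; exists (B * D) => t tb.
by rewrite normrM ler_pM ?HB ?HD.
Qed.

Lemma lbmN f : lbm f -> lbm (fun t => - f t).
Proof.
move=> lf; rewrite (_ : (fun t => - f t) = (fun t => (-1) * f t)).
  exact: lbmM (lbm_cst _) lf.
by apply/funext => t; rewrite mulN1r.
Qed.

Lemma lbmB f g : lbm f -> lbm g -> lbm (fun t => f t - g t).
Proof. by move=> lf lg; apply: lbmD => //; exact: lbmN. Qed.

Lemma lbm_sum (I : Type) (r : seq I) (F : I -> R -> R) :
  (forall i, lbm (F i)) -> lbm (fun t => \sum_(i <- r) F i t).
Proof.
move=> lF; elim: r => [|i r IH].
  by under eq_fun do rewrite big_nil; exact: lbm_cst.
by under eq_fun do rewrite big_cons; exact: lbmD.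
Qed.

Lemma lbm_within_continuous f : {within `[0, +oo[, continuous f} -> lbm f.
Proof.
move=> cf; split=> [|b]; first exact: subspace_continuous_measurable_fun.
have [b0|b0] := ltP b 0.
  by exists 0 => t /andP[t0 tb]; have := le_lt_trans (le_trans t0 tb) b0; rewrite ltxx.
have cfb : {within `[0, b], continuous f}.
  by apply: continuous_subspaceW cf => t /=; rewrite !in_itv/= => /andP[->].
have [c _ Hc] := EVT_max b0 cfb; have [d _ Hd] := EVT_min b0 cfb.
exists (`|f c| + `|f d|) => t tb.
have {}Hc := Hc t; have {}Hd := Hd t; rewrite !in_itv/= tb in Hc Hd.
have := Hc isT; have := Hd isT => ? ?.
have := ler_norm (f c); have := ler_norm (- f d); rewrite normrN => ? ?.
have := normr_ge0 (f c); have := normr_ge0 (f d) => ? ?.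
by rewrite ler_norml; apply/andP; split; lra.
Qed.

Lemma lbm_indicator (b : R -> bool) :
  measurable_fun (`[0, +oo[ : set R) b -> lbm (fun t => (b t)%:R).
Proof.
move=> mb; split=> [|c]; last by exists 1 => t _; case: (b t); rewrite ?normr1 ?normr0.
rewrite (_ : (fun t => _) = (fun x : bool => x%:R : R) \o b)//.
by apply: (measurableT_comp _ mb) => // _ Y _; exact: I.
Qed.

Lemma lbm_Rintegral_split f a b : lbm f -> 0 <= a -> a <= b ->
  \int[mu]_(t in `[0, b]) f t =
  \int[mu]_(t in `[0, a]) f t + \int[mu]_(t in `[a, b]) f t.
Proof.
move=> lf a0 ab.
have := @Rintegral_itvB R f (BLeft 0) (BRight b) a (lbm_integrable b lf (lexx 0)).
rewrite !bnd_simp => /(_ a0 ab) E.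
rewrite -[X in _ = _ + X]Rintegral_itv_obnd_cbnd -?E; first by rewrite subrKC.
apply: integrableS (lbm_integrable b lf a0) => //.
by apply: subset_itvr; rewrite bnd_simp.
Qed.

Lemma Rintegral_itv_cst (c a b : R) : a <= b -> \int[mu]_(_ in `[a, b]) c = c * (b - a).
Proof.
move=> ab; rewrite Rintegral_cst//= lebesgue_measure_itv/= lte_fin.
by case: ltgtP ab => // -> _; rewrite subrr.
Qed.

Lemma le_lbm_Rintegral f g a b : lbm f -> lbm g -> 0 <= a ->
  (forall t, a <= t <= b -> f t <= g t) ->
  \int[mu]_(t in `[a, b]) f t <= \int[mu]_(t in `[a, b]) g t.
Proof.
move=> lf lg a0 fg; by apply: le_Rintegral => //; exact: lbm_integrable.
Qed.

Lemma normr_lbm_Rintegral_le f a b (B : R) : lbm f -> 0 <= a -> a <= b ->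
  (forall t, a <= t <= b -> `|f t| <= B) ->
  `|\int[mu]_(t in `[a, b]) f t| <= B * (b - a).
Proof.
move=> lf a0 ab fB; rewrite -(Rintegral_itv_cst B ab) ler_norml.
have -> : - (\int[mu]_(_ in `[a, b]) B) = (\int[mu]_(_ in `[a, b]) (- B)).
  by rewrite !Rintegral_itv_cst// mulNr.
apply/andP; split; apply: le_lbm_Rintegral => //; try exact: lbm_cst.
  by move=> t /fB; rewrite ler_norml => /andP[].
by move=> t /fB; rewrite ler_norml => /andP[].
Qed.

Lemma lbm_RintegralD f g a b : lbm f -> lbm g -> 0 <= a ->
  \int[mu]_(t in `[a, b]) (f t + g t) =
  \int[mu]_(t in `[a, b]) f t + \int[mu]_(t in `[a, b]) g t.
Proof. by move=> lf lg a0; rewrite RintegralD//; exact: lbm_integrable. Qed.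

Lemma lbm_RintegralB f g a b : lbm f -> lbm g -> 0 <= a ->
  \int[mu]_(t in `[a, b]) (f t - g t) =
  \int[mu]_(t in `[a, b]) f t - \int[mu]_(t in `[a, b]) g t.
Proof. by move=> lf lg a0; rewrite RintegralB//; exact: lbm_integrable. Qed.

Lemma lbm_RintegralZ c f a b : lbm f -> 0 <= a ->
  \int[mu]_(t in `[a, b]) (c * f t) = c * \int[mu]_(t in `[a, b]) f t.
Proof. by move=> lf a0; rewrite RintegralZl//; exact: lbm_integrable. Qed.

Lemma lbm_Rintegral_sum (I : Type) (r : seq I) (F : I -> R -> R) a b :
  (forall i, lbm (F i)) -> 0 <= a ->
  \int[mu]_(t in `[a, b]) (\sum_(i <- r) F i t) =
  \sum_(i <- r) \int[mu]_(t in `[a, b]) F i t.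
Proof.
move=> lF a0; elim: r => [|i r IH].
  rewrite big_nil; under eq_Rintegral do rewrite big_nil.
  by rewrite Rintegral_cst// mul0r.
rewrite big_cons -IH -lbm_RintegralD//; last exact: lbm_sum.
by apply: eq_Rintegral => t _; rewrite big_cons.
Qed.

Lemma eq_Rintegral_itv f g a b : (forall t, a <= t <= b -> f t = g t) ->
  \int[mu]_(t in `[a, b]) f t = \int[mu]_(t in `[a, b]) g t.
Proof. by move=> fg; apply: eq_Rintegral => t; rewrite inE/= in_itv/=; exact: fg. Qed.

(** Serves on grid cells: at the right endpoint the schedule already has its next value, so the
    integrands agree only on the half-open interval. *)
Lemma eq_Rintegral_itv_co f g a b :
  mu.-integrable `[a, b] (EFin \o f) -> mu.-integrable `[a, b] (EFin \o g) ->
  (forall t, a <= t < b -> f t = g t) ->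
  \int[mu]_(t in `[a, b]) f t = \int[mu]_(t in `[a, b]) g t.
Proof.
move=> If Ig fg.
rewrite -[LHS]Rintegral_itv_bndo_bndc; last first.
  by apply: integrableS If => //; apply: subset_itvl; rewrite bnd_simp.
rewrite -[RHS]Rintegral_itv_bndo_bndc; last first.
  by apply: integrableS Ig => //; apply: subset_itvl; rewrite bnd_simp.
by apply: eq_Rintegral => t; rewrite inE/= in_itv/=; exact: fg.
Qed.

End LocallyBounded.

(** * The chain rule along absolutely continuous trajectories *)

Section CalculusAlongTrajectories.
Context {R : realType}.
Local Notation mu := (@lebesgue_measure R).
Local Notation lbm := locally_bounded_measurable.

Lemma is_derive_dist (f : R -> R) (x df e : R) : is_derive x 1 f df -> 0 < e ->
  exists2 eta, 0 < eta & forall y, `|y - x| < eta ->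
    `|f y - f x - df * (y - x)| <= e * `|y - x|.
Proof.
move=> [dvf dfE] e0.
have H : h^-1 *: (f (h *: 1 + x) - f x) @[h --> 0^'] --> df.
  by rewrite -dfE; exact: dvf.
move/cvgrPdist_le : H => /(_ _ e0).
move=> -[eta /= eta0 Heta].
exists eta => // y yx.
have [->|yneqx] := eqVneq y x; first by rewrite !subrr mulr0 subrr normr0 mulr0.
have yx0 : y - x != 0 by rewrite subr_eq0.
have := Heta (y - x); rewrite /ball_/= sub0r normrN => /(_ yx yx0).
rewrite -[(y - x) *: 1]/((y - x) * 1) mulr1 subrK -[_ *: _]/(_ * _) => H.
have -> : f y - f x - df * (y - x) = - (y - x) * (df - (y - x)^-1 * (f y - f x)).
  by field.
by rewrite normrM normrN mulrC ler_wpM2r.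
Qed.

Lemma small_increments_const (G : R -> R) (b : R) : 0 <= b ->
  (forall e, 0 < e -> forall t, 0 <= t -> exists2 eta, 0 < eta &
    forall s, 0 <= s -> `|s - t| < eta -> `|G s - G t| <= e * `|s - t|) ->
  G b = G 0.
Proof.
(* The extension by the constant [G 0] to the left of 0 has zero derivative on the whole line,
   because [Num.max 0] is 1-Lipschitz. *)
move=> b0 smallG; pose H x := G (Num.max 0 x).
have -> : G b = H b by rewrite /H max_r.
have -> : G 0 = H 0 by rewrite /H maxxx.
apply: is_derive_0_is_cst => x.
have maxD (y z : R) : `|Num.max 0 y - Num.max 0 z| <= `|y - z|.
  by rewrite /Num.max; case: ltP => ?; case: ltP => ?;
    rewrite ?subr0 ?sub0r ?subrr ?normrN ?normr0// ler_norml;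
    apply/andP; split; have := ler_norm (y - z); have := ler_norm (z - y);
    rewrite distrC; lra.
suff HH : h^-1 *: (H (h *: 1 + x) - H x) @[h --> 0^'] --> (0 : R).
  by apply: DeriveDef; [apply/cvg_ex; exists 0; exact: HH | exact: cvg_lim HH].
apply/cvgrPdist_le => e e0.
have [|eta eta0 Heta] := smallG _ e0 (Num.max 0 x); first by rewrite le_max lexx.
exists eta => //= h /=; rewrite sub0r normrN => heta h0.
rewrite sub0r normrN -[_ *: (_ - _)]/(_ * _) normrM normfV.
rewrite ler_pdivrMl ?normr_gt0//.
rewrite -[h *: 1]/(h * 1) mulr1.
have hx : `|Num.max 0 (h + x) - Num.max 0 x| <= `|h|.
  by rewrite (le_trans (maxD _ _))// addrK.
rewrite (le_trans (Heta _ _ _)) ?le_max ?lexx//; first exact: le_lt_trans heta.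
by rewrite mulrC ler_wpM2r// ltW.
Qed.

Lemma within_continuous_dist (f : R -> R) (t e : R) :
  {within `[0, +oo[, continuous f} -> 0 <= t -> 0 < e ->
  exists2 eta, 0 < eta & forall s, 0 <= s -> `|s - t| < eta -> `|f s - f t| <= e.
Proof.
move=> /subspace_continuousP cf t0 e0.
have /cvgrPdist_le/(_ _ e0) : f @ within `[0, +oo[ (nbhs t) --> f t.
  by apply: cf; rewrite /= in_itv/= t0.
rewrite /within/= => -[eta eta0 Heta]; exists eta => // s s0 st.
by rewrite distrC; apply: Heta; rewrite /= ?in_itv/= ?s0//= distrC.
Qed.

Lemma Rintegral_increment (Sig f : R -> R) :
  lbm f -> (forall t, 0 <= t -> Sig t = Sig 0 + \int[mu]_(r in `[0, t]) f r) ->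
  forall a b, 0 <= a -> a <= b -> Sig b - Sig a = \int[mu]_(r in `[a, b]) f r.
Proof.
move=> lf E a b a0 ab; rewrite (E b) ?(le_trans a0)// (E a)//.
by rewrite (lbm_Rintegral_split lf a0 ab); ring.
Qed.

(** [Sig] need not be differentiable at every time, since [f] is only measurable. Differentiation
    almost everywhere is bypassed: the increments of [h (Sig u)] and of the integral are both
    [d (Sig u)] times the increment of [Sig], up to [o(|s - u|)]. Their difference therefore has
    zero derivative at every time. *)
Lemma lbm_chain_rule (h d Sig f : R -> R) :
  lbm f -> (forall t, 0 <= t -> Sig t = Sig 0 + \int[mu]_(r in `[0, t]) f r) ->
  {within `[0, +oo[, continuous (d \o Sig)} ->
  (forall t, 0 <= t -> is_derive (Sig t) (1 : R) h (d (Sig t))) ->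
  forall t, 0 <= t ->
    h (Sig t) = h (Sig 0) + \int[mu]_(r in `[0, t]) (d (Sig r) * f r).
Proof.
move=> lf SigE cd dh t t0.
have ld : lbm (d \o Sig) by exact: lbm_within_continuous.
have ldf : lbm (fun r => d (Sig r) * f r) := lbmM ld lf.
pose J u := \int[mu]_(r in `[0, u]) (d (Sig r) * f r).
pose G u := h (Sig u) - J u.
suff : G t = G 0.
  by rewrite /G /J set_itv1 Rintegral_set1 subr0 => /eqP; rewrite subr_eq => /eqP ->.
apply: small_increments_const => // e e0 u u0.
have [B0 HB0] := lf.2 (u + 1).
pose B := Num.max 1 B0; have B1 : 1 <= B by rewrite le_max lexx.
have HB r : 0 <= r <= u + 1 -> `|f r| <= B.
  by move=> /HB0 H; rewrite le_max H orbT.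
(* Each of the two errors will be at most [e1 * B * |s - u|], half of the allowed [e * |s - u|]. *)
pose e1 := e / (2 * B).
have e10 : 0 < e1 by rewrite divr_gt0// mulr_gt0//; lra.
have [eta1 eta10 H1] := is_derive_dist (dh _ u0) e10.
have [eta2 eta20 H2] := within_continuous_dist cd u0 e10.
(* Radius 1 keeps [f] bounded by [B], [eta1 / B] keeps [Sig s] within [eta1] of [Sig u], and [eta2]
   keeps [d (Sig r)] within [e1] of [d (Sig u)]. *)
exists (Num.min 1 (Num.min (eta1 / B) eta2)).
  by rewrite !lt_min ltr01 eta20 divr_gt0//; lra.
move=> s s0; rewrite !lt_min => /and3P[su1 suB su2].
have aux a b : 0 <= a -> a <= b -> `|a - u| <= `|s - u| -> `|b - u| <= `|s - u| ->
    `|Sig b - Sig a| <= B * (b - a) /\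
    `|(J b - J a) - d (Sig u) * (Sig b - Sig a)| <= e1 * B * (b - a).
  move=> a0 ab au bu.
  have inu r : a <= r <= b -> 0 <= r /\ `|r - u| <= `|s - u|.
    move=> /andP[ar rb]; split; first by rewrite (le_trans a0).
    by move: au bu; rewrite !ler_norml => /andP[? ?] /andP[? ?]; apply/andP; split; lra.
  have fB r : a <= r <= b -> `|f r| <= B.
    move=> /inu [r0 ru]; apply: HB; rewrite r0/=.
    by have := ler_norm (r - u); lra.
  have SE := Rintegral_increment lf SigE a0 ab.
  split; first by rewrite SE; exact: normr_lbm_Rintegral_le.
  have -> : J b - J a = \int[mu]_(r in `[a, b]) (d (Sig r) * f r).
    by rewrite /J (lbm_Rintegral_split ldf a0 ab) addrC addKr.
  rewrite SE -lbm_RintegralZ// -lbm_RintegralB//; last exact: lbmM (lbm_cst _) lf.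
  apply: normr_lbm_Rintegral_le => //.
    by apply: lbmB => //; exact: lbmM (lbm_cst _) lf.
  move=> r rab; rewrite -mulrBl normrM ler_pM ?fB//.
  have [r0 ru] := inu _ rab.
  by apply: H2 => //; exact: le_lt_trans su2.
have [S1 S2] : `|Sig s - Sig u| <= B * `|s - u| /\
    `|(J s - J u) - d (Sig u) * (Sig s - Sig u)| <= e1 * B * `|s - u|.
  have [us|su] := leP u s.
    have [||] := aux u s u0 us => //; first by rewrite subrr normr0.
    by rewrite (ger0_norm (_ : 0 <= s - u)) ?subr_ge0.
  have [||] := aux s u s0 (ltW su) => //; first by rewrite subrr normr0.
  rewrite (distrC s u) (ger0_norm (_ : 0 <= u - s)) ?subr_ge0 ?(ltW su)//.
  rewrite distrC => -> H; split => //.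
  by rewrite -normrN; congr (`|_| <= _) : H; ring.
have S3 := H1 (Sig s).
have {}S3 : `|h (Sig s) - h (Sig u) - d (Sig u) * (Sig s - Sig u)| <= e1 * (B * `|s - u|).
  rewrite (le_trans (S3 _))// ?ler_wpM2l// ?(ltW e10)//.
  by rewrite (le_lt_trans S1)// mulrC -ltr_pdivlMr//; lra.
have -> : G s - G u =
  (h (Sig s) - h (Sig u) - d (Sig u) * (Sig s - Sig u)) -
  ((J s - J u) - d (Sig u) * (Sig s - Sig u)) by rewrite /G; ring.
rewrite (le_trans (ler_normB _ _))// (le_trans (lerD S3 S2))//.
rewrite [leLHS](_ : _ = e * `|s - u|)// /e1; field; lra.
Qed.

End CalculusAlongTrajectories.

(** * Error variance trajectories *)

Section ErrorVariance.
Context {R : realType}.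
Local Notation mu := (@lebesgue_measure R).
Local Notation lbm := locally_bounded_measurable.

Definition variance_drift (s : site R) (pi : R -> bool) (Sig : R -> R) (r : R) : R :=
  2 * dynA s * Sig r + noiseW s
  - (pi r)%:R * (gainC s ^+ 2 / noiseV s) * Sig r ^+ 2.

Definition running_cost (s : site R) (lam : R) (pi : R -> bool) (Sig : R -> R)
    (t : R) : R :=
  weightT s * Sig t + (kappa s + lam) * (pi t)%:R.

Lemma within_continuous_distP (f : R -> R) :
  {within `[0, +oo[, continuous f} <->
  (forall t e : R, 0 <= t -> 0 < e -> exists2 eta : R, 0 < eta &
    forall s : R, 0 <= s -> `|s - t| < eta -> `|f s - f t| <= e).
Proof.
split=> [cf t e|H]; first exact: within_continuous_dist.
apply/subspace_continuousP => t; rewrite /= in_itv/= andbT => t0.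
apply/cvgrPdist_le => e e0; have [eta eta0 Heta] := H t e t0 e0.
exists eta => // s st; rewrite /= in_itv/= andbT => s0.
by rewrite distrC; apply: Heta => //; rewrite distrC.
Qed.

Lemma within_continuous_comp (g f : R -> R) :
  {within `[0, +oo[, continuous g} -> {within `[0, +oo[, continuous f} ->
  (forall t, 0 <= t -> 0 <= f t) -> {within `[0, +oo[, continuous (g \o f)}.
Proof.
move=> /within_continuous_distP cg /within_continuous_distP cf f0.
apply/within_continuous_distP => t e t0 e0.
have [d d0 Hd] := cg (f t) e (f0 _ t0) e0.
have [|eta eta0 Heta] := cf t (d / 2) t0; first by rewrite divr_gt0.
exists eta => // s s0 st; apply: Hd; first exact: f0.
by rewrite (le_lt_trans (Heta _ s0 st))//; lra.
Qed.

Section Trajectory.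
Variables (s : site R) (pi : R -> bool) (Sig : R -> R).
Hypotheses (hs : standing_assumptions s) (hpi : schedule pi)
  (hSig : error_variance s pi Sig).

Lemma lbm_error_variance : lbm Sig.
Proof. exact: lbm_within_continuous hSig.1. Qed.

Lemma lbm_schedule : lbm (fun t => (pi t)%:R).
Proof. exact: lbm_indicator. Qed.

Lemma lbm_variance_drift : lbm (variance_drift s pi Sig).
Proof.
apply: lbmB.
  by apply: lbmD; [apply: lbmM (lbm_cst _) lbm_error_variance | exact: lbm_cst].
apply: lbmM; first exact: lbmM lbm_schedule (lbm_cst _).
by under eq_fun do rewrite expr2; apply: lbmM; exact: lbm_error_variance.
Qed.

Lemma lbm_running_cost lam : lbm (running_cost s lam pi Sig).
Proof.
apply: lbmD; first exact: lbmM (lbm_cst _) lbm_error_variance.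
exact: lbmM (lbm_cst _) lbm_schedule.
Qed.

Lemma error_variance0 : Sig 0 = Sigma0 s.
Proof. by rewrite hSig.2// set_itv1 Rintegral_set1 addr0. Qed.

Lemma error_varianceE t : 0 <= t ->
  Sig t = Sig 0 + \int[mu]_(r in `[0, t]) variance_drift s pi Sig r.
Proof. by move=> t0; rewrite error_variance0 hSig.2. Qed.

Lemma gain_ge0 : 0 <= gainC s ^+ 2 / noiseV s.
Proof. by case: hs => _ _ V0 _ _; rewrite divr_ge0 ?sqr_ge0// ltW. Qed.

(** At the first time [u] where the variance is not positive, it is small just before [u], where the
    noise intensity dominates the drift. The variance is then nondecreasing up to [u], hence still
    positive there. *)
Lemma error_variance_gt0 t : 0 <= t -> 0 < Sig t.
Proof.
move=> t0; rewrite ltNge; apply/negP => St.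
pose Z := [set u : R | 0 <= u /\ Sig u <= 0].
have hZ : has_inf Z by split; [exists t | exists 0 => u []].
pose u := inf Z.
have u0 : 0 <= u by apply: lb_le_inf; [exists t | move=> ? []].
have posS r : 0 <= r -> r < u -> 0 < Sig r.
  move=> r0 ru; rewrite ltNge; apply/negP => Sr.
  by have := ge_inf hZ.2 (conj r0 Sr : Z r); rewrite leNgt ru.
have Su : Sig u <= 0.
  rewrite leNgt; apply/negP => Su.
  have Su2 : 0 < Sig u / 2 by rewrite divr_gt0.
  have [eta eta0 Heta] := within_continuous_dist hSig.1 u0 Su2.
  have [v [v0 Sv] vu] := inf_adherent eta0 hZ.
  have uv : u <= v by exact: (ge_inf hZ.2).
  have := Heta v v0; rewrite ger0_norm ?subr_ge0//.
  rewrite ltrBlDl => /(_ vu); rewrite ler_norml => /andP[H _]; lra.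
case: (hs) => S00 W0 V0 T0 _.
have u_gt0 : 0 < u.
  rewrite lt_neqAle u0 andbT; apply/eqP => u_0.
  by move: Su; rewrite -u_0 error_variance0 leNgt S00.
set g := gainC s ^+ 2 / noiseV s.
have g0 : 0 <= g := gain_ge0.
have a0 : 0 <= `|dynA s| by [].
(* For [|Sig r| <= c <= 1] the linear and quadratic terms are at most [2 |A| c] and [g c] in
   absolute value, and [c * D <= noiseW s] makes the drift nonnegative. The summand 1 only keeps [D]
   positive. *)
pose D := 2 * `|dynA s| + g + 1.
have D0 : 0 < D by rewrite /D; lra.
pose c := Num.min 1 (noiseW s / D).
have c0 : 0 < c by rewrite lt_min ltr01 divr_gt0.
have c1 : c <= 1 by rewrite ge_min lexx.
have cD : c * D <= noiseW s by rewrite -ler_pdivlMr// ge_min lexx orbT.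
have [eta eta0 Heta] := within_continuous_dist hSig.1 u0 c0.
pose b := Num.max 0 (u - eta / 2).
have b0 : 0 <= b by rewrite le_max lexx.
have bu : b < u by rewrite gt_max u_gt0/=; lra.
have small r : b <= r <= u -> `|Sig r| <= c.
  move=> /andP[br ru]; have r0 := le_trans b0 br.
  have near_u v : b <= v -> v <= u -> `|v - u| < eta.
    move=> bv vu; rewrite distrC ger0_norm ?subr_ge0//.
    by move: bv; rewrite ge_max => /andP[_]; lra.
  move: ru; rewrite le_eqVlt => /predU1P[->|ru].
    have := Heta b b0 (near_u _ (lexx _) (ltW bu)); have := posS b b0 bu.
    by rewrite !ler_norml => ? /andP[? ?]; apply/andP; split; lra.
  have := Heta r r0 (near_u _ br (ltW ru)); have := posS r r0 ru.
  by rewrite !ler_norml => ? /andP[? ?]; apply/andP; split; lra.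
have : 0 <= Sig u - Sig b.
  rewrite (Rintegral_increment lbm_variance_drift error_varianceE b0 (ltW bu)).
  rewrite -[leLHS](mul0r (u - b)) -Rintegral_itv_cst; last exact: ltW.
  apply: le_lbm_Rintegral => //; [exact: lbm_cst|exact: lbm_variance_drift|].
  move=> r /small Sc; rewrite /variance_drift -/g.
  have H1 : - (`|dynA s| * c) <= dynA s * Sig r.
    have : `|dynA s * Sig r| <= `|dynA s| * c by rewrite normrM ler_wpM2l.
    by rewrite ler_norml => /andP[].
  have H2 : (pi r)%:R * g * Sig r ^+ 2 <= g * c.
    apply: (@le_trans _ _ (g * Sig r ^+ 2)).
      by case: (pi r); rewrite ?mul1r// !mul0r mulr_ge0// sqr_ge0.
    rewrite ler_wpM2l// -real_normK ?num_real// expr2.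
    by rewrite -[leRHS]mul1r ler_pM// (le_trans Sc).
  rewrite /D in cD; nra.
have := posS b b0 bu; lra.
Qed.

(** The verification argument: the running cost plus [d (Sig r)] times the drift is the passive or
    the active term, according to [pi r], so it is at least [gam]. The chain rule integrates the
    second summand to an increment of [h]. *)
Lemma running_cost_lower (lam gam : R) (h d : R -> R) :
  (forall S : R, 0 < S -> is_derive S (1 : R) h (d S)) ->
  {within `[0, +oo[, continuous d} ->
  (forall S : R, 0 <= S -> gam <= passive_term s d S) ->
  (forall S : R, 0 <= S -> gam <= active_term s lam d S) ->
  forall t, 0 <= t ->
  gam * t + h (Sig 0) - h (Sig t) <= \int[mu]_(r in `[0, t]) running_cost s lam pi Sig r.
Proof.
move=> dh cd gp ga t t0.
have cdS : {within `[0, +oo[, continuous (d \o Sig)}.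
  apply: within_continuous_comp => //; first exact: hSig.1.
  by move=> r /error_variance_gt0/ltW.
rewrite (@lbm_chain_rule R h d Sig _ lbm_variance_drift error_varianceE cdS _ t t0); last first.
  by move=> r r0; exact/dh/error_variance_gt0.
have ldS : lbm (d \o Sig) := lbm_within_continuous cdS.
have lf := lbmM ldS lbm_variance_drift.
rewrite opprD addrA addrK lerBlDr.
rewrite -lbm_RintegralD//; last exact: lbm_running_cost.
rewrite -[X in X <= _](_ : \int[mu]_(_ in `[0, t]) gam = _); last first.
  by rewrite Rintegral_itv_cst// subr0.
apply: le_lbm_Rintegral => //; first exact: lbm_cst.
  by apply: lbmD => //; exact: lbm_running_cost.
move=> r /andP[r0 _]; have S0 := ltW (error_variance_gt0 r0).
have := gp _ S0; have := ga _ S0.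
rewrite /active_term /passive_term /active_drift /passive_drift /running_cost.
rewrite /variance_drift /=.
by case: (pi r) => /= H1 H2; lra.
Qed.

End Trajectory.
End ErrorVariance.

(** * Average costs *)

Section AverageCost.
Context {R : realType}.
Local Notation mu := (@lebesgue_measure R).
Local Notation lbm := locally_bounded_measurable.

Lemma average_cost_ge (c : R -> R) (v : R) :
  (forall e t0, 0 < e -> exists t, [/\ t0 < t, 0 < t &
     (v - e) * t <= \int[mu]_(r in `[0, t]) c r]) ->
  (v%:E <= average_cost c)%E.
Proof.
move=> H; apply: le_ereal_inf_tmp => /= _ [V [t0 [_ Vt0]] <-].
apply/lee_subgt0Pr => e e0; have [t [tt0 t_gt0 Ht]] := H e t0 e0.
apply: (@le_trans _ _ (t^-1 * \int[mu]_(r in `[0, t]) c r)%:E).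
  by rewrite -EFinB lee_fin mulrC ler_pdivlMr.
by apply: ereal_sup_ubound => /=; exists t => //; exact: Vt0.
Qed.

Lemma average_cost_le (c : R -> R) (v K : R) :
  (exists t0, forall t, t0 < t -> \int[mu]_(r in `[0, t]) c r <= v * t + K) ->
  (average_cost c <= v%:E)%E.
Proof.
move=> [t0 H]; apply/lee_addgt0Pr => e e0.
pose t1 := Num.max t0 (Num.max 0 (`|K| / e)).
apply: (@le_trans _ _ (ereal_sup [set (t^-1 * \int[mu]_(r in `[0, t]) c r)%:E |
    t in [set t | t1 < t]])).
  apply: ereal_inf_lbound => /=; exists [set t | t1 < t] => //.
  by exists t1; split => //; rewrite num_real.
apply: ge_ereal_sup => _ [t /= t1t <-].
move: t1t; rewrite !gt_max => /and3P[t0t t_gt0 Kt].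
rewrite -EFinD lee_fin mulrC ler_pdivrMr// (le_trans (H t t0t))//.
rewrite mulrDl lerD2l (le_trans (ler_norm _))// mulrC -ler_pdivrMr//.
exact: ltW.
Qed.

(** The bound [K] on the final variance controls the boundary term [h (Sig t)]. It is asked only for
    a positive weight, because a large unweighted variance does not show in the cost. [B] may depend
    on the trajectory but not on [t]. *)
Definition lower_certified (s : site R) (lam gam : R) : Prop :=
  forall pi Sig, schedule pi -> error_variance s pi Sig ->
  forall K, exists B, forall t, 0 <= t -> (0 < weightT s -> Sig t <= K) ->
    gam * t - B <= \int[mu]_(r in `[0, t]) running_cost s lam pi Sig r.

(* Either all the variances with positive weight are simultaneously bounded at
   arbitrarily late times, where the certificates add up, or from some time on
   one of them is so large that the running cost alone exceeds the bound.  The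
   dichotomy is needed because the limsup of a sum is not bounded below by the
   sum of the limsups. *)
Lemma average_cost_sum_ge (N : nat) (s : 'I_N -> site R) (lam k : R)
    (gam : 'I_N -> R) (pi : 'I_N -> R -> bool) (Sig : 'I_N -> R -> R) (c : R -> R) :
  (forall i, standing_assumptions (s i)) ->
  (forall i, lower_certified (s i) lam (gam i)) ->
  (forall i, schedule (pi i)) ->
  (forall i, error_variance (s i) (pi i) (Sig i)) ->
  (forall t, 0 <= t ->
     c t = \sum_(i < N) running_cost (s i) lam (pi i) (Sig i) t + k) ->
  ((\sum_(i < N) gam i + k)%:E <= average_cost c)%E.
Proof.
move=> hs hc hpi hSig cE; apply: average_cost_ge => e t0 e0.
pose G := \sum_(i < N) gam i; pose m := \sum_(i < N) `|kappa (s i) + lam|.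
(* Once the weighted variance [i] exceeds [K i], its term is more than [|G| + m], while all the
   observation costs together take away at most [m]; the total then exceeds [G]. *)
pose K i := (`|G| + m) / weightT (s i).
have /choice [B HB] : forall i, exists B, forall t, 0 <= t ->
    (0 < weightT (s i) -> Sig i t <= K i) ->
    gam i * t - B <= \int[mu]_(r in `[0, t]) running_cost (s i) lam (pi i) (Sig i) r.
  by move=> i; exact: hc.
pose C t := \sum_(i < N) running_cost (s i) lam (pi i) (Sig i) t.
have lrc i : lbm (running_cost (s i) lam (pi i) (Sig i)) by exact: lbm_running_cost.
have lC : lbm C by exact: lbm_sum.
have intc t : 0 <= t -> \int[mu]_(r in `[0, t]) c r = \int[mu]_(r in `[0, t]) C r + k * t.
  move=> t_ge0; rewrite (@eq_Rintegral_itv _ c (fun r => C r + k)).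
    by rewrite lbm_RintegralD//; [rewrite Rintegral_itv_cst// subr0|exact: lbm_cst].
  by move=> r /andP[r0 _]; rewrite cE.
have m0 : 0 <= m by exact: sumr_ge0.
have term_ge i t : 0 <= t ->
    weightT (s i) * Sig i t - `|kappa (s i) + lam| <=
    running_cost (s i) lam (pi i) (Sig i) t.
  move=> t_ge0; rewrite /running_cost lerD2l.
  have := ler_norm (- (kappa (s i) + lam)); rewrite normrN.
  have := normr_ge0 (kappa (s i) + lam).
  by case: (pi i t) => /=; lra.
have TS_ge0 i t : 0 <= t -> 0 <= weightT (s i) * Sig i t.
  move=> t_ge0; case: (hs i) => _ _ _ T0 _; rewrite mulr_ge0// ltW//.
  exact: (error_variance_gt0 (hs i) (hpi i) (hSig i)).
have C_ge t : 0 <= t -> - m <= C t.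
  move=> t_ge0; rewrite /m -sumrN; apply: ler_sum => i _.
  by rewrite (le_trans _ (term_ge i t t_ge0))// -subr_ge0 opprK subrK TS_ge0.
(* After [t1] the constants of the certificates sum to at most [e * t]. *)
pose t1 := Num.max t0 (Num.max 1 (`|\sum_(i < N) B i| / e)).
have t11 : 1 <= t1 by rewrite !le_max lexx orbT.
have [[t [t1t Ht]]|late] := pselect (exists t, t1 < t /\
    forall i, 0 < weightT (s i) -> Sig i t <= K i).
  move: (t1t); rewrite !gt_max => /and3P[t0t t1' tB].
  have t_gt0 : 0 < t by lra.
  exists t; split => //; rewrite intc ?(ltW t_gt0)// mulrBl mulrDl.
  rewrite [X in _ <= X + _]lbm_Rintegral_sum//.
  have : G * t - \sum_(i < N) B i <=
      \sum_(i < N) \int[mu]_(r in `[0, t]) running_cost (s i) lam (pi i) (Sig i) r.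
    rewrite /G mulr_suml -sumrB; apply: ler_sum => i _.
    by apply: HB; [exact: ltW|exact: Ht].
  have : \sum_(i < N) B i <= e * t.
    by rewrite (le_trans (ler_norm _))// mulrC -ler_pdivrMr// ltW.
  by rewrite -/G; lra.
have C_late t : t1 < t -> G <= C t.
  move=> t1t; have t_ge0 : 0 <= t by lra.
  have [i Ti Si] : exists2 i, 0 < weightT (s i) & K i < Sig i t.
    apply: contrapT => nex; apply: late; exists t; split => // i Ti.
    by rewrite leNgt; apply/negP => Si; apply: nex; exists i.
  have : `|G| + m <= weightT (s i) * Sig i t.
    by rewrite mulrC -ler_pdivrMr// ltW.
  have : weightT (s i) * Sig i t - m <= C t.
    rewrite /C (bigD1 i)//= /m (bigD1 i)//= opprD addrA lerD// ?term_ge//.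
    rewrite -sumrN; apply: ler_sum => j _.
    by rewrite (le_trans _ (term_ge j t t_ge0))// -subr_ge0 opprK subrK TS_ge0.
  by have := ler_norm G; lra.
(* [C_late] holds only strictly after [t1], hence the shift by 1. The time [t] is then so large that
   the loss on [[0, t2]], at most [(|G| + m) * t2], is below [e * t]. *)
pose t2 := t1 + 1.
pose t := Num.max (t2 + 1) ((`|G| + m) * t2 / e).
have tt2 : t2 + 1 <= t by rewrite le_max lexx.
have t0t1 : t0 <= t1 by rewrite le_max lexx.
exists t; split; [rewrite /t2 in tt2; lra|rewrite /t2 in tt2; lra|].
have t_ge0 : 0 <= t by rewrite /t2 in tt2; lra.
have t2_ge0 : 0 <= t2 by rewrite /t2; lra.
have t2t : t2 <= t by lra.
rewrite intc// (lbm_Rintegral_split lC t2_ge0 t2t).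
have I1 : - m * t2 <= \int[mu]_(r in `[0, t2]) C r.
  rewrite -[X in X <= _](_ : \int[mu]_(_ in `[0, t2]) (- m) = _); last first.
    by rewrite Rintegral_itv_cst// subr0.
  apply: le_lbm_Rintegral => //; first exact: lbm_cst.
  by move=> r /andP[r0 _]; exact: C_ge.
have I2 : G * (t - t2) <= \int[mu]_(r in `[t2, t]) C r.
  rewrite -Rintegral_itv_cst//; apply: le_lbm_Rintegral => //; first exact: lbm_cst.
  by move=> r /andP[r0 _]; apply: C_late; rewrite /t2 in r0; lra.
have I3 : (`|G| + m) * t2 <= e * t.
  by rewrite mulrC [leRHS]mulrC -ler_pdivrMr// mulrC le_max lexx orbT.
have : G * t2 <= `|G| * t2 by rewrite ler_wpM2r// ler_norm.
by rewrite -/G; lra.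
Qed.

Lemma single_site_value_ge (s : site R) (lam gam : R) :
  standing_assumptions s -> lower_certified s lam gam ->
  (gam%:E <= single_site_value s lam)%E.
Proof.
move=> hs hc; apply: le_ereal_inf_tmp => _ [pi [Sig [hpi hSig ->]]].
have := @average_cost_sum_ge 1 (fun=> s) lam 0 (fun=> gam) (fun=> pi) (fun=> Sig).
rewrite big_ord1 addr0; apply => // t t0; by rewrite big_ord1 addr0.
Qed.

(* Adding [theta] times the Riccati equation to the cost does not change the
   average cost as long as the variance stays bounded. *)
Lemma single_site_value_le (s : site R) (lam v theta B : R) (pi : R -> bool)
    (Sig : R -> R) :
  schedule pi -> error_variance s pi Sig ->
  (exists2 t0, 0 <= t0 & forall t, t0 <= t -> `|Sig t| <= B /\
    running_cost s lam pi Sig t + theta * variance_drift s pi Sig t <= v) ->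
  (single_site_value s lam <= v%:E)%E.
Proof.
move=> hpi hSig [t0 t00 H].
apply: (@le_trans _ _ (average_cost (running_cost s lam pi Sig))).
  by apply: ereal_inf_lbound; exists pi, Sig.
have lf := lbm_variance_drift hpi hSig.
have lc := lbm_running_cost hpi hSig lam.
have lcf := lbmD lc (lbmM (lbm_cst theta) lf).
pose I := \int[mu]_(r in `[0, t0])
  (running_cost s lam pi Sig r + theta * variance_drift s pi Sig r).
apply: (@average_cost_le _ _ (I - v * t0 + `|theta| * (B + `|Sig 0|))).
exists t0 => t t0t; have t_ge0 : 0 <= t by rewrite (le_trans t00)// ltW.
have E : \int[mu]_(r in `[0, t]) running_cost s lam pi Sig r =
    \int[mu]_(r in `[0, t]) (running_cost s lam pi Sig r + theta * variance_drift s pi Sig r)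
    - theta * (Sig t - Sig 0).
  rewrite (lbm_RintegralD t lc (lbmM (lbm_cst theta) lf) (lexx 0)).
  by rewrite lbm_RintegralZ// (error_varianceE hSig t_ge0); ring.
rewrite E (lbm_Rintegral_split lcf t00 (ltW t0t)) -/I.
have I2 : \int[mu]_(r in `[t0, t])
    (running_cost s lam pi Sig r + theta * variance_drift s pi Sig r) <= v * (t - t0).
  rewrite -(Rintegral_itv_cst v (ltW t0t)); apply: le_lbm_Rintegral => //; first exact: lbm_cst.
  by move=> r /andP[/H[]].
have [SB _] := H t (ltW t0t).
have : - (theta * (Sig t - Sig 0)) <= `|theta| * (B + `|Sig 0|).
  rewrite (le_trans (ler_norm _))// normrN normrM ler_wpM2l//.
  by rewrite (le_trans (ler_normB _ _))// lerD2r.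
lra.
Qed.

End AverageCost.

(** * Piecewise smooth trajectories *)

Section PiecewiseTrajectories.
Context {R : realType}.
Local Notation mu := (@lebesgue_measure R).
Local Notation lbm := locally_bounded_measurable.

Definition variance_field (s : site R) (b : bool) (S : R) : R :=
  2 * dynA s * S + noiseW s - b%:R * (gainC s ^+ 2 / noiseV s) * S ^+ 2.

Lemma is_derive_continuous (F : R -> R) (x df : R) :
  is_derive x 1 F df -> {for x, continuous F}.
Proof. by move=> [dF _]; apply: differentiable_continuous; exact/derivable1_diffP. Qed.

Lemma Rintegral_FTC2 (F f : R -> R) (a b : R) : a <= b ->
  (forall r, a <= r <= b -> is_derive r 1 F (f r)) ->
  {within `[a, b], continuous f} ->
  \int[mu]_(r in `[a, b]) f r = F b - F a.
Proof.
move=> ab dF cf; move: ab; rewrite le_eqVlt => /predU1P[abE|ab].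
  by rewrite abE set_itv1 Rintegral_set1 subrr.
have cF r : a <= r <= b -> {for r, continuous F}.
  by move=> /dF; exact: is_derive_continuous.
rewrite /Rintegral (@continuous_FTC2 _ f F)//.
- split.
  + move=> r; rewrite in_itv/= => /andP[ar rb].
    by have [] := dF r; rewrite ?(ltW ar) ?(ltW rb).
  + by apply: cvg_at_right_filter; apply: cF; rewrite lexx ltW.
  + by apply: cvg_at_left_filter; apply: cF; rewrite lexx ltW.
- move=> r; rewrite in_itv/= => /andP[ar rb].
  have /dF[_ <-] : a <= r <= b by rewrite (ltW ar) (ltW rb).
  by rewrite derive1E.
Qed.

(** * Gluing flows over a uniform time grid *)

Section Grid.
Variables (s : site R) (delta : R) (b : nat -> bool) (y : nat -> R -> R).
Hypotheses (delta0 : 0 < delta) (y0 : y 0 0 = Sigma0 s)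
  (ynext : forall n, y n.+1 0 = y n delta)
  (dy : forall n (r : R), 0 <= r -> is_derive r (1 : R) (y n) (variance_field s (b n) (y n r))).

Let cell (t : R) : nat := Num.truncn (t / delta).
Let gpi (t : R) : bool := b (cell t).
Let gSig (t : R) : R := y (cell t) (t - (cell t)%:R * delta).

Let cellP (t : R) : 0 <= t -> (cell t)%:R * delta <= t < (cell t).+1%:R * delta.
Proof.
move=> t0; have : 0 <= t / delta by rewrite divr_ge0// ltW.
by move=> /truncn_itv; rewrite ler_pdivlMr// ltr_pdivrMr.
Qed.

Let cellE n (t : R) : n%:R * delta <= t -> t < n.+1%:R * delta -> cell t = n.
Proof.
move=> nt tn; apply: truncn_def.
by rewrite ler_pdivlMr// ltr_pdivrMr// nt.
Qed.

Let gSigE n (t : R) : n%:R * delta <= t -> t <= n.+1%:R * delta ->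
  gSig t = y n (t - n%:R * delta).
Proof.
move=> nt; rewrite le_eqVlt => /predU1P[->|tn]; last by rewrite /gSig (cellE nt tn).
rewrite /gSig (@cellE n.+1)//; last by rewrite ltr_pM2r// ltr_nat.
by rewrite subrr ynext -mulrBl -natrB// subSnn mul1r.
Qed.

Let cy n (r : R) : 0 <= r -> {for r, continuous (y n)}.
Proof. by move=> r0; exact: is_derive_continuous (dy n r0). Qed.

Let clamp (t : R) : R := Num.max 0 (Num.min t delta).

Let clampC : continuous clamp.
Proof.
move=> t; apply: (@continuous_max _ _ (fun=> 0) (fun t => Num.min t delta)).
  exact: cst_continuous.
by apply: (@continuous_min _ _ id (fun=> delta)); [exact: cvg_id|exact: cst_continuous].
Qed.

(** Past cells contribute their full increment, the current one a partial increment, later ones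
    nothing. Each summand is continuous where it is used, so continuity of the glued function
    follows without examining the grid points. *)
Let gSig_clamp n (t : R) : 0 <= t -> t <= n%:R * delta ->
  gSig t = Sigma0 s + \sum_(k < n) (y k (clamp (t - k%:R * delta)) - y k 0).
Proof.
elim: n t => [|n IH] t t0 tn.
  have -> : t = 0 by apply/eqP; rewrite eq_le t0 andbT -(mul0r delta).
  by rewrite big_ord0 addr0 (@gSigE 0) ?mul0r ?subr0//; exact: mulr_ge0 (ltW delta0).
rewrite big_ord_recr/=; have [nt|nt] := leP (n%:R * delta) t.
  rewrite (gSigE nt tn).
  have E : gSig (n%:R * delta) = y n 0.
    by rewrite (@gSigE n) ?subrr// ler_pM2r// ler_nat.
  rewrite (_ : \sum_(k < n) _ = gSig (n%:R * delta) - Sigma0 s).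
    rewrite E /clamp min_l; last by rewrite lerBlDl -[X in _ + X]mul1r -mulrDl natr1.
    by rewrite max_r ?subr_ge0//; ring.
  rewrite IH// ?mulr_ge0// ?(ltW delta0)// addrAC subrr add0r.
  apply: eq_bigr => k _; congr (y _ _ - _).
  rewrite /clamp !min_r//; rewrite -?mulrBl.
    by rewrite -[leLHS]mul1r ler_pM2r// lerBrDl natr1 ler_nat.
  rewrite lerBrDl (le_trans _ nt)// -[X in _ + X]mul1r -mulrDl.
  by rewrite ler_pM2r// natr1 ler_nat.
have -> : clamp (t - n%:R * delta) = 0.
  by rewrite /clamp max_l// ge_min subr_le0 (ltW nt).
by rewrite subrr addr0 IH// ltW.
Qed.

Let gSigC : {within `[0, +oo[, continuous gSig}.
Proof.
apply/within_continuous_distP => t e t0 e0.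
(* One cell more than the one containing [t], so that all times within [delta] of [t] are covered by
   the same finite sum. *)
pose n := (cell t).+2.
pose Q u := Sigma0 s + \sum_(k < n) (y k (clamp (u - k%:R * delta)) - y k 0).
have cl0 (u : R) : 0 <= clamp u by rewrite /clamp le_max lexx.
have cterm k : {for t, continuous (fun u => y k (clamp (u - k%:R * delta)) - y k 0)}.
  apply: cvgB; last exact: cvg_cst.
  have H : {for t, continuous (clamp \o (fun u => u - k%:R * delta))}.
    apply: continuous_comp; last exact: clampC.
    by apply: cvgB; [exact: cvg_id|exact: cvg_cst].
  by apply: (@continuous_comp _ _ _ _ (y k) t H); apply: cy; exact: cl0.
pose P m (u : R) := \sum_(k < m) (y k (clamp (u - k%:R * delta)) - y k 0).
have csum m : {for t, continuous (P m)}.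
  elim: m => [|m IH].
    have -> : P 0 = fun=> 0 by apply/funext => u; rewrite /P big_ord0.
    exact: cvg_cst.
  have -> : P m.+1 = fun u => P m u + (y m (clamp (u - m%:R * delta)) - y m 0).
    by apply/funext => u; rewrite /P big_ord_recr.
  by apply: cvgD; [exact: IH|exact: cterm].
have cQ : {for t, continuous Q} by apply: cvgD; [exact: cvg_cst|exact: csum].
have /cvgrPdist_le/(_ _ e0) [eta eta0 Heta] := cQ.
exists (Num.min eta delta) => [|u u0]; first by rewrite lt_min eta0.
rewrite lt_min => /andP[ue ud].
have tn : t < (cell t).+1%:R * delta by have /andP[] := cellP t0.
have nE : n%:R * delta = (cell t).+1%:R * delta + delta.
  by rewrite /n -[in LHS]natr1 mulrDl mul1r.
rewrite (@gSig_clamp n u)//; last first.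
  by have := ler_norm (u - t); rewrite nE; lra.
rewrite (@gSig_clamp n t)//; last by rewrite nE (le_trans (ltW tn))// lerDl ltW.
by rewrite distrC; apply: Heta; rewrite /= distrC.
Qed.

Let gpi_schedule : schedule gpi.
Proof.
rewrite /schedule.
have -> : [set` `[0 : R, +oo[] = \bigcup_(n : nat) [set` `[n%:R * delta, n.+1%:R * delta[].
  apply/seteqP; split=> t /=; rewrite ?in_itv/= ?andbT.
    by move=> t0; exists (cell t) => //=; rewrite in_itv/=; exact: cellP.
  move=> [n _]; rewrite /= in_itv/= => /andP[nt _].
  by rewrite (le_trans _ nt)// mulr_ge0// ltW.
apply/measurable_fun_bigcup => // n.
apply: (@eq_measurable_fun _ _ _ _ _ (fun=> b n)); last exact: measurable_cst.
by move=> t; rewrite inE/= in_itv/= => /andP[nt tn]; rewrite /gpi (cellE nt tn).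
Qed.

(** The integral equation holds on each cell by the fundamental theorem of calculus and is added up
    over the cells. The pointwise description is on half-open cells because [pi] may jump at the
    grid points. *)
Lemma grid_trajectory : exists pi Sig, [/\ schedule pi, error_variance s pi Sig &
  forall n (t : R), n%:R * delta <= t -> t < n.+1%:R * delta ->
    pi t = b n /\ Sig t = y n (t - n%:R * delta)].
Proof.
exists gpi, gSig; split => //; last first.
  by move=> n t nt tn; rewrite /gpi (cellE nt tn) (gSigE nt (ltW tn)).
split => // t t0.
pose f r := variance_field s (gpi r) (gSig r).
have lS : lbm gSig by exact: lbm_within_continuous.
have lf : lbm f.
  apply: lbmB.
    by apply: lbmD; [exact: lbmM (lbm_cst _) lS | exact: lbm_cst].
  apply: lbmM; first exact: lbmM (lbm_indicator gpi_schedule) (lbm_cst _).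
  by under eq_fun do rewrite expr2; exact: lbmM.
have piece n (u : R) : n%:R * delta <= u -> u <= n.+1%:R * delta ->
    \int[mu]_(r in `[n%:R * delta, u]) f r = gSig u - gSig (n%:R * delta).
  move=> nu un; have nd0 : 0 <= n%:R * delta by rewrite mulr_ge0// ltW.
  pose fn r := variance_field s (b n) (y n (r - n%:R * delta)).
  have dF (r : R) : n%:R * delta <= r <= u ->
      is_derive r 1 (fun r => y n (r - n%:R * delta)) (fn r).
    move=> /andP[nr _]; have r0 : 0 <= r - n%:R * delta by rewrite subr_ge0.
    have H := dy n r0.
    have H2 : is_derive r (1 : R) (fun r => r - n%:R * delta) (1 - 0).
      exact: is_deriveB.
    have := @is_derive1_comp _ (y n) (fun r => r - n%:R * delta) r _ _ H H2.
    by rewrite subr0 mulr1.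
  have cfn : {within `[n%:R * delta, u], continuous fn}.
    apply: continuous_in_subspaceT => r; rewrite inE/= in_itv/= => /dF dr.
    have cyr := is_derive_continuous dr.
    apply: cvgB; first by apply: cvgD; [apply: cvgM => //; exact: cvg_cst|exact: cvg_cst].
    by apply: cvgM; [exact: cvg_cst|apply: cvgM].
  rewrite (gSigE nu un) (@gSigE n (n%:R * delta)) ?ler_pM2r ?ler_nat//.
  rewrite -(Rintegral_FTC2 nu dF cfn).
  have lfn : mu.-integrable `[n%:R * delta, u] (EFin \o fn).
    by apply: continuous_compact_integrable => //; exact: segment_compact.
  apply: eq_Rintegral_itv_co => //; first exact: lbm_integrable.
  move=> r /andP[nr ru].
  have rn := lt_le_trans ru un.
  by rewrite /f /fn /gpi (cellE nr rn) (gSigE nr (ltW rn)).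
have gS0 : gSig 0 = Sigma0 s by rewrite (@gSigE 0) ?mul0r ?subr0// mulr_ge0// ltW.
have full n : \int[mu]_(r in `[0, n%:R * delta]) f r = gSig (n%:R * delta) - gSig 0.
  elim: n => [|n IH]; first by rewrite mul0r set_itv1 Rintegral_set1 subrr.
  have le_n : n%:R * delta <= n.+1%:R * delta by rewrite ler_pM2r// ler_nat.
  rewrite (@lbm_Rintegral_split _ f (n%:R * delta))// ?mulr_ge0// ?(ltW delta0)//.
  by rewrite IH piece//; ring.
have /andP[ct tc] := cellP t0.
rewrite -/(f _) -gS0 -[LHS](subrK (gSig ((cell t)%:R * delta))).
rewrite -(piece _ _ ct (ltW tc)) (@lbm_Rintegral_split _ f ((cell t)%:R * delta))//.
  by rewrite full; ring.
by rewrite mulr_ge0// ltW.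
Qed.

End Grid.
End PiecewiseTrajectories.

(** * Holding the variance near a level *)

Section Controllability.
Context {R : realType}.

Section Roots.
Variables (s : site R).
Hypotheses (hs : standing_assumptions s) (hC : gainC s != 0).

Definition gain_ratio (s : site R) : R := gainC s ^+ 2 / noiseV s.

Lemma gain_ratio_gt0 : 0 < gain_ratio s.
Proof. by case: hs => _ _ V0 _ _; rewrite divr_gt0// exprn_even_gt0. Qed.

Lemma root_x1_lt0 : root_x1 s < 0.
Proof.
have g0 := gain_ratio_gt0; case: hs => _ W0 V0 _ _.
rewrite /root_x1 ltr_pdivrMr// mul0r subr_lt0.
rewrite (le_lt_trans (ler_norm _))// -sqrtr_sqr ltr_sqrt ?ltrDl.
  by rewrite divr_gt0// mulr_gt0// exprn_even_gt0.
by rewrite ltr_wpDl ?sqr_ge0// divr_gt0// mulr_gt0// exprn_even_gt0.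
Qed.

Lemma root_x2_gt0 : 0 < root_x2 s.
Proof.
have g0 := gain_ratio_gt0; case: hs => _ W0 V0 _ _.
rewrite /root_x2 divr_gt0// -ltrBlDl sub0r.
rewrite (le_lt_trans (ler_norm _))// normrN -sqrtr_sqr ltr_sqrt ?ltrDl.
  by rewrite divr_gt0// mulr_gt0// exprn_even_gt0.
by rewrite ltr_wpDl ?sqr_ge0// divr_gt0// mulr_gt0// exprn_even_gt0.
Qed.

Lemma active_driftE (S : R) :
  active_drift s S = - gain_ratio s * (S - root_x1 s) * (S - root_x2 s).
Proof.
have g0 := gain_ratio_gt0; case: hs => _ W0 V0 _ _.
rewrite /active_drift /root_x1 /root_x2 -/(gain_ratio s).
set Q := Num.sqrt _.
have Q2 : Q ^+ 2 = dynA s ^+ 2 + gain_ratio s * noiseW s.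
  have -> : gain_ratio s * noiseW s = gainC s ^+ 2 * noiseW s / noiseV s.
    by rewrite /gain_ratio mulrAC.
  apply: sqr_sqrtr; apply: addr_ge0; first exact: sqr_ge0.
  by apply: divr_ge0; rewrite ltW// mulr_gt0// exprn_even_gt0.
have gn0 : gain_ratio s != 0 by rewrite gt_eqF.
have -> : - gain_ratio s * (S - (dynA s - Q) / gain_ratio s) *
   (S - (dynA s + Q) / gain_ratio s) =
   - (gain_ratio s * S ^+ 2 - 2 * dynA s * S + (dynA s ^+ 2 - Q ^+ 2) / gain_ratio s).
  by field.
by rewrite Q2; field.
Qed.

End Roots.

(** * Explicit flows of the two actions *)

Section PassiveFlow.
Variable a : R.

(** The solution of [y' = 1 + 2 a y], [y(0) = 0], that is, the integral of [exp (2 a u)] over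
    [[0, t]]. It gives one formula for the passive flow whatever the sign of [A]; the case [a = 0]
    is the limit of the quotient. *)
Definition exp_growth (t : R) : R :=
  if a == 0 then t else (expR (2 * a * t) - 1) / (2 * a).

Lemma exp_growth0 : exp_growth 0 = 0.
Proof. by rewrite /exp_growth mulr0 expR0 subrr mul0r if_same. Qed.

Lemma is_derive_exp_growth (t : R) :
  is_derive t (1 : R) exp_growth (1 + 2 * a * exp_growth t).
Proof.
rewrite /exp_growth; have [->|a0] := eqVneq a 0.
  by rewrite mulr0 mul0r addr0; exact: is_derive_id.
have -> : (fun t => (expR (2 * a * t) - 1) / (2 * a)) =
    (fun t => (2 * a)^-1 * (expR (2 * a * t) - 1)).
  by apply/funext => u; rewrite mulrC.
have d1 : is_derive t (1 : R) (fun t : R => 2 * a * t) (2 * a * 1).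
  exact: is_deriveZ.
have d2 := is_derive1_comp (is_derive_expR (2 * a * t)) d1.
have d3 : is_derive t (1 : R) (fun t => expR (2 * a * t) - 1)
   (expR (2 * a * t) * (2 * a * 1) - 0).
  exact: is_deriveB.
have H := @is_deriveZ _ _ _ _ (2 * a)^-1 _ _ _ d3.
by apply: (is_derive_eq H); rewrite /GRing.scale/=; field.
Qed.

Lemma exp_growth_gt0 (t : R) : 0 < t -> 0 < exp_growth t.
Proof.
move=> t0; rewrite /exp_growth; case: (ltgtP a 0) => a0 //.
  have e1 : expR (2 * a * t) - 1 < 0 by rewrite subr_lt0 expR_lt1; nra.
  by rewrite nmulr_rgt0// invr_lt0; lra.
by rewrite divr_gt0//; [rewrite subr_gt0 expR_gt1; nra | lra].
Qed.

Lemma exp_growth_ge0 (t : R) : 0 <= t -> 0 <= exp_growth t.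
Proof.
by rewrite le_eqVlt => /predU1P[<-|/exp_growth_gt0/ltW//]; rewrite exp_growth0.
Qed.

End PassiveFlow.

Lemma passive_flow (s : site R) (S t : R) :
  is_derive t (1 : R) (fun t => S + passive_drift s S * exp_growth (dynA s) t)
    (variance_field s false (S + passive_drift s S * exp_growth (dynA s) t)).
Proof.
have d1 := @is_deriveZ _ _ _ _ (passive_drift s S) _ _ _ (is_derive_exp_growth (dynA s) t).
have H := @is_deriveD _ _ _ _ _ _ _ _ _ (is_derive_cst S t (1 : R)) d1.
apply: (is_derive_eq H); rewrite /GRing.scale/= /variance_field /passive_drift/=; ring.
Qed.

Definition saturation (rho t : R) : R := 1 - expR (- rho * t).

Lemma saturation0 rho : saturation rho 0 = 0.
Proof. by rewrite /saturation mulr0 expR0 subrr. Qed.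

Lemma saturation_lt1 rho t : saturation rho t < 1.
Proof. by rewrite /saturation ltrBlDr ltrDl expR_gt0. Qed.

Lemma saturation_ge0 (rho t : R) : 0 <= rho -> 0 <= t -> 0 <= saturation rho t.
Proof.
by move=> r0 t0; rewrite /saturation subr_ge0 expR_le1 mulNr oppr_le0 mulr_ge0.
Qed.

Lemma saturation_gt0 (rho t : R) : 0 < rho -> 0 < t -> 0 < saturation rho t.
Proof.
by move=> r0 t0; rewrite /saturation subr_gt0 expR_lt1 mulNr oppr_lt0 mulr_gt0.
Qed.

Lemma is_derive_saturation (rho t : R) :
  is_derive t (1 : R) (saturation rho) (rho * (1 - saturation rho t)).
Proof.
have d1 : is_derive t (1 : R) (fun t : R => - rho * t) (- rho * 1).
  exact: is_deriveZ.
have d2 := is_derive1_comp (is_derive_expR (- rho * t)) d1.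
have H := @is_deriveB _ _ _ _ _ _ _ _ _ (is_derive_cst (1 : R) t (1 : R)) d2.
by apply: (is_derive_eq H); rewrite /saturation; ring.
Qed.

(* The substitution [z = 1 / (S - x1)] linearizes the Riccati equation. *)
Definition riccati_flow (s : site R) (S t : R) : R :=
  let z0 := (S - root_x1 s)^-1 in
  let zoo := (root_x2 s - root_x1 s)^-1 in
  root_x1 s + (z0 + (zoo - z0) *
    saturation (gain_ratio s * (root_x2 s - root_x1 s)) t)^-1.

(** For [z = 1 / (S - x1)] the factored drift gives [z' = rho (zoo - z)] with [rho = g (x2 - x1)].
    Since [z] stays between the positive numbers [z0] and [zoo], it can be inverted. *)
Lemma riccati_flowP (s : site R) (S t : R) : standing_assumptions s ->
  gainC s != 0 -> root_x1 s < S -> 0 <= t ->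
  is_derive t (1 : R) (riccati_flow s S) (variance_field s true (riccati_flow s S t)).
Proof.
move=> hs hC x1S t0.
have g0 := gain_ratio_gt0 hs hC.
have x10 := root_x1_lt0 hs hC; have x20 := root_x2_gt0 hs hC.
set rho := gain_ratio s * (root_x2 s - root_x1 s).
have rho0 : 0 < rho by rewrite mulr_gt0//; lra.
set z0 := (S - root_x1 s)^-1; set zoo := (root_x2 s - root_x1 s)^-1.
have z00 : 0 < z0 by rewrite invr_gt0 subr_gt0.
have zoo0 : 0 < zoo by rewrite invr_gt0; lra.
pose z u := z0 + (zoo - z0) * saturation rho u.
have zt : 0 < z t.
  have := saturation_lt1 rho t; have := saturation_ge0 (ltW rho0) t0.
  by rewrite /z; move: (saturation rho t) => D *; nra.
have dz : is_derive t (1 : R) z (rho * (zoo - z t)).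
  have d1 := @is_deriveZ _ _ _ _ (zoo - z0) _ _ _ (is_derive_saturation rho t).
  have H := @is_deriveD _ _ _ _ _ _ _ _ _ (is_derive_cst z0 t (1 : R)) d1.
  by apply: (is_derive_eq H); rewrite /z /GRing.scale/=; ring.
have dzV := @is_deriveV _ z t _ 1 (lt0r_neq0 zt) dz.
have H := @is_deriveD _ _ _ _ _ _ _ _ _ (is_derive_cst (root_x1 s) t (1 : R)) dzV.
have -> : variance_field s true (riccati_flow s S t) = active_drift s (riccati_flow s S t).
  by rewrite /variance_field mul1r.
rewrite active_driftE// /riccati_flow -/rho -/z0 -/zoo -/(z t).
apply: (is_derive_eq H); rewrite /GRing.scale/=.
have -> : zoo = (root_x2 s - root_x1 s)^-1 by [].
rewrite /rho; field; apply/andP; split; first exact: lt0r_neq0.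
by apply: lt0r_neq0; lra.
Qed.

Lemma no_bounded_progress (u : nat -> R) (c M : R) : 0 < c ->
  (forall n, u n + c <= u n.+1) -> ~ (forall n, u n <= M).
Proof.
move=> c0 hu hM.
have H n : u 0 + n%:R * c <= u n.
  elim: n => [|n IH]; first by rewrite mul0r addr0.
  by rewrite (le_trans _ (hu n))// -natr1 mulrDl mul1r addrA lerD2r.
have := archi_boundP (normr_ge0 ((M - u 0) / c)).
set n := Num.bound _ => /(le_lt_trans (ler_norm _)).
by rewrite ltr_pdivrMr// => Hn; have := H n; have := hM n; lra.
Qed.

Lemma is_derive_near0 (f : R -> R) (df e : R) : is_derive (0 : R) (1 : R) f df -> f 0 = 0 ->
  0 < e -> exists2 eta : R, 0 < eta & forall t : R, 0 <= t -> t <= eta -> `|f t| <= e.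
Proof.
move=> /is_derive_continuous/cvgrPdist_le cf f0 e0.
have [eta eta0 Heta] := cf e e0; exists (eta / 2); first by rewrite divr_gt0.
move=> t t0 te; have := Heta t; rewrite f0 sub0r normrN; apply.
by rewrite /= sub0r normrN ger0_norm//; move: eta0 => /=; lra.
Qed.

(** * Sampled bang-bang control around a level, for abstract flows *)

Section BangBang.
Variables (f0 f1 : R -> R -> R) (X eps delta S0 c0 c1 M : R) (phi : R -> R).
Hypotheses (S00 : 0 <= S0) (eps0 : 0 < eps) (epsX : eps <= X) (delta0 : 0 <= delta)
  (c00 : 0 < c0) (c10 : 0 < c1)
  (f0P : forall S t : R, 0 <= S -> S <= X -> 0 <= t -> t <= delta ->
    S <= f0 S t <= X + eps)
  (f0_up : forall S : R, 0 <= S -> S <= X -> S + c0 <= f0 S delta)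
  (f1P : forall S t : R, X <= S -> 0 <= t -> t <= delta -> X - eps <= f1 S t <= S)
  (phi_le : forall S : R, X <= S -> phi S <= M)
  (f1_down : forall S : R, X <= S -> phi S + c1 <= phi (f1 S delta)).

(** The action is chosen from the side of [X] at the start of a period and kept for the whole
    period. A feedback switching instantly at [X] would slide along [X], which no 0/1 action
    realizes. *)
Definition bang_bang (S : R) : R -> R := if S <= X then f0 S else f1 S.
Definition bang_bang_state (n : nat) : R := iter n (fun S => bang_bang S delta) S0.
Local Notation Sn := bang_bang_state.

Let SnS n : Sn n.+1 = bang_bang (Sn n) delta. Proof. by []. Qed.

Lemma bang_bang_state_ge0 n : 0 <= Sn n.
Proof.
elim: n => // n IH; rewrite SnS /bang_bang; case: (leP (Sn n) X) => SX.
  by have /andP[+ _] := f0P IH SX delta0 (lexx _); exact: le_trans.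
have /andP[+ _] := f1P (ltW SX) delta0 (lexx _); apply: le_trans.
by rewrite subr_ge0.
Qed.

Lemma bang_bang_band (S t : R) : `|S - X| <= eps -> 0 <= t -> t <= delta ->
  `|bang_bang S t - X| <= eps.
Proof.
rewrite !ler_distl => /andP[SX1 SX2] t0 td; rewrite /bang_bang.
case: (leP S X) => SX.
  have S_ge0 : 0 <= S by rewrite (le_trans _ SX1)// subr_ge0.
  by have /andP[F1 ->] := f0P S_ge0 SX t0 td; rewrite (le_trans SX1).
by have /andP[-> F2] := f1P (ltW SX) t0 td; rewrite (le_trans F2).
Qed.

(** One period cannot jump over the band: from below it ends at most at [X + eps], from above at
    least at [X - eps]. A state that never enters thus stays on one side, where [S] or [phi] grows
    by a fixed amount each period while remaining bounded. *)
Lemma bang_bang_enters : exists n, `|Sn n - X| <= eps.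
Proof.
apply: contrapT => /forallNP notin.
have out n : Sn n < X - eps \/ X + eps < Sn n.
  by have /negP := notin n; rewrite ler_distl negb_and -!ltNge => /orP.
have XeX : X - eps <= X by rewrite gerBl ltW.
have XXe : X <= X + eps by rewrite lerDl ltW.
case: (out 0%N) => out0.
  have low n : Sn n < X - eps.
    elim: n => // n IH; case: (out n.+1) => //.
    have SX := le_trans (ltW IH) XeX.
    have /andP[_ H] := f0P (bang_bang_state_ge0 n) SX delta0 (lexx _).
    by rewrite SnS /bang_bang SX ltNge H.
  apply: (@no_bounded_progress Sn c0 X) => // n.
    have SX := le_trans (ltW (low n)) XeX.
    by rewrite SnS /bang_bang SX f0_up// bang_bang_state_ge0.
  exact: le_trans (ltW (low n)) XeX.
have high n : X + eps < Sn n.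
  elim: n => // n IH; case: (out n.+1) => //.
  have SX := le_lt_trans XXe IH.
  have /andP[H _] := f1P (ltW SX) delta0 (lexx _).
  by rewrite SnS /bang_bang leNgt SX/= ltNge H.
apply: (@no_bounded_progress (fun n => phi (Sn n)) c1 M) => // n.
  have SX := le_lt_trans XXe (high n).
  by rewrite SnS /bang_bang [_ <= X]leNgt SX/= f1_down// ltW.
by apply/phi_le/ltW/(le_lt_trans XXe).
Qed.

Lemma bang_bang_stays : exists n0, forall n, (n0 <= n)%N -> `|Sn n - X| <= eps.
Proof.
have [n0 Hn0] := bang_bang_enters; exists n0; elim=> [|n IH].
  by rewrite leqn0 => /eqP <-.
rewrite leq_eqVlt => /predU1P[<-//|/IH H].
by rewrite SnS; apply: bang_bang_band.
Qed.

End BangBang.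

(** The duration [d] has to be uniform in [S >= X], although the drift is unbounded there. In the
    variable [z] the starting values fill the bounded interval [(0, zX]], and [z] grows by at most
    [zoo] times the saturation, which is made smaller than [ze - zX]. *)
Lemma riccati_flow_bounds (s : site R) (X eps : R) :
  standing_assumptions s -> gainC s != 0 -> 0 < eps -> eps < X - root_x2 s ->
  exists2 d, 0 < d & forall S t : R, X <= S -> 0 <= t -> t <= d ->
    X - eps <= riccati_flow s S t <= S.
Proof.
move=> hs hC eps0 epsX.
have x10 := root_x1_lt0 hs hC; have x20 := root_x2_gt0 hs hC.
have g0 := gain_ratio_gt0 hs hC.
rewrite /riccati_flow; move: (root_x1 s) (root_x2 s) x10 x20 epsX => x1 x2 x10 x20 epsX.
have x12 : 0 < x2 - x1 by rewrite subr_gt0 (lt_trans x10).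
have Xex1 : 0 < X - eps - x1 by lra.
have Xx1 : 0 < X - x1 by lra.
have rho0 : 0 < gain_ratio s * (x2 - x1) by rewrite mulr_gt0.
move: (gain_ratio s * _) rho0 => rho rho0.
pose zX := (X - x1)^-1; pose zoo := (x2 - x1)^-1; pose ze := (X - eps - x1)^-1.
have zoo0 : 0 < zoo by rewrite invr_gt0.
have zXe : zX < ze by rewrite ltf_pV2 ?posrE//; lra.
have zXoo : zX < zoo by rewrite ltf_pV2 ?posrE//; lra.
have ez0 : 0 < (ze - zX) / zoo by rewrite divr_gt0// subr_gt0.
have [d d0 Hd] := is_derive_near0 (is_derive_saturation rho 0) (saturation0 rho) ez0.
exists d => // S t XS t0 td; rewrite -/zoo.
have Sx1 : 0 < S - x1 by rewrite (lt_le_trans Xx1)// lerD2r.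
have z00 : 0 < (S - x1)^-1 by rewrite invr_gt0.
have z0X : (S - x1)^-1 <= zX by rewrite lef_pV2 ?posrE// lerD2r.
have D0 : 0 <= saturation rho t by rewrite saturation_ge0// ltW.
have D1 : saturation rho t <= 1 by rewrite ltW// saturation_lt1.
have Dz : saturation rho t * zoo <= ze - zX.
  by rewrite -ler_pdivlMr//; apply: le_trans (ler_norm _) (Hd t t0 td).
have invz0 : (S - x1)^-1^-1 = S - x1 by rewrite invrK.
move: {Hd ez0} (saturation rho t) D0 D1 Dz => D D0 D1 Dz.
move: (S - x1)^-1 z00 z0X invz0 => z0 z00 z0X invz0.
have zz0 : z0 <= z0 + (zoo - z0) * D.
  by rewrite lerDl mulr_ge0// subr_ge0 (le_trans z0X)// ltW.
have zze : z0 + (zoo - z0) * D <= ze.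
  clear -Dz z0X D0 z00; nra.
have z_gt0 : 0 < z0 + (zoo - z0) * D by exact: lt_le_trans zz0.
have ze_gt0 : 0 < ze by rewrite invr_gt0.
apply/andP; split.
  by rewrite -lerBlDl (_ : X - eps - x1 = ze^-1) ?lef_pV2 ?posrE// /ze invrK.
by rewrite -[leRHS](subrKC x1) lerD2l -invz0 lef_pV2 ?posrE.
Qed.

Lemma riccati_flow_progress (s : site R) (S t : R) :
  (riccati_flow s S t - root_x1 s)^-1 = (S - root_x1 s)^-1 +
    ((root_x2 s - root_x1 s)^-1 - (S - root_x1 s)^-1) *
    saturation (gain_ratio s * (root_x2 s - root_x1 s)) t.
Proof. by rewrite /riccati_flow addrAC subrr add0r invrK. Qed.

Lemma passive_flow_bounds (s : site R) (X eps : R) :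
  standing_assumptions s -> 0 < X -> 0 < passive_drift s X -> 0 < eps ->
  exists m d, [/\ 0 < m, 0 < d & forall S t : R, 0 <= S -> S <= X -> 0 <= t -> t <= d ->
    S + m * exp_growth (dynA s) t <=
      S + passive_drift s S * exp_growth (dynA s) t <= X + eps].
Proof.
move=> [_ W0 _ _ _] X0 pX eps0.
pose P := noiseW s + 2 * `|dynA s| * X.
have P0 : 0 < P by rewrite ltr_pwDl// !mulr_ge0// ltW.
have pP (S : R) : 0 <= S -> S <= X -> passive_drift s S <= P.
  move=> S0 SX; rewrite /passive_drift /P addrC lerD2l -!mulrA ler_wpM2l//.
  by rewrite (le_trans (ler_norm _))// normrM (ger0_norm S0) ler_wpM2l.
(* An affine function on [[0, X]] is at least the smaller of its two end values. *)
pose m := Num.min (noiseW s) (passive_drift s X).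
have m0 : 0 < m by rewrite lt_min W0.
have pm (S : R) : 0 <= S -> S <= X -> m <= passive_drift s S.
  move=> S0 SX; rewrite ge_min /passive_drift.
  clear -S0 SX W0 X0.
  have [a0|a0] := leP 0 (dynA s); apply/orP; [left|right].
    by rewrite lerDr !mulr_ge0.
  by rewrite lerD2r -!mulrA ler_wpM2l// ler_wnM2l// ltW.
have [d d0 Hd] := is_derive_near0 (is_derive_exp_growth (dynA s) 0)
  (exp_growth0 (dynA s)) (divr_gt0 eps0 P0).
exists m, d; split => // S t S0 SX t0 td.
have E0 := exp_growth_ge0 (dynA s) t0.
apply/andP; split; first by rewrite lerD2l ler_wpM2r ?pm.
rewrite lerD// (@le_trans _ _ (P * exp_growth (dynA s) t))//.
  by rewrite ler_wpM2r ?pP.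
rewrite mulrC -ler_pdivlMr//.
by rewrite (le_trans (ler_norm _))// Hd.
Qed.

(** The two sign conditions make the actions opposite at [X]: the passive drift raises the variance,
    and the active drift lowers it because [X > x2]. *)
Lemma exists_trajectory_near (s : site R) (X eps : R) :
  standing_assumptions s -> gainC s != 0 ->
  0 < X -> 0 < passive_drift s X -> root_x2 s < X -> 0 < eps ->
  exists pi Sig, [/\ schedule pi, error_variance s pi Sig &
    exists2 t0 : R, 0 <= t0 & forall t : R, t0 <= t -> `|Sig t - X| <= eps].
Proof.
move=> hs hC X0 pX x2X; wlog epsX : eps / eps < X - root_x2 s => [wl|] eps0.
  have X20 : 0 < X - root_x2 s by rewrite subr_gt0.
  have [||pi [Sig [? ? [t0 t00 H]]]] := wl (Num.min eps ((X - root_x2 s) / 2)).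
  - by rewrite gt_min; apply/orP; right; rewrite ltr_pdivrMr// mulr_natr mulr2n ltrDl.
  - by rewrite lt_min eps0 divr_gt0.
  exists pi, Sig; split => //; exists t0 => // t /H.
  by rewrite le_min => /andP[].
have x10 := root_x1_lt0 hs hC; have x20 := root_x2_gt0 hs hC.
have g0 := gain_ratio_gt0 hs hC; case: (hs) => S00 W0 _ _ _.
have [d1 d10 flow1] := riccati_flow_bounds hs hC eps0 epsX.
have [m [d0 [m0 d00 flow0]]] := passive_flow_bounds hs X0 pX eps0.
pose delta := Num.min d0 d1.
have delta0 : 0 < delta by rewrite lt_min d00.
have dd0 : delta <= d0 by rewrite ge_min lexx.
have dd1 : delta <= d1 by rewrite ge_min lexx orbT.
pose f0 (S t : R) := S + passive_drift s S * exp_growth (dynA s) t.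
pose f1 := riccati_flow s.
pose zX := (X - root_x1 s)^-1; pose zoo := (root_x2 s - root_x1 s)^-1.
have x12 : 0 < root_x2 s - root_x1 s by rewrite subr_gt0 (lt_trans x10).
have zXoo : zX < zoo by rewrite ltf_pV2 ?posrE// ?ltrD2r// subr_gt0 (lt_trans x10).
pose rho := gain_ratio s * (root_x2 s - root_x1 s).
pose c0 := m * exp_growth (dynA s) delta.
have c00 : 0 < c0 by rewrite mulr_gt0// exp_growth_gt0.
pose c1 := (zoo - zX) * saturation rho delta.
have D0 : 0 < saturation rho delta by rewrite saturation_gt0// mulr_gt0.
have c10 : 0 < c1 by rewrite mulr_gt0// subr_gt0.
(* In this coordinate the active flow advances by [(zoo - phi S)] times the saturation per period,
   which is at least [c1] for all [S >= X] because [phi S <= zX < zoo]. *)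
pose phi (S : R) := (S - root_x1 s)^-1.
have f0P (S t : R) : 0 <= S -> S <= X -> 0 <= t -> t <= delta ->
    S <= f0 S t <= X + eps.
  move=> S0 SX t0 td; have /andP[F ->] := flow0 S t S0 SX t0 (le_trans td dd0).
  rewrite andbT (le_trans _ F)// lerDl mulr_ge0 ?exp_growth_ge0//; exact: ltW.
have f0_up (S : R) : 0 <= S -> S <= X -> S + c0 <= f0 S delta.
  by move=> S0 SX; have /andP[] := flow0 S delta S0 SX (ltW delta0) dd0.
have f1P (S t : R) : X <= S -> 0 <= t -> t <= delta -> X - eps <= f1 S t <= S.
  by move=> XS t0 td; exact: flow1 XS t0 (le_trans td dd1).
have phi_le (S : R) : X <= S -> phi S <= zX.
  move=> XS; rewrite lef_pV2 ?posrE ?lerD2r// subr_gt0 (lt_trans x10)//.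
  by rewrite (lt_le_trans X0).
have f1_down (S : R) : X <= S -> phi S + c1 <= phi (f1 S delta).
  move=> XS; rewrite /phi /f1 riccati_flow_progress lerD2l ler_wpM2r ?(ltW D0)//.
  by rewrite lerD2l lerN2; exact: phi_le.
have epsX' : eps <= X by rewrite ltW// (lt_trans epsX)// gtrBl.
have Sn_ge0 := bang_bang_state_ge0 (ltW S00) epsX' (ltW delta0) f0P f1P.
have [n0 Hn0] := bang_bang_stays (ltW S00) eps0 epsX' (ltW delta0) c00 c10
  f0P f0_up f1P phi_le f1_down.
have band := bang_bang_band epsX' f0P f1P.
set Sn := bang_bang_state _ _ _ _ _ in Sn_ge0 Hn0.
have y_0 (S : R) : root_x1 s < S -> bang_bang f0 f1 X S 0 = S.
  move=> x1S; rewrite /bang_bang; case: ifP => _.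
    by rewrite /f0 exp_growth0 mulr0 addr0.
  by rewrite /f1 /riccati_flow saturation0 mulr0 addr0 invrK subrKC.
have [|||pi [Sig [hpi hSig HS]]] := @grid_trajectory _ s delta
    (fun n => ~~ (Sn n <= X)) (fun n => bang_bang f0 f1 X (Sn n)) delta0.
- by rewrite y_0//= (lt_trans x10).
- by move=> n; rewrite y_0//; apply: (lt_le_trans x10).
- move=> n r r0; rewrite /bang_bang; case: (leP (Sn n) X) => SX /=.
    exact: passive_flow.
  by apply: riccati_flowP => //; rewrite (lt_trans x10)// (lt_trans X0).
exists pi, Sig; split => //.
exists (n0%:R * delta); first by rewrite mulr_ge0// ltW.
move=> t n0t; have t0 : 0 <= t by rewrite (le_trans _ n0t)// mulr_ge0// ltW.
pose n := Num.truncn (t / delta).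
have /andP[nt tn] : n%:R * delta <= t < n.+1%:R * delta.
  have : 0 <= t / delta by rewrite divr_ge0// ltW.
  by move=> /truncn_itv; rewrite ler_pdivlMr// ltr_pdivrMr.
have n0n : (n0 <= n)%N.
  by rewrite -ltnS -(ltr_nat R) -(ltr_pM2r delta0) (le_lt_trans n0t).
have [_ ->] := HS n t nt tn; apply: band; first exact: Hn0.
  by rewrite subr_ge0.
by move: tn; rewrite -natr1 mulrDl mul1r => /ltW; rewrite addrC -lerBlDr.
Qed.

End Controllability.

(** * Upper bounds on the single-site value *)

Section SingleSiteValueBounds.
Context {R : realType}.
Variables (s : site R).
Hypothesis (hs : standing_assumptions s).

(* The average cost of keeping the variance at X by alternating quickly between
   the two actions: observing a fraction [passive_drift s X / (C^2 / V * X^2)]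
   of the time balances the drift. *)
Definition hold_cost (lam X : R) : R :=
  weightT s * X + (kappa s + lam) * (passive_drift s X / (gain_ratio s * X ^+ 2)).

(** The multiplier [theta] is chosen so that, at [Sig t = X], the coefficient of [pi t] in the cost
    plus [theta] times the drift vanishes. What remains there is [hold_cost lam X] for either
    action, so near [X] the sum exceeds it by at most a small error, whatever the switching
    pattern. *)
Lemma single_site_value_le_hold (lam X : R) : gainC s != 0 -> 0 < X ->
  0 < passive_drift s X -> root_x2 s < X ->
  (single_site_value s lam <= (hold_cost lam X)%:E)%E.
Proof.
move=> hC X0 pX x2X; have g0 := gain_ratio_gt0 hs hC.
case: (hs) => _ _ _ T0 _.
pose theta := (kappa s + lam) / (gain_ratio s * X ^+ 2).
have X20 : 0 < X ^+ 2 by rewrite exprn_gt0.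
have thetaE : theta * (gain_ratio s * X ^+ 2) = kappa s + lam.
  by rewrite /theta divfK// gt_eqF// mulr_gt0.
(* [L] bounds the error per unit of [eps]; the factor [2 * X + 1] bounds [|X + Sig t|], as
   [eps <= 1]. *)
pose L := weightT s + `|2 * dynA s * theta| + `|theta * gain_ratio s| * (2 * X + 1) + 1.
have L0 : 0 < L.
  by rewrite ltr_wpDl// !addr_ge0// mulr_ge0// addr_ge0// mulr_ge0// ltW.
apply/lee_addgt0Pr => e e0; rewrite -EFinD.
pose eps := Num.min 1 (e / L).
have eps0 : 0 < eps by rewrite lt_min ltr01 divr_gt0.
have eps1 : eps <= 1 by rewrite ge_min lexx.
have epsL : L * eps <= e by rewrite mulrC -ler_pdivlMr// ge_min lexx orbT.
have [pi [Sig [hpi hSig [t0 t00 near]]]] := exists_trajectory_near hs hC X0 pX x2X eps0.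
apply: (@single_site_value_le _ s lam _ theta (X + 1) pi Sig hpi hSig).
exists t0 => // t /near St; split.
  have : `|Sig t| <= `|Sig t - X| + `|X| by rewrite -[in leLHS](subrK X (Sig t)) ler_normD.
  by rewrite (gtr0_norm X0) => H; rewrite (le_trans H)// addrC lerD2l (le_trans St).
have -> : running_cost s lam pi Sig t + theta * variance_drift s pi Sig t =
    hold_cost lam X + (weightT s * (Sig t - X) + (2 * dynA s * theta) * (Sig t - X)
    + theta * gain_ratio s * ((pi t)%:R * ((X - Sig t) * (X + Sig t)))).
  rewrite /running_cost /variance_drift /hold_cost -/(gain_ratio s).
  have -> : (kappa s + lam) * (passive_drift s X / (gain_ratio s * X ^+ 2)) =
    theta * passive_drift s X by rewrite /theta; ring.
  by rewrite -thetaE /passive_drift; ring.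
rewrite lerD2l (le_trans _ epsL)//.
have abs2 : `|(pi t)%:R * ((X - Sig t) * (X + Sig t))| <= (2 * X + 1) * eps.
  apply: (@le_trans _ _ `|(X - Sig t) * (X + Sig t)|).
    by case: (pi t); rewrite ?mul1r// mul0r normr0.
  rewrite normrM mulrC ler_pM//; last by rewrite distrC.
  have -> : X + Sig t = 2 * X + (Sig t - X) by ring.
  rewrite (le_trans (ler_normD _ _))// lerD ?(le_trans St)//.
  by rewrite ger0_norm// mulr_ge0// ltW.
have -> : L * eps = weightT s * eps + `|2 * dynA s * theta| * eps +
    `|theta * gain_ratio s| * ((2 * X + 1) * eps) + eps by rewrite /L; ring.
rewrite -[leLHS]addr0 lerD ?(ltW eps0)//.
apply: lerD; first apply: lerD.
- by rewrite ler_wpM2l// (le_trans (ler_norm _)).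
- by rewrite (le_trans (ler_norm _))// normrM ler_wpM2l.
- by rewrite (le_trans (ler_norm _))// normrM ler_wpM2l.
Qed.

Lemma hold_cost_le_near (lam X e : R) : gainC s != 0 -> 0 < X -> 0 < e ->
  exists2 eta, 0 < eta & forall Y, `|Y - X| < eta -> hold_cost lam Y <= hold_cost lam X + e.
Proof.
move=> hC X0 e0; have g0 := gain_ratio_gt0 hs hC.
have c : {for X, continuous (hold_cost lam)}.
  have cX : {for X, continuous (fun Y : R => Y)} by exact: cvg_id.
  apply: cvgD; first by apply: cvgM cX; exact: cvg_cst.
  apply: cvgM; first exact: cvg_cst.
  apply: cvgM.
    apply: cvgD; last exact: cvg_cst.
    by apply: cvgM cX; exact: cvg_cst.
  apply: cvgV; first by rewrite gt_eqF// mulr_gt0// exprn_gt0.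
  apply: cvgM; first exact: cvg_cst.
  exact: (@exprn_continuous _ 2).
have /cvgrPdist_le/(_ _ e0)[eta eta0 Heta] := c.
exists eta => // Y YX; have := Heta Y; rewrite /= distrC => /(_ YX).
by rewrite ler_distl => /andP[+ _]; rewrite lerBlDr.
Qed.

(** Only levels where the two actions push in opposite directions can be held. Optimal levels [x2],
    [xe] or infinity are reached as limits of such levels, hence the error [e]. *)
Definition hold_approximable (lam gam : R) : Prop :=
  forall e : R, 0 < e -> exists X : R,
    [/\ root_x2 s < X, 0 < passive_drift s X & hold_cost lam X <= gam + e].

Lemma passive_drift_root_x2 : gainC s != 0 ->
  passive_drift s (root_x2 s) = gain_ratio s * root_x2 s ^+ 2.
Proof.
move=> hC; have : active_drift s (root_x2 s) = 0.
  by rewrite active_driftE// subrr mulr0.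
by rewrite /active_drift -/(gain_ratio s) => /eqP; rewrite subr_eq0 => /eqP.
Qed.

Lemma passive_drift_xe : dynA s < 0 -> passive_drift s (point_xe s) = 0.
Proof. by move=> a0; rewrite /passive_drift /point_xe; field; rewrite lt_eqF. Qed.

Lemma passive_driftE (S : R) : dynA s < 0 ->
  passive_drift s S = 2 * `|dynA s| * (point_xe s - S).
Proof.
by move=> a0; rewrite ltr0_norm// /passive_drift /point_xe; field; rewrite lt_eqF.
Qed.

Lemma point_xe_gt0 : dynA s < 0 -> 0 < point_xe s.
Proof.
move=> a0; case: hs => _ W0 _ _ _; rewrite /point_xe oppr_gt0.
by rewrite pmulr_rlt0// invr_lt0; lra.
Qed.

Lemma root_x2_lt_xe : gainC s != 0 -> dynA s < 0 -> root_x2 s < point_xe s.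
Proof.
move=> hC a0; have g0 := gain_ratio_gt0 hs hC; have x20 := root_x2_gt0 hs hC.
have : 0 < passive_drift s (root_x2 s).
  by rewrite passive_drift_root_x2// mulr_gt0// exprn_gt0.
by rewrite passive_driftE// pmulr_rgt0 ?subr_gt0// mulr_gt0// normr_gt0 lt_eqF.
Qed.

Lemma passive_drift_gt0 (S : R) : 0 <= S -> (dynA s < 0 -> S < point_xe s) ->
  0 < passive_drift s S.
Proof.
move=> S0 Sxe; have [a0|a0] := ltP (dynA s) 0.
  by rewrite passive_driftE// mulr_gt0 ?subr_gt0 ?Sxe// mulr_gt0// normr_gt0 lt_eqF.
by case: hs => _ W0 _ _ _; rewrite /passive_drift ltr_wpDl// !mulr_ge0.
Qed.

Lemma hold_cost_root_x2 (lam : R) : gainC s != 0 ->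
  hold_cost lam (root_x2 s) = weightT s * root_x2 s + (kappa s + lam).
Proof.
move=> hC; have g0 := gain_ratio_gt0 hs hC; have x20 := root_x2_gt0 hs hC.
by rewrite /hold_cost passive_drift_root_x2// divff ?mulr1// gt_eqF// mulr_gt0// exprn_gt0.
Qed.

Lemma hold_cost_xe (lam : R) : dynA s < 0 ->
  hold_cost lam (point_xe s) = weightT s * point_xe s.
Proof. by move=> a0; rewrite /hold_cost passive_drift_xe// mul0r mulr0 addr0. Qed.

Lemma hold_approximable_root_x2 (lam : R) : gainC s != 0 ->
  hold_approximable lam (weightT s * root_x2 s + (kappa s + lam)).
Proof.
move=> hC e e0; have x20 := root_x2_gt0 hs hC.
have [eta eta0 Heta] := hold_cost_le_near lam hC x20 e0.
pose d := if dynA s < 0 then point_xe s - root_x2 s else 1.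
have d0 : 0 < d by rewrite /d; case: ifP => // a0; rewrite subr_gt0 root_x2_lt_xe.
pose eps := Num.min (eta / 2) (d / 2).
have eps0 : 0 < eps by rewrite lt_min !divr_gt0.
exists (root_x2 s + eps); split.
- by rewrite ltrDl.
- apply: passive_drift_gt0 => [|a0]; first by rewrite addr_ge0// ltW.
  rewrite -ltrBrDl; have : eps <= d / 2 by rewrite ge_min lexx orbT.
  rewrite /d a0 => H; rewrite (le_lt_trans H)// ltr_pdivrMr// ltr_pMr ?ltr1n//.
  by rewrite subr_gt0 root_x2_lt_xe.
- rewrite -hold_cost_root_x2//; apply: Heta.
  have : eps <= eta / 2 by rewrite ge_min lexx.
  rewrite addrAC subrr add0r gtr0_norm// => H; rewrite (le_lt_trans H)//.
  by rewrite ltr_pdivrMr// ltr_pMr ?ltr1n.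
Qed.

Lemma hold_approximable_xe (lam : R) : gainC s != 0 -> dynA s < 0 ->
  hold_approximable lam (weightT s * point_xe s).
Proof.
move=> hC a0 e e0; have x20 := root_x2_gt0 hs hC; have xe0 := point_xe_gt0 a0.
have [eta eta0 Heta] := hold_cost_le_near lam hC xe0 e0.
have d0 : 0 < point_xe s - root_x2 s by rewrite subr_gt0 root_x2_lt_xe.
pose eps := Num.min (eta / 2) ((point_xe s - root_x2 s) / 2).
have eps0 : 0 < eps by rewrite lt_min !divr_gt0.
have x2eps : root_x2 s < point_xe s - eps.
  rewrite ltrBrDr -ltrBrDl.
  have H : eps <= (point_xe s - root_x2 s) / 2 by rewrite ge_min lexx orbT.
  by rewrite (le_lt_trans H)// ltr_pdivrMr// ltr_pMr ?ltr1n.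
exists (point_xe s - eps); split => //.
- apply: passive_drift_gt0 => [|_]; first by rewrite ltW// (lt_trans x20).
  by rewrite gtrBl.
- rewrite -(hold_cost_xe lam)//; apply: Heta.
  have : eps <= eta / 2 by rewrite ge_min lexx.
  rewrite addrAC subrr add0r normrN gtr0_norm// => H; rewrite (le_lt_trans H)//.
  by rewrite ltr_pdivrMr// ltr_pMr ?ltr1n.
Qed.

(** With zero weight only the observations cost. For [X >= 1] holding [X] requires observing a
    fraction of at most [(2 A + W) / (g X)] of the time, which tends to 0; [D] is the level where
    its cost drops to [e]. *)
Lemma hold_approximable_infty (lam : R) : gainC s != 0 -> 0 <= dynA s ->
  weightT s = 0 -> 0 <= kappa s + lam -> hold_approximable lam 0.
Proof.
move=> hC a0 T0 m0 e e0; have x20 := root_x2_gt0 hs hC.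
have g0 := gain_ratio_gt0 hs hC; case: (hs) => _ W0 _ _ _.
pose D := (kappa s + lam) * (2 * dynA s + noiseW s) / (gain_ratio s * e).
pose X := Num.max 1 (Num.max (root_x2 s + 1) D).
have X1 : 1 <= X by rewrite le_max lexx.
have X0 : 0 < X by rewrite (lt_le_trans ltr01).
have XD : D <= X by rewrite !le_max lexx !orbT.
exists X; split.
- by rewrite (@lt_le_trans _ _ (root_x2 s + 1)) ?ltrDl// !le_max lexx !orbT.
- by apply: passive_drift_gt0; [exact: ltW|rewrite ltNge a0].
- rewrite /hold_cost T0 mul0r !add0r mulrA ler_pdivrMr; last by rewrite mulr_gt0// exprn_gt0.
  have : (kappa s + lam) * (2 * dynA s + noiseW s) <= X * (gain_ratio s * e).
    by rewrite -ler_pdivrMr// mulr_gt0.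
  move=> H; apply: (@le_trans _ _ ((kappa s + lam) * ((2 * dynA s + noiseW s) * X))).
    rewrite ler_wpM2l// /passive_drift.
    rewrite (_ : (2 * dynA s + noiseW s) * X = 2 * dynA s * X + noiseW s * X); last by ring.
    by rewrite lerD2l ler_pMr.
  rewrite mulrA (_ : e * _ = X * (gain_ratio s * e) * X); last by ring.
  by rewrite ler_pM2r.
Qed.

Lemma single_site_value_le_approx (lam gam : R) : gainC s != 0 ->
  hold_approximable lam gam -> (single_site_value s lam <= gam%:E)%E.
Proof.
move=> hC H; apply/lee_addgt0Pr => e e0; have [X [x2X pX HX]] := H e e0.
apply: (@le_trans _ _ (hold_cost lam X)%:E); last by rewrite -EFinD lee_fin.
by apply: single_site_value_le_hold => //; exact: lt_trans (root_x2_gt0 hs hC) x2X.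
Qed.

Lemma single_site_value_le_unobserved (lam : R) (b : bool) : gainC s = 0 ->
  dynA s < 0 ->
  (single_site_value s lam <=
    (weightT s * point_xe s + (kappa s + lam) * b%:R)%:E)%E.
Proof.
move=> hC a0; case: (hs) => S00 W0 _ T0 _.
pose Sig t := Sigma0 s + passive_drift s (Sigma0 s) * exp_growth (dynA s) t.
have dSig (t : R) : is_derive t (1 : R) Sig (variance_field s b (Sig t)).
  have := passive_flow s (Sigma0 s) t; rewrite -/(Sig t).
  by rewrite /variance_field hC expr0n/= !(mul0r, mulr0).
have cSig : continuous Sig by move=> t; exact: is_derive_continuous (dSig t).
have hSig : error_variance s (fun=> b) Sig.
  split; first exact: continuous_subspaceT.
  move=> t t0.
  rewrite (@Rintegral_FTC2 _ Sig (fun r => variance_field s b (Sig r)) 0 t t0).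
  - by rewrite /Sig exp_growth0; ring.
  - apply: continuous_subspaceT => r; apply: cvgB.
      by apply: cvgD; [apply: cvgM; [exact: cvg_cst|exact: cSig]|exact: cvg_cst].
    by apply: cvgM; [exact: cvg_cst|apply: cvgM; exact: cSig].
(* [E] is the supremum of [exp_growth], which bounds the trajectory, and [weightT s * E] is the
   multiplier cancelling [Sig t] between the cost and the drift. *)
pose E := (- (2 * dynA s))^-1.
have E0 : 0 < E by rewrite invr_gt0; lra.
apply: (@single_site_value_le _ s lam _ (weightT s * E)
  (Sigma0 s + `|passive_drift s (Sigma0 s)| * E) (fun=> b) Sig _ hSig).
  exact: measurable_cst.
exists 0 => // t t0; split.
  rewrite /Sig (le_trans (ler_normD _ _))// (gtr0_norm S00) lerD2l normrM ler_wpM2l//.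
  rewrite ger0_norm ?exp_growth_ge0// /exp_growth (lt_eqF a0).
  rewrite -[leLHS]mulrNN -invrN; apply: ler_piMl; first exact: ltW.
  by rewrite opprB gerBl expR_ge0.
rewrite /running_cost /variance_drift hC expr0n/= !(mul0r, mulr0) subr0.
by rewrite le_eqVlt; apply/orP; left; apply/eqP; rewrite /E /point_xe; field; rewrite lt_eqF.
Qed.

End SingleSiteValueBounds.

(** * The HJB equation and the index function *)

Section HJB.
Context {R : realType}.
Local Notation mu := (@lebesgue_measure R).
Local Notation lbm := locally_bounded_measurable.

Lemma antiderivative (d : R -> R) : {within `[0, +oo[, continuous d} ->
  exists h : R -> R, {within `[0, +oo[, continuous h} /\
    forall S : R, 0 < S -> is_derive S (1 : R) h (d S).
Proof.
move=> cd; have ld := lbm_within_continuous cd.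
pose h (S : R) := \int[mu]_(t in `[0, S]) d t; exists h; split.
  apply/within_continuous_distP => t e t0 e0.
  have [B0 HB0] := ld.2 (t + 1); pose B := `|B0| + 1.
  have B_gt0 : 0 < B by rewrite ltr_wpDl.
  exists (Num.min 1 (e / B)); first by rewrite lt_min ltr01 divr_gt0.
  move=> u u0; rewrite lt_min => /andP[ut1 utB].
  have aux (a b : R) : 0 <= a -> a <= b -> b <= t + 1 -> `|h b - h a| <= B * (b - a).
    move=> a0 ab bt; rewrite /h (lbm_Rintegral_split ld a0 ab) addrC addKr.
    apply: normr_lbm_Rintegral_le => // r /andP[ar rb].
    rewrite (le_trans (HB0 r _)) ?(le_trans a0 ar) ?(le_trans rb)//.
    by rewrite (le_trans (ler_norm _))// lerDl.
  have ut : u <= t + 1 by rewrite -lerBlDl ltW// (le_lt_trans (ler_norm _)).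
  have tt1 : t <= t + 1 by rewrite lerDl.
  have H : `|h u - h t| <= B * `|u - t|.
    have [tu|/ltW ut'] := leP t u.
      by rewrite [X in _ * X]ger0_norm ?subr_ge0//; exact: aux.
    rewrite distrC [`|u - t|]distrC [X in _ * X]ger0_norm ?subr_ge0//.
    exact: aux.
  by rewrite (le_trans H)// mulrC -ler_pdivlMr// ltW.
move=> S S0; have cdS : {for S, continuous d}.
  apply/cvgrPdist_le => e e0.
  have [eta eta0 Heta] := within_continuous_dist cd (ltW S0) e0.
  exists (Num.min eta S) => /=; first by rewrite lt_min eta0.
  move=> u /=; rewrite lt_min => /andP[ue uS]; rewrite distrC; apply: Heta.
    by move: uS; rewrite ltr_distlC => /andP[+ _]; rewrite subrr => /ltW.
  by rewrite distrC.
have SS1 : S < S + 1 by rewrite ltrDl.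
have [dh dhE] := continuous_FTC1_closed SS1 (lbm_integrable (S + 1) ld (lexx 0)) S0 cdS.
by apply: DeriveDef => //; rewrite -derive1E.
Qed.

Lemma is_derive_le (h d : R -> R) (a b : R) : a <= b ->
  (forall S : R, a <= S <= b -> is_derive S (1 : R) h (d S)) ->
  (forall S : R, a <= S <= b -> 0 <= d S) -> h a <= h b.
Proof.
move=> ab dh d0; move: ab; rewrite le_eqVlt => /predU1P[->//|ab].
have [||c cab E] := @MVT _ h d a b ab.
- move=> S; rewrite in_itv/= => /andP[aS Sb]; apply: dh.
  by rewrite (ltW aS) (ltW Sb).
- apply: continuous_in_subspaceT => S; rewrite inE/= in_itv/= => /dh.
  exact: is_derive_continuous.
move: cab; rewrite in_itv/= => /andP[ac cb].
by rewrite -subr_ge0 E mulr_ge0 ?subr_ge0 ?(ltW ab)// d0// (ltW ac) (ltW cb).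
Qed.

(** Here [gam] is a free parameter: a suitable solution first certifies it as a lower bound, and it
    is identified with the single-site value only afterwards. *)
Definition hjb (s : site R) (lam gam : R) (d : R -> R) : Prop :=
  {within `[0, +oo[, continuous d} /\
  forall S : R, 0 <= S -> gam = Num.min (passive_term s d S) (active_term s lam d S).

Lemma lower_certified_hjb (s : site R) (lam gam : R) (d : R -> R) :
  standing_assumptions s -> hjb s lam gam d ->
  (forall S : R, 0 <= S -> 0 <= d S) ->
  (weightT s = 0 -> forall S : R, 0 <= S -> d S = 0) ->
  lower_certified s lam gam.
Proof.
move=> hs [cd Hd] d0 dT0 pi Sig hpi hSig K.
have [h [ch dh]] := antiderivative cd.
have incr (a b : R) : 0 < a -> a <= b -> h a <= h b.
  move=> a0 ab; apply: (@is_derive_le h d a b ab) => S /andP[aS _].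
    by apply: dh; exact: lt_le_trans aS.
  by apply: d0; rewrite ltW// (lt_le_trans a0).
have cstT0 (a b : R) : weightT s = 0 -> 0 < a -> a <= b -> h b <= h a.
  move=> T0 a0 ab; rewrite -lerN2.
  apply: (@is_derive_le (- h) (- d) a b ab) => S /andP[aS _].
    by apply: is_deriveN; apply: dh; exact: lt_le_trans aS.
  by rewrite /GRing.opp/= dT0 ?oppr0// ltW// (lt_le_trans a0).
have S00 : 0 < Sig 0 by exact: (error_variance_gt0 hs hpi hSig).
(* For a positive weight, [h (Sig t) <= h (Num.max K 1)] by monotonicity, the 1 keeping the argument
   in the open half-line where [h] is differentiable. For zero weight [h] is constant, and
   [h (Sig 0)] serves. *)
exists (Num.max (h (Num.max K 1)) (h (Sig 0)) - h (Sig 0)) => t t0 HK.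
have le_pas (S : R) : 0 <= S -> gam <= passive_term s d S.
  by move=> S0; rewrite {1}(Hd S S0) ge_min lexx.
have le_act (S : R) : 0 <= S -> gam <= active_term s lam d S.
  by move=> S0; rewrite {1}(Hd S S0) ge_min lexx orbT.
apply: le_trans (running_cost_lower hs hpi hSig dh cd le_pas le_act t0).
rewrite opprB addrA lerD2l lerN2.
have St0 : 0 < Sig t by exact: (error_variance_gt0 hs hpi hSig).
rewrite le_max; have [T0|T0] := eqVneq (weightT s) 0.
  apply/orP; right; have [St|/ltW St] := lerP (Sig 0) (Sig t).
    exact: cstT0.
  exact: incr.
apply/orP; left; apply: incr => //; rewrite le_max HK// lt_def T0.
by case: hs.
Qed.

(* For [S != 0] this is [gain_ratio s * S ^+ 2 * (hold_cost s lam S - gam)].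
   Where it does not vanish, the two terms of the equation are different, so a
   solution cannot switch between the two actions. *)
Definition hjb_gap (s : site R) (lam gam S : R) : R :=
  (kappa s + lam) * passive_drift s S
  - gain_ratio s * S ^+ 2 * (gam - weightT s * S).

Lemma drift_diff (s : site R) (S : R) :
  passive_drift s S - active_drift s S = gain_ratio s * S ^+ 2.
Proof. by rewrite /active_drift /passive_drift -/(gain_ratio s); ring. Qed.

Lemma active_termE (s : site R) (lam : R) (d : R -> R) (S : R) :
  active_term s lam d S =
  passive_term s d S + (kappa s + lam) - gain_ratio s * S ^+ 2 * d S.
Proof. by rewrite -drift_diff /passive_term /active_term; ring. Qed.

(** Observing costs [kappa s + lam] and lowers the drift term by [gain_ratio s * S ^+ 2 * d S];
    every question of optimality is reduced to comparing these two quantities. *)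
Lemma le_passive_active (s : site R) (lam : R) (d : R -> R) (S : R) :
  (passive_term s d S <= active_term s lam d S) =
  (gain_ratio s * S ^+ 2 * d S <= kappa s + lam).
Proof. by rewrite active_termE -addrA lerDl subr_ge0. Qed.

(* The Whittle index plus [kappa s]. *)
Definition whittle_value (s : site R) (S : R) : R :=
  if (gainC s == 0) || (weightT s == 0) then 0
  else if S <= root_x2 s then weightT s * S ^+ 2 / (S - root_x1 s)
  else if (dynA s < 0) && (point_xe s <= S) then
    weightT s * gain_ratio s * S ^+ 2 / (2 * `|dynA s|)
  else gain_ratio s / 2 * (weightT s * S ^+ 3 / (dynA s * S + noiseW s)).

(** * The index function is strictly increasing *)

Section Index.
Variable s : site R.
Hypotheses (hs : standing_assumptions s) (hC : gainC s != 0) (hT : weightT s != 0).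

Lemma weightT_gt0 : 0 < weightT s.
Proof. by rewrite lt_def hT; case: hs. Qed.

Lemma half_drift_gt0 (S : R) : 0 <= S -> (dynA s < 0 -> S <= point_xe s) ->
  0 < dynA s * S + noiseW s.
Proof.
case: hs => _ W0 _ _ _ S0 Sxe; have [a0|a0] := ltP (dynA s) 0; last first.
  by rewrite ltr_wpDl// mulr_ge0.
have := Sxe a0; rewrite /point_xe -mulNr ler_ndivlMr; last lra.
by move=> H; lra.
Qed.

Lemma root_sum : 2 * dynA s = gain_ratio s * (root_x1 s + root_x2 s).
Proof.
have := active_driftE hs hC 1; have := active_driftE hs hC 0.
rewrite /active_drift -/(gain_ratio s); lra.
Qed.

Lemma root_prod : noiseW s = - gain_ratio s * root_x1 s * root_x2 s.
Proof.
have := active_driftE hs hC 0.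
by rewrite /active_drift mulr0 add0r expr0n/= mulr0 subr0 => ->; ring.
Qed.

Lemma half_drift_root_x2 : dynA s * root_x2 s + noiseW s =
  gain_ratio s * root_x2 s * (root_x2 s - root_x1 s) / 2.
Proof.
have -> : dynA s = gain_ratio s * (root_x1 s + root_x2 s) / 2.
  by rewrite -root_sum; field.
by rewrite root_prod; field.
Qed.

Lemma half_drift_xe : dynA s < 0 ->
  dynA s * point_xe s + noiseW s = `|dynA s| * point_xe s.
Proof. by move=> a0; rewrite ltr0_norm// /point_xe; field; rewrite lt_eqF. Qed.

Local Notation wv := (whittle_value s).

Lemma whittle_value_low (S : R) : S <= root_x2 s ->
  wv S = weightT s * S ^+ 2 / (S - root_x1 s).
Proof. by move=> Sx2; rewrite /whittle_value (negPf hC) (negPf hT) Sx2. Qed.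

Lemma whittle_value_high (S : R) : dynA s < 0 -> point_xe s <= S ->
  wv S = weightT s * gain_ratio s * S ^+ 2 / (2 * `|dynA s|).
Proof.
move=> a0 xeS; rewrite /whittle_value (negPf hC) (negPf hT)/=.
by rewrite leNgt (lt_le_trans (root_x2_lt_xe hs hC a0) xeS)/= a0 xeS.
Qed.

(** Both ends are included because the adjacent formulas agree at [x2] and at [xe]. This lets the
    monotonicity proof chain through the junctions. *)
Lemma whittle_value_mid (S : R) : root_x2 s <= S -> (dynA s < 0 -> S <= point_xe s) ->
  wv S = gain_ratio s / 2 * (weightT s * S ^+ 3 / (dynA s * S + noiseW s)).
Proof.
have x20 := root_x2_gt0 hs hC; have x10 := root_x1_lt0 hs hC.
have g0 := gain_ratio_gt0 hs hC.
rewrite le_eqVlt => /predU1P[<- _|x2S Sxe].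
  rewrite whittle_value_low// half_drift_root_x2; field.
  by rewrite !gt_eqF//= subr_gt0 (lt_trans x10).
rewrite /whittle_value (negPf hC) (negPf hT)/= leNgt x2S/=.
case: ifP => // /andP[a0 xeS].
have -> : S = point_xe s by apply/eqP; rewrite eq_le Sxe.
rewrite half_drift_xe//; have xe0 := point_xe_gt0 hs a0; field.
by rewrite gt_eqF//= normr_eq0 lt_eqF.
Qed.

(** The bound [x2] is absent on purpose: the active slope gives the same expression above [x2],
    where it is no longer the index. *)
Lemma low_value_lt (u v : R) : 0 <= u -> u < v ->
  weightT s * u ^+ 2 / (u - root_x1 s) < weightT s * v ^+ 2 / (v - root_x1 s).
Proof.
move=> u0 uv; have x10 := root_x1_lt0 hs hC; have T0 := weightT_gt0.
have ux1 : 0 < u - root_x1 s by rewrite subr_gt0 (lt_le_trans x10).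
have vx1 : 0 < v - root_x1 s by rewrite (lt_trans ux1)// ltrD2r.
rewrite ltr_pdivrMr// mulrAC ltr_pdivlMr// -!mulrA ltr_pM2l//.
rewrite -subr_gt0 (_ : _ - _ = (v - u) * (u * v - root_x1 s * (u + v))); last by ring.
rewrite mulr_gt0 ?subr_gt0// (@lt_le_trans _ _ 0)//.
  by rewrite nmulr_rlt0// ltr_wpDl// (le_lt_trans u0).
by rewrite mulr_ge0// (le_trans u0 (ltW uv)).
Qed.

Lemma whittle_value_lt (S S' : R) : 0 <= S -> S < S' -> wv S < wv S'.
Proof.
have x20 := root_x2_gt0 hs hC; have x10 := root_x1_lt0 hs hC.
have g0 := gain_ratio_gt0 hs hC; have T0 := weightT_gt0.
have W0 : 0 < noiseW s by case: hs.
have low (u v : R) : 0 <= u -> u < v -> v <= root_x2 s -> wv u < wv v.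
  move=> u0 uv vx2; rewrite !whittle_value_low//; first exact: low_value_lt.
  by rewrite (le_trans (ltW uv)).
have mid (u v : R) : root_x2 s <= u -> u < v -> (dynA s < 0 -> v <= point_xe s) ->
    wv u < wv v.
  move=> x2u uv vxe.
  have uxe : dynA s < 0 -> u <= point_xe s by move=> /vxe; apply: le_trans (ltW uv).
  have u0 : 0 < u by exact: lt_le_trans x2u.
  have v0 : 0 < v by exact: lt_trans uv.
  have Du := half_drift_gt0 (ltW u0) uxe; have Dv := half_drift_gt0 (ltW v0) vxe.
  rewrite !whittle_value_mid// ?(le_trans x2u (ltW uv))//.
  rewrite ltr_pM2l; last by rewrite divr_gt0.
  rewrite ltr_pdivrMr// mulrAC ltr_pdivlMr// -!mulrA ltr_pM2l//.
  (* Grouped so that every summand is positive even for [A < 0], using only the positivity of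
     [A u + W], [A v + W] and [W]. *)
  rewrite -subr_gt0 (_ : _ - _ = (v - u) * (v ^+ 2 * (dynA s * u + noiseW s) +
    u ^+ 2 * (dynA s * v + noiseW s) + noiseW s * (u * v))); last by ring.
  by rewrite mulr_gt0 ?subr_gt0// !addr_gt0// mulr_gt0// ?exprn_gt0// mulr_gt0.
have high (u v : R) : dynA s < 0 -> point_xe s <= u -> u < v -> wv u < wv v.
  move=> a0 xeu uv; have u0 : 0 < u by exact: lt_le_trans (point_xe_gt0 hs a0) xeu.
  rewrite !whittle_value_high// ?(le_trans xeu (ltW uv))//.
  rewrite ltr_pM2r; last by rewrite invr_gt0 mulr_gt0// normr_gt0 lt_eqF.
  rewrite ltr_pM2l; last by rewrite mulr_gt0.
  by rewrite ltr_pXn2r// nnegrE ltW// (lt_trans u0).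
have upper (u v : R) : root_x2 s <= u -> u < v -> wv u < wv v.
  move=> x2u uv; have [a0|a0] := ltP (dynA s) 0; last first.
    by apply: mid => //; rewrite ltNge a0.
  have [xeu|uxe] := leP (point_xe s) u; first exact: high.
  have [vxe|xev] := leP v (point_xe s); first exact: mid.
  by apply: (lt_trans (mid u (point_xe s) _ _ _)) => //; exact: high.
move=> S0 SS'; have [x2S|Sx2] := leP (root_x2 s) S; first exact: upper.
have [S'x2|x2S'] := leP S' (root_x2 s); first exact: low.
by apply: (lt_trans (low S (root_x2 s) _ _ _)) => //; exact: upper.
Qed.

Lemma whittle_value_le (S S' : R) : 0 <= S -> 0 <= S' ->
  (wv S <= wv S') = (S <= S').
Proof.
move=> S0 S'0; apply/idP/idP; last first.
  by rewrite le_eqVlt => /predU1P[->//|/(whittle_value_lt S0)/ltW].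
by move=> H; rewrite leNgt; apply/negP => /(whittle_value_lt S'0); rewrite ltNge H.
Qed.

End Index.
End HJB.

(** * Solutions of the HJB equation *)

Section HJBSolutions.
Context {R : realType}.
Variable s : site R.
Hypothesis (hs : standing_assumptions s).
Local Notation wv := (whittle_value s).

(** The sign of [d] and its vanishing for zero weight are what the lower-bound certificate uses; the
    last clause describes the passive region by the index. *)
Definition hjb_threshold (lam gam : R) (d : R -> R) : Prop :=
  [/\ hjb s lam gam d, forall S : R, 0 <= S -> 0 <= d S,
      weightT s = 0 -> forall S : R, 0 <= S -> d S = 0 &
      forall S : R, 0 <= S ->
        (gain_ratio s * S ^+ 2 * d S <= kappa s + lam) = (wv S <= kappa s + lam)].

(** Without gain both actions have the same drift and their terms differ by the constant
    [kappa s + lam]; the slope [T / (2 |A|)] cancels the dependence on [S]. *)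
Lemma hjb_unobservable (lam : R) : gainC s = 0 -> dynA s < 0 ->
  hjb_threshold lam (weightT s * point_xe s + Num.min 0 (kappa s + lam))
    (fun=> weightT s / (2 * `|dynA s|)).
Proof.
move=> hC a0; have gE : gain_ratio s = 0 by rewrite /gain_ratio hC expr0n/= mul0r.
have an0 : `|dynA s| != 0 by rewrite normr_eq0 lt_eqF.
split.
- split; first exact: (continuous_subspaceT (@cst_continuous _ _ _)).
  move=> S S0; rewrite active_termE gE !mul0r subr0.
  have -> : passive_term s (fun=> weightT s / (2 * `|dynA s|)) S =
      weightT s * point_xe s.
    by rewrite /passive_term passive_driftE//; field.
  by rewrite addr_minr addr0.
- by move=> S _; rewrite divr_ge0 ?mulr_ge0//; case: hs.
- by move=> -> S _; rewrite mul0r.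
- by move=> S S0; rewrite gE !mul0r /whittle_value hC eqxx.
Qed.

Lemma hjb_unweighted (lam : R) : gainC s != 0 -> weightT s = 0 ->
  hjb_threshold lam (Num.min 0 (kappa s + lam)) (fun=> 0).
Proof.
move=> hC T0; split => //.
- split; first exact: (continuous_subspaceT (@cst_continuous _ _ _)).
  move=> S S0; rewrite active_termE mulr0 subr0.
  by rewrite /passive_term T0 !(mul0r, mulr0) !add0r.
- by move=> S S0; rewrite mulr0 /whittle_value T0 eqxx orbT.
Qed.

Lemma hjb_eqP (lam gam : R) (d : R -> R) (S : R) :
  gam = Num.min (passive_term s d S) (active_term s lam d S) <->
  gam - weightT s * S = Num.min (passive_drift s S * d S)
    ((kappa s + lam) + active_drift s S * d S).
Proof.
rewrite /passive_term (_ : active_term s lam d S = weightT s * S +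
  (kappa s + lam + active_drift s S * d S)); last by rewrite /active_term; ring.
rewrite -addr_minr; split => [->|/eqP]; first by rewrite addrAC subrr add0r.
by rewrite subr_eq addrC => /eqP.
Qed.

Definition passive_slope (gam S : R) : R := (gam - weightT s * S) / passive_drift s S.

Definition active_slope (lam gam S : R) : R :=
  (gam - (kappa s + lam) - weightT s * S) / active_drift s S.

Lemma continuous_affine (b c S : R) : {for S, continuous (fun S : R => b - c * S)}.
Proof. by apply: cvgB; [exact: cvg_cst|apply: cvgM; [exact: cvg_cst|exact: cvg_id]]. Qed.

Lemma continuous_passive_slope (gam S : R) : passive_drift s S != 0 ->
  {for S, continuous (passive_slope gam)}.
Proof.
move=> p0; apply: cvgM; first exact: continuous_affine.
apply: cvgV => //; apply: cvgD; last exact: cvg_cst.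
by apply: cvgM; [exact: cvg_cst|exact: cvg_id].
Qed.

Lemma continuous_active_slope (lam gam S : R) : active_drift s S != 0 ->
  {for S, continuous (active_slope lam gam)}.
Proof.
move=> q0; apply: cvgM; first exact: continuous_affine.
apply: cvgV => //; apply: cvgB.
  by apply: cvgD; [apply: cvgM; [exact: cvg_cst|exact: cvg_id]|exact: cvg_cst].
by apply: cvgM; [exact: cvg_cst|exact: (@exprn_continuous _ 2)].
Qed.

(** Clamping the argument keeps a slope away from the zeros of its denominator, so that branches can
    be glued by a single formula, continuous on the half-line. *)
Lemma continuous_compmin (f : R -> R) (X S : R) :
  {for Num.min S X, continuous f} -> {for S, continuous (fun S => f (Num.min S X))}.
Proof.
move=> cf; apply: (@continuous_comp _ _ _ (fun S => Num.min S X) f) => //.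
by apply: (@continuous_min _ _ id (fun=> X)); [exact: cvg_id|exact: cvg_cst].
Qed.

Lemma continuous_compmax (f : R -> R) (X S : R) :
  {for Num.max S X, continuous f} -> {for S, continuous (fun S => f (Num.max S X))}.
Proof.
move=> cf; apply: (@continuous_comp _ _ _ (fun S => Num.max S X) f) => //.
by apply: (@continuous_max _ _ id (fun=> X)); [exact: cvg_id|exact: cvg_cst].
Qed.

Section Observed.
Hypotheses (hC : gainC s != 0) (hT : weightT s != 0).
Let g0 := gain_ratio_gt0 hs hC.
Let T0 := weightT_gt0 hs hT.
Let x10 := root_x1_lt0 hs hC.
Let x20 := root_x2_gt0 hs hC.

Lemma active_drift_lt0 (S : R) : root_x2 s < S -> active_drift s S < 0.
Proof.
move=> x2S; rewrite active_driftE// !mulNr oppr_lt0.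
apply: mulr_gt0; last by rewrite subr_gt0.
by rewrite mulr_gt0// subr_gt0 (lt_trans x10)// (lt_trans x20).
Qed.

Lemma active_drift_ge0 (S : R) : 0 <= S -> S <= root_x2 s -> 0 <= active_drift s S.
Proof.
move=> S0 Sx2; rewrite active_driftE// !mulNr -mulrN opprB mulr_ge0 ?subr_ge0//.
by rewrite mulr_ge0 ?(ltW g0)// subr_ge0 (le_trans (ltW x10)).
Qed.

Lemma active_drift_root_x2 : active_drift s (root_x2 s) = 0.
Proof. by rewrite active_driftE// subrr mulr0. Qed.

(** Up to [x2] both drifts are nonnegative, so the minimum is nondecreasing in [d] and the larger of
    the two branch slopes [U] and [L] solves the equation. Beyond [x2] the active slope [U] remains;
    the cancelled factor [S - x2] makes it regular at [x2]. *)
Lemma hjb_always_active (lam : R) : kappa s + lam <= wv (root_x2 s) ->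
  exists d, hjb_threshold lam (weightT s * root_x2 s + (kappa s + lam)) d.
Proof.
set m := kappa s + lam => m2; set gam := weightT s * root_x2 s + m.
pose U (S : R) := weightT s / (gain_ratio s * (S - root_x1 s)).
pose L := passive_slope gam.
(* [L] is evaluated only up to [x2], where the passive drift is positive. Since [L <= U] at [x2],
   the correction vanishes beyond. *)
pose d (S : R) := U S + Num.max 0 (L (Num.min S (root_x2 s)) - U (Num.min S (root_x2 s))).
have Sx1 (S : R) : 0 <= S -> 0 < S - root_x1 s.
  by move=> S0; rewrite subr_gt0 (lt_le_trans x10).
have U0 (S : R) : 0 <= S -> 0 <= U S.
  by move=> S0; rewrite divr_ge0 ?(ltW T0)// mulr_ge0 ?(ltW g0)// ltW// Sx1.
have UE (S : R) : 0 <= S -> m + active_drift s S * U S = gam - weightT s * S.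
  move=> S0; rewrite active_driftE// /U /gam; field.
  by rewrite !gt_eqF//= Sx1.
have gU (S : R) : 0 <= S -> gain_ratio s * S ^+ 2 * U S = weightT s * S ^+ 2 / (S - root_x1 s).
  by move=> S0; rewrite /U; field; rewrite !gt_eqF//= Sx1.
have p_gt0 (S : R) : 0 <= S -> S <= root_x2 s -> 0 < passive_drift s S.
  move=> S_0 Sx2; apply: (passive_drift_gt0 hs) => // a0.
  exact: le_lt_trans (root_x2_lt_xe hs hC a0).
have dlow (S : R) : 0 <= S -> S <= root_x2 s -> d S = Num.max (U S) (L S).
  by move=> S0 Sx2; rewrite /d min_l// addr_maxr addr0 subrKC.
have LUx2 : L (root_x2 s) <= U (root_x2 s).
  rewrite /L /passive_slope /gam [_ + m]addrC addrK passive_drift_root_x2//.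
  rewrite ler_pdivrMr; last by rewrite mulr_gt0// exprn_gt0.
  rewrite mulrC gU ?(ltW x20)//.
  by rewrite -whittle_value_low.
have dhigh (S : R) : root_x2 s <= S -> d S = U S.
  by move=> x2S; rewrite /d min_r// max_l ?addr0// subr_le0.
have pL (S : R) : 0 <= S -> S <= root_x2 s -> passive_drift s S * L S = gam - weightT s * S.
  by move=> S0 Sx2; rewrite mulrC divfK// gt_eqF// p_gt0.
exists d; split; last first.
- move=> S S0; rewrite -/m; have [Sx2|x2S] := leP S (root_x2 s); last first.
    rewrite (dhigh _ (ltW x2S)) gU//.
    have wS : wv (root_x2 s) < wv S by apply: whittle_value_lt => //; exact: ltW.
    rewrite [RHS]leNgt (le_lt_trans m2 wS)/=; apply/negbTE; rewrite -ltNge.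
    rewrite (le_lt_trans m2)// whittle_value_low//.
    exact: (low_value_lt hs hC hT (ltW x20) x2S).
  rewrite dlow// (whittle_value_low hC hT Sx2) -gU//.
  have gS0 : 0 <= gain_ratio s * S ^+ 2 by rewrite mulr_ge0 ?sqr_ge0// ltW.
  apply/idP/idP => [|HU].
    by apply: le_trans; rewrite ler_wpM2l// le_max lexx.
  rewrite maxr_pMr// ge_max HU/=.
  (* Multiplied by the passive drift, the inequality for [L] becomes the inequality for [U]
     multiplied by the active drift, which is nonnegative here. *)
  have pE : passive_drift s S = gain_ratio s * S ^+ 2 + active_drift s S.
    by rewrite -drift_diff subrK.
  rewrite -(ler_pM2l (p_gt0 _ S0 Sx2)) mulrCA pL// -UE// pE -subr_ge0.
  rewrite (_ : _ - _ = active_drift s S * (m - gain_ratio s * S ^+ 2 * U S)); last by ring.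
  by rewrite mulr_ge0 ?active_drift_ge0// subr_ge0.
- by move=> /eqP; rewrite (negPf hT).
- by move=> S S0; rewrite addr_ge0 ?U0// le_max lexx.
split.
  apply: continuous_in_subspaceT => S; rewrite inE/= in_itv/= andbT => S0.
  have cU (u : R) : 0 <= u -> {for u, continuous U}.
    move=> u0; apply: cvgM; first exact: cvg_cst.
    apply: cvgV; first by rewrite gt_eqF// mulr_gt0// Sx1.
    by apply: cvgM; [exact: cvg_cst|apply: cvgB; [exact: cvg_id|exact: cvg_cst]].
  have m0 : 0 <= Num.min S (root_x2 s) by rewrite le_min S0 ltW.
  apply: cvgD; first exact: cU.
  apply: (@continuous_max _ _ (fun=> 0)
    (fun u => L (Num.min u (root_x2 s)) - U (Num.min u (root_x2 s)))); first exact: cvg_cst.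
  apply: (@continuous_compmin (fun u => L u - U u)).
  apply: cvgB; last exact: cU.
  apply: continuous_passive_slope; rewrite gt_eqF// p_gt0//.
  by rewrite ge_min lexx orbT.
move=> S S0; apply/hjb_eqP; rewrite -/m.
have [Sx2|/ltW x2S] := leP S (root_x2 s).
  rewrite dlow//; apply/eqP; rewrite eq_le; apply/andP; split.
    rewrite le_min -{1}pL// -UE// lerD2l !ler_wpM2l ?le_max ?lexx ?orbT//.
      exact: active_drift_ge0.
    exact/ltW/p_gt0.
  by rewrite ge_min /Num.max; case: ltP => _; rewrite ?pL ?UE// lexx ?orbT.
rewrite dhigh// min_r; first by rewrite UE.
rewrite -lerBrDr -mulrBl drift_diff gU//.
apply: le_trans m2 _; rewrite whittle_value_low//.
move: x2S; rewrite le_eqVlt => /predU1P[->//|x2S].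
exact/ltW/(low_value_lt hs hC hT (ltW x20) x2S).
Qed.

Lemma passive_slopeK (gam S : R) : passive_drift s S != 0 ->
  passive_drift s S * passive_slope gam S = gam - weightT s * S.
Proof. by move=> p0; rewrite mulrC divfK. Qed.

Lemma active_slopeK (lam gam S : R) : active_drift s S != 0 ->
  (kappa s + lam) + active_drift s S * active_slope lam gam S = gam - weightT s * S.
Proof. by move=> q0; rewrite mulrC divfK//; ring. Qed.

(** Following the passive branch is consistent with optimality exactly when the gap is nonnegative.
    [ge_active_slope] gives the same criterion for the active branch where the active drift is
    negative. *)
Lemma le_passive_slope (lam gam S : R) : 0 < passive_drift s S ->
  (gain_ratio s * S ^+ 2 * passive_slope gam S <= kappa s + lam) =
  (0 <= hjb_gap s lam gam S).
Proof.
move=> p0; rewrite -(ler_pM2l p0) mulrCA passive_slopeK ?gt_eqF// -subr_ge0.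
by rewrite /hjb_gap; congr (0 <= _); ring.
Qed.

Lemma hjb_gap_active (lam gam S : R) : active_drift s S < 0 ->
  hjb_gap s lam gam S = active_drift s S *
    (kappa s + lam - gain_ratio s * S ^+ 2 * active_slope lam gam S).
Proof.
move=> q0; rewrite /hjb_gap -(@active_slopeK lam gam S) ?lt_eqF//.
by rewrite -(subrK (active_drift s S) (passive_drift s S)) drift_diff; ring.
Qed.

Lemma ge_active_slope (lam gam S : R) : active_drift s S < 0 ->
  (kappa s + lam <= gain_ratio s * S ^+ 2 * active_slope lam gam S) =
  (0 <= hjb_gap s lam gam S).
Proof. by move=> q0; rewrite hjb_gap_active// nmulr_rge0// subr_le0. Qed.

Lemma le_active_slope (lam gam S : R) : active_drift s S < 0 ->
  (gain_ratio s * S ^+ 2 * active_slope lam gam S <= kappa s + lam) =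
  (hjb_gap s lam gam S <= 0).
Proof. by move=> q0; rewrite hjb_gap_active// nmulr_rle0// subr_ge0. Qed.

(** The assumed value of [kappa s + lam] makes [X] a stationary point of the holding cost. The gap,
    a cubic in [S], then has a double zero at [X], and the remaining linear factor is positive for
    [S >= 0]. *)
Lemma hjb_gap_hold (lam X S : R) : 0 < X -> 0 < dynA s * X + noiseW s ->
  kappa s + lam = gain_ratio s / 2 * (weightT s * X ^+ 3 / (dynA s * X + noiseW s)) ->
  hjb_gap s lam (hold_cost s lam X) S =
  gain_ratio s * weightT s * (S - X) ^+ 2 *
  (2 * S * (dynA s * X + noiseW s) + noiseW s * X) / (2 * (dynA s * X + noiseW s)).
Proof.
move=> X0 DX E; rewrite /hjb_gap /hold_cost E /passive_drift.
by field; rewrite !gt_eqF.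
Qed.

(** * Prices strictly between the indices of [x2] and [xe] *)

Section Intermediate.
Variables (lam X : R).
Hypotheses (x2X : root_x2 s < X) (Xxe : dynA s < 0 -> X < point_xe s)
  (XE : kappa s + lam = wv X).
Let X0 : 0 < X := lt_trans x20 x2X.
Let DX : 0 < dynA s * X + noiseW s.
Proof. by apply: half_drift_gt0 => //; [exact: ltW|move=> /Xxe/ltW]. Qed.

Lemma hjb_gap_intermediate (S : R) : hjb_gap s lam (hold_cost s lam X) S =
  gain_ratio s * weightT s * (S - X) ^+ 2 *
  (2 * S * (dynA s * X + noiseW s) + noiseW s * X) / (2 * (dynA s * X + noiseW s)).
Proof.
apply: hjb_gap_hold => //; rewrite XE whittle_value_mid// ?(ltW x2X)//.
by move=> /Xxe/ltW.
Qed.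

Lemma hjb_gap_intermediate_gt0 (S : R) : 0 <= S -> S != X ->
  0 < hjb_gap s lam (hold_cost s lam X) S.
Proof.
move=> S0 SX; rewrite hjb_gap_intermediate; have W0 : 0 < noiseW s by case: hs.
apply: divr_gt0; last by rewrite mulr_gt0.
apply: mulr_gt0.
  by apply: mulr_gt0; [exact: mulr_gt0|rewrite exprn_even_gt0//= subr_eq0].
by apply: ltr_wpDl; [apply: mulr_ge0; [apply: mulr_ge0|exact: ltW]|exact: mulr_gt0].
Qed.

(** The passive slope is followed up to [X] and the active one from [X] on, each where its
    denominator has a strict sign. A nonnegative gap makes each branch optimal on its side, and the
    zero of the gap at [X] makes them meet. *)
Lemma hjb_intermediate : exists d, hjb_threshold lam (hold_cost s lam X) d.
Proof.
have W0 : 0 < noiseW s by case: hs.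
set gam := hold_cost s lam X.
have gap0 (S : R) : 0 <= S -> 0 <= hjb_gap s lam gam S.
  move=> S0; have [->|SX] := eqVneq S X; last exact/ltW/hjb_gap_intermediate_gt0.
  by rewrite hjb_gap_intermediate subrr expr0n/= mulr0 !mul0r.
have p_gt0 (S : R) : 0 <= S -> S <= X -> 0 < passive_drift s S.
  move=> S0 SX; apply: (passive_drift_gt0 hs) => // /Xxe; exact: le_lt_trans.
have q_lt0 (S : R) : X <= S -> active_drift s S < 0.
  by move=> XS; apply: active_drift_lt0; exact: lt_le_trans XS.
have m0 : 0 <= kappa s + lam.
  rewrite XE whittle_value_mid// ?(ltW x2X)//; last by move=> /Xxe/ltW.
  apply: mulr_ge0; first by rewrite divr_ge0// ltW.
  apply: divr_ge0; last exact: ltW.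
  by apply: mulr_ge0; [exact: ltW|rewrite exprn_ge0// ltW].
have gX : 0 < gain_ratio s * X ^+ 2 by rewrite mulr_gt0// exprn_gt0.
have gamX : gam - weightT s * X = (kappa s + lam) * (passive_drift s X / (gain_ratio s * X ^+ 2)).
  by rewrite /gam /hold_cost addrAC subrr add0r.
have gamX' : gam - (kappa s + lam) - weightT s * X =
    (kappa s + lam) * (active_drift s X / (gain_ratio s * X ^+ 2)).
  rewrite addrAC gamX (_ : active_drift s X = passive_drift s X - gain_ratio s * X ^+ 2).
    by field; rewrite !gt_eqF.
  by rewrite -drift_diff opprB subrKC.
pose L := passive_slope gam; pose U := active_slope lam gam.
have LUX : L X = U X.
  rewrite /L /U /passive_slope /active_slope gamX gamX'.
  have pn := lt0r_neq0 (p_gt0 X (ltW X0) (lexx X)); have qn := ltr0_neq0 (q_lt0 X (lexx X)).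
  have gn := lt0r_neq0 g0; have Xn := lt0r_neq0 X0.
  by field; rewrite pn qn gn Xn.
(* On either side of [X] one clamped slope is frozen at the common value [L X], which is
   subtracted. *)
pose d (S : R) := L (Num.min S X) + U (Num.max S X) - L X.
have dlow (S : R) : S <= X -> d S = L S.
  by move=> SX; rewrite /d min_l// max_r// LUX addrK.
have dhigh (S : R) : X <= S -> d S = U S.
  by move=> XS; rewrite /d min_r// max_l// addrAC subrr add0r.
exists d; split; last first.
- move=> S S0; rewrite [in RHS]XE whittle_value_le//; last exact: ltW.
  have [SX|XS] := leP S X; first by rewrite dlow// le_passive_slope ?gap0// p_gt0.
  rewrite dhigh ?(ltW XS)// le_active_slope ?q_lt0 ?(ltW XS)//.
  by apply/negbTE; rewrite -ltNge hjb_gap_intermediate_gt0// gt_eqF.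
- by move=> /eqP; rewrite (negPf hT).
- move=> S S0; have [SX|/ltW XS] := leP S X.
    rewrite dlow// divr_ge0//; last exact/ltW/p_gt0.
    rewrite (@le_trans _ _ (gam - weightT s * X))//.
      by rewrite gamX mulr_ge0// divr_ge0 ?(ltW gX)// ltW// p_gt0// ltW.
    by rewrite lerD2l lerN2 ler_pM2l.
  rewrite dhigh// /U /active_slope nmulr_lge0 ?invr_lt0 ?q_lt0//.
  rewrite (@le_trans _ _ (gam - (kappa s + lam) - weightT s * X))//.
    by rewrite lerD2l lerN2 ler_pM2l.
  by rewrite gamX' mulr_ge0_le0// mulr_le0_ge0 ?ltW ?q_lt0// invr_gt0.
split.
  apply: continuous_in_subspaceT => S; rewrite inE/= in_itv/= andbT => S0.
  apply: cvgB; last exact: cvg_cst.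
  apply: cvgD.
    apply: (@continuous_compmin L); apply: continuous_passive_slope.
    by rewrite gt_eqF// p_gt0 ?ge_min ?lexx ?orbT// le_min S0 ltW.
  apply: (@continuous_compmax U); apply: continuous_active_slope.
  by rewrite lt_eqF// q_lt0// le_max lexx orbT.
move=> S S0; apply/hjb_eqP; have [SX|/ltW XS] := leP S X.
  rewrite dlow// min_l; first by rewrite passive_slopeK// gt_eqF// p_gt0.
  rewrite -lerBlDr -mulrBl drift_diff le_passive_slope ?gap0//; exact: p_gt0.
rewrite dhigh// min_r; first by rewrite active_slopeK// lt_eqF// q_lt0.
rewrite -lerBrDr -mulrBl drift_diff ge_active_slope ?gap0//; exact: q_lt0.
Qed.

End Intermediate.

(** The mirror image of the always active case: from [xe] on the passive drift is nonpositive and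
    the active one negative, so the minimum is nonincreasing in [d] and the smaller branch slope
    solves the equation. Below [xe] the constant passive slope [c] remains. *)
Lemma hjb_passive_below (lam : R) : dynA s < 0 -> wv (point_xe s) <= kappa s + lam ->
  exists d, hjb_threshold lam (weightT s * point_xe s) d.
Proof.
move=> a0 mxe; set gam := weightT s * point_xe s.
have xe0 := point_xe_gt0 hs a0.
have a_gt0 : 0 < 2 * `|dynA s| by rewrite mulr_gt0// normr_gt0 lt_eqF.
pose c := weightT s / (2 * `|dynA s|).
have c0 : 0 < c by rewrite divr_gt0.
have pc (S : R) : passive_drift s S * c = gam - weightT s * S.
  by rewrite passive_driftE// /c /gam; field; rewrite normr_eq0 lt_eqF.
have gc (S : R) : gain_ratio s * S ^+ 2 * c =
    weightT s * gain_ratio s * S ^+ 2 / (2 * `|dynA s|) by rewrite /c; ring.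
pose U := active_slope lam gam.
have q_lt0 (S : R) : point_xe s <= S -> active_drift s S < 0.
  by move=> XS; apply: active_drift_lt0; exact: lt_le_trans (root_x2_lt_xe hs hC a0) XS.
pose d (S : R) := c + Num.min 0 (U (Num.max S (point_xe s)) - c).
have m0 : 0 <= kappa s + lam.
  rewrite (le_trans _ mxe)// whittle_value_high// -gc mulr_ge0 ?(ltW c0)//.
  by rewrite mulr_ge0 ?sqr_ge0// ltW.
have dhigh (S : R) : point_xe s <= S -> d S = Num.min c (U S).
  by move=> XS; rewrite /d max_l// addr_minr addr0 subrKC.
have p_le0 (S : R) : point_xe s <= S -> passive_drift s S <= 0.
  by move=> XS; rewrite passive_driftE// pmulr_rle0// subr_le0.
have gapE (S : R) : hjb_gap s lam gam S =
    passive_drift s S * ((kappa s + lam) - gain_ratio s * S ^+ 2 * c).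
  by rewrite /hjb_gap -pc; ring.
(* The gap vanishes at [xe], so the active slope there is at least the indifference slope, while [c]
   is at most that slope because the index of [xe] is at most the price. *)
have cU : c <= U (point_xe s).
  have gx : 0 < gain_ratio s * point_xe s ^+ 2 by rewrite mulr_gt0// exprn_gt0.
  rewrite -(ler_pM2l gx) (le_trans _ (_ : kappa s + lam <= _))//.
    by rewrite gc -whittle_value_high.
  by rewrite ge_active_slope ?q_lt0// gapE passive_drift_xe// mul0r.
have dlow (S : R) : S <= point_xe s -> d S = c.
  by move=> SX; rewrite /d max_r// min_l ?addr0// subr_ge0.
have gS0 (S : R) : 0 <= gain_ratio s * S ^+ 2 by rewrite mulr_ge0 ?sqr_ge0// ltW.
exists d; split; last first.
- move=> S S0; have [SX|XS] := leP S (point_xe s).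
    rewrite dlow// [RHS](le_trans _ mxe); last by rewrite whittle_value_le// ltW.
    rewrite (le_trans _ mxe)// whittle_value_high// -gc ler_wpM2r ?(ltW c0)//.
    by rewrite ler_wpM2l ?(ltW g0)// lerXn2r// nnegrE ltW.
  rewrite dhigh ?(ltW XS)// (whittle_value_high hs hC hT a0 (ltW XS)) -gc.
  have p_lt0 : passive_drift s S < 0.
    by rewrite passive_driftE// pmulr_rlt0// subr_lt0.
  apply/idP/idP => [H|]; last first.
    by apply: le_trans; rewrite ler_wpM2l// ge_min lexx.
  rewrite leNgt; apply/negP => mc.
  have [cU'|Uc] := leP c (U S).
    by move: H; rewrite min_l// leNgt mc.
  move: H; rewrite min_r ?(ltW Uc)// => H.
  move: H; rewrite le_active_slope ?q_lt0 ?(ltW XS)// gapE.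
  by rewrite nmulr_rle0// subr_ge0 leNgt mc.
- by move=> /eqP; rewrite (negPf hT).
- move=> S S0; have [SX|/ltW XS] := leP S (point_xe s); first by rewrite dlow// ltW.
  rewrite dhigh// le_min (ltW c0)/= /U /active_slope nmulr_lge0 ?invr_lt0 ?q_lt0//.
  rewrite addrAC subr_le0 (le_trans _ m0)// subr_le0.
  by rewrite ler_pM2l.
split.
  apply: continuous_in_subspaceT => S; rewrite inE/= in_itv/= andbT => S0.
  apply: cvgD; first exact: cvg_cst.
  apply: (@continuous_min _ _ (fun=> 0) (fun u => U (Num.max u (point_xe s)) - c)).
    exact: cvg_cst.
  apply: cvgB; last exact: cvg_cst.
  apply: (@continuous_compmax U); apply: continuous_active_slope.
  by rewrite lt_eqF// q_lt0// le_max lexx orbT.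
move=> S S0; apply/hjb_eqP; have [SX|/ltW XS] := leP S (point_xe s).
  rewrite dlow// min_l; first by rewrite pc.
  rewrite -lerBlDr -mulrBl drift_diff (le_trans _ mxe)// whittle_value_high// -gc.
  rewrite ler_wpM2r ?(ltW c0)// ler_wpM2l ?(ltW g0)// lerXn2r// nnegrE ltW//.
rewrite dhigh//; apply/eqP; rewrite eq_le; apply/andP; split.
  rewrite le_min -{1}pc -(@active_slopeK lam gam S) ?lt_eqF ?q_lt0// lerD2l.
  rewrite ler_wnM2l ?p_le0 ?ge_min ?lexx//= ler_wnM2l ?ge_min ?lexx ?orbT//.
  exact/ltW/q_lt0.
rewrite ge_min /Num.min; case: ltP => _; first by rewrite pc lexx.
by rewrite active_slopeK ?lexx ?orbT// lt_eqF// q_lt0.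
Qed.

End Observed.
End HJBSolutions.

(** * Uniqueness for the HJB equation *)

Section Uniqueness.
Context {R : realType}.

Lemma within_continuousD (f g : R -> R) :
  {within `[0, +oo[, continuous f} -> {within `[0, +oo[, continuous g} ->
  {within `[0, +oo[, continuous (fun S => f S + g S)}.
Proof.
move=> /subspace_continuousP cf /subspace_continuousP cg.
by apply/subspace_continuousP => S S0; apply: cvgD; [exact: cf|exact: cg].
Qed.

Lemma within_continuousM (f g : R -> R) :
  {within `[0, +oo[, continuous f} -> {within `[0, +oo[, continuous g} ->
  {within `[0, +oo[, continuous (fun S => f S * g S)}.
Proof.
move=> /subspace_continuousP cf /subspace_continuousP cg.
by apply/subspace_continuousP => S S0; apply: cvgM; [exact: cf|exact: cg].
Qed.

(** Used at points where a drift vanishes or the optimal action changes: there the equality of two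
    solutions is recovered from continuity. *)
Lemma eq_left_limit (d1 d2 : R -> R) (l t : R) :
  {within `[0, +oo[, continuous d1} -> {within `[0, +oo[, continuous d2} ->
  0 <= l -> l < t -> (forall u : R, l < u -> u < t -> d1 u = d2 u) -> d1 t = d2 t.
Proof.
move=> c1 c2 l0 lt eq12; apply/eqP; rewrite -subr_eq0 -normr_le0.
apply/ler_addgt0Pl => e e0; rewrite addr0; have t0 : 0 <= t by rewrite (le_trans l0)// ltW.
have e20 : 0 < e / 2 by rewrite divr_gt0.
have [eta1 eta10 H1] := within_continuous_dist c1 t0 e20.
have [eta2 eta20 H2] := within_continuous_dist c2 t0 e20.
pose eps := Num.min (t - l) (Num.min eta1 eta2) / 2.
have eps0 : 0 < eps by rewrite divr_gt0// !lt_min subr_gt0 lt eta10.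
have eps2 : eps < Num.min (t - l) (Num.min eta1 eta2).
  by rewrite ltr_pdivrMr// ltr_pMr ?ltr1n// !lt_min subr_gt0 lt eta10.
move: eps2; rewrite !lt_min => /and3P[epsl eps1 eps2].
pose u := t - eps; have lu : l < u by rewrite ltrBrDr -ltrBrDl.
have u0 : 0 <= u by rewrite (le_trans l0)// ltW.
have ut : `|u - t| = eps by rewrite /u addrAC subrr add0r normrN gtr0_norm.
have {}H1 := H1 u u0; have {}H2 := H2 u u0; rewrite ut in H1 H2.
have -> : d1 t - d2 t = (d2 u - d2 t) - (d1 u - d1 t).
  by rewrite (eq12 u)// /u ?gtrBl//; ring.
by rewrite (le_trans (ler_normB _ _))// [leRHS]splitr lerD ?H1 ?H2.
Qed.

(** Two slopes of the same sign make the minimum strictly monotone in the unknown. *)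
Lemma min_affine_inj (p q m d1 d2 : R) : 0 < p * q ->
  Num.min (p * d1) (m + q * d1) = Num.min (p * d2) (m + q * d2) -> d1 = d2.
Proof.
wlog : p q d1 d2 / d1 < d2 => [wl pq E|d12 pq].
  have [d12|d21|//] := ltgtP d1 d2; first exact: (wl p q).
  by apply/esym/(wl p q).
have [p0|p0|p0] := ltgtP p 0; last by move: pq; rewrite p0 mul0r ltxx.
- have q0 : q < 0 by move: pq; rewrite nmulr_rgt0.
  move=> E; suff : Num.min (p * d2) (m + q * d2) < Num.min (p * d1) (m + q * d1).
    by rewrite E ltxx.
  rewrite lt_min !gt_min ltr_nM2l// d12/= ltrD2l ltr_nM2l// d12 orbT.
  by [].
- have q0 : 0 < q by move: pq; rewrite pmulr_rgt0.
  move=> E; suff : Num.min (p * d1) (m + q * d1) < Num.min (p * d2) (m + q * d2).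
    by rewrite E ltxx.
  by rewrite lt_min !gt_min ltr_pM2l// d12/= ltrD2l ltr_pM2l// d12 orbT.
Qed.

Variable s : site R.
Hypothesis (hs : standing_assumptions s).
Variables (lam gam : R).
Let m := kappa s + lam.

(** Its sign tells the optimal action: negative for strictly passive, positive for strictly active,
    zero for indifference. *)
Definition active_excess (d : R -> R) (S : R) : R :=
  gain_ratio s * S ^+ 2 * d S - (kappa s + lam).
Local Notation e := active_excess.

Section OneSolution.
Variable d : R -> R.
Hypothesis (hd : hjb s lam gam d).

Lemma hjb_passive (S : R) : 0 <= S -> e d S <= 0 ->
  passive_drift s S * d S = gam - weightT s * S.
Proof.
move=> S0 eS; have /hjb_eqP -> := hd.2 S S0.
by rewrite min_l// -lerBlDr -mulrBl drift_diff -subr_le0.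
Qed.

Lemma hjb_active (S : R) : 0 <= S -> 0 <= e d S ->
  m + active_drift s S * d S = gam - weightT s * S.
Proof.
move=> S0 eS; have /hjb_eqP -> := hd.2 S S0.
by rewrite min_r// -lerBrDr -mulrBl drift_diff -subr_ge0.
Qed.

(** At a point of indifference the passive branch equation and [gain_ratio s * S ^+ 2 * d S = kappa
    s + lam] hold together; eliminating [d S] makes the gap zero. *)
Lemma active_excess_neq0 (S : R) : 0 <= S -> hjb_gap s lam gam S != 0 -> e d S != 0.
Proof.
move=> S0; apply: contra_neq => eS.
have := hjb_passive S0; rewrite eS lexx => /(_ isT) E.
move/eqP: eS; rewrite subr_eq0 => /eqP eS.
by rewrite /hjb_gap -E -eS; ring.
Qed.

Lemma active_excess_sign (a b : R) : 0 <= a -> a <= b ->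
  (forall S : R, a <= S -> S <= b -> e d S != 0) -> (e d a < 0) = (e d b < 0).
Proof.
move=> a0 ab nz.
have ce0 : {within `[0, +oo[, continuous (e d)}.
  apply: within_continuousD; last exact: (continuous_subspaceT (@cst_continuous _ _ _)).
  apply: within_continuousM; last exact: hd.1.
  apply: continuous_subspaceT => S.
  by apply: cvgM; [exact: cvg_cst|exact: (@exprn_continuous _ 2)].
have ce : {within `[a, b], continuous (e d)}.
  apply: continuous_subspaceW ce0 => S /=.
  by rewrite !in_itv/= => /andP[aS _]; rewrite (le_trans a0).
have aN := nz a (lexx _) ab; have bN := nz b ab (lexx _).
apply/idP/idP => H; rewrite ltNge; apply/negP => H'.
  have [|c + /eqP] := @IVT _ (e d) a b 0 ab ce.
    by rewrite ge_min le_max (ltW H) H' orbT.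
  by rewrite in_itv/= => /andP[ac cb]; apply/negP/nz.
have [|c + /eqP] := @IVT _ (e d) a b 0 ab ce.
  by rewrite ge_min le_max (ltW H) H' orbT.
by rewrite in_itv/= => /andP[ac cb]; apply/negP/nz.
Qed.

(* Being passive at all large variances forces h to tend to -oo. *)
Lemma hjb_not_eventually_passive (h : R -> R) (lb S1 : R) :
  0 <= dynA s -> 0 < weightT s -> 0 <= S1 ->
  (forall S : R, 0 < S -> is_derive S (1 : R) h (d S)) ->
  (forall S : R, 0 <= S -> lb <= h S) ->
  ~ (forall S : R, S1 <= S -> passive_drift s S * d S = gam - weightT s * S).
Proof.
move=> a0 T0 S10 dh hlb Hd; have W0 : 0 < noiseW s by case: hs.
(* Beyond [S2] one has [gam - T S <= - T S / 2] and a passive drift of at most [(2 A + W) S], so the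
   passive slope is at most [- c]. *)
pose c := weightT s / (2 * (2 * dynA s + noiseW s)).
have aw0 : 0 < 2 * dynA s + noiseW s by rewrite ltr_wpDl// mulr_ge0.
have c0 : 0 < c by rewrite divr_gt0// mulr_gt0.
pose S2 := Num.max S1 (Num.max 1 (2 * gam / weightT s)).
have S21 : S1 <= S2 by rewrite le_max lexx.
have S2_1 : 1 <= S2 by rewrite !le_max lexx orbT.
have S2g : 2 * gam / weightT s <= S2 by rewrite !le_max lexx !orbT.
have dc (S : R) : S2 <= S -> d S <= - c.
  move=> S2S; have S_1 : 1 <= S by exact: le_trans S2S.
  have S0 : 0 < S by exact: lt_le_trans S_1.
  have p0 : 0 < passive_drift s S.
    by rewrite /passive_drift ltr_wpDl// !mulr_ge0// ltW.
  rewrite -(ler_pM2l p0) Hd; last exact: le_trans S2S.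
  have pS : passive_drift s S <= (2 * dynA s + noiseW s) * S.
    rewrite (_ : _ * S = 2 * dynA s * S + noiseW s * S); last by ring.
    by rewrite lerD2l ler_pMr.
  have g2 : 2 * gam <= weightT s * S.
    by rewrite mulrC -[leRHS]mulrC -ler_pdivrMr// mulrC (le_trans S2g).
  have : c * passive_drift s S <= weightT s * S / 2.
    rewrite (@le_trans _ _ (c * ((2 * dynA s + noiseW s) * S)))//.
      by rewrite ler_wpM2l// ltW.
    by rewrite le_eqVlt; apply/orP; left; apply/eqP; rewrite /c; field; rewrite gt_eqF.
  by move=> H; clear -H g2; lra.
have decr (S : R) : S2 <= S -> h S + c * S <= h S2 + c * S2.
  move=> S2S; rewrite -lerN2.
  have S2_0 : 0 < S2 by exact: lt_le_trans S2_1.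
  apply: (@is_derive_le _ (fun S => - (h S + c * S)) (fun S => - (d S + c * 1)) _ _ S2S).
    move=> u /andP[S2u _]; have dhu := dh u (lt_le_trans S2_0 S2u).
    have dcu : is_derive u (1 : R) (fun S : R => c * S) (c * 1) by exact: is_deriveZ.
    exact: is_deriveN (is_deriveD dhu dcu).
  by move=> u /andP[S2u _]; rewrite oppr_ge0 mulr1 -lerBrDr sub0r dc.
have S20 : 0 <= S2 by exact: le_trans S2_1.
(* At this point a decrease at rate [c] from [h S2] has brought [h] down to at most [lb - 1]. *)
pose S := S2 + (h S2 - lb + 1) / c.
have hS2 := hlb S2 S20.
have S2S : S2 <= S by rewrite lerDl divr_ge0 ?(ltW c0)// addr_ge0// subr_ge0.
have := decr S S2S; have := hlb S (le_trans S20 S2S).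
have -> : c * S = c * S2 + (h S2 - lb + 1).
  by rewrite /S mulrDr; congr (_ + _); rewrite mulrC divfK// gt_eqF.
move: (h S) (h S2) (c * S2) => x y z H1 H2; clear -H1 H2; lra.
Qed.

End OneSolution.

Section Observed.
Hypotheses (hC : gainC s != 0).
Let g0 := gain_ratio_gt0 hs hC.
Let x10 := root_x1_lt0 hs hC.
Let x20 := root_x2_gt0 hs hC.

Lemma hjb_eq_low (d1 d2 : R -> R) (S : R) : hjb s lam gam d1 -> hjb s lam gam d2 ->
  0 <= S -> S <= root_x2 s -> d1 S = d2 S.
Proof.
move=> h1 h2.
have low (u : R) : 0 <= u -> u < root_x2 s -> d1 u = d2 u.
  move=> u0 ux2; apply: (@min_affine_inj (passive_drift s u) (active_drift s u) m).
    apply: mulr_gt0.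
      apply: passive_drift_gt0 => // a0; exact: lt_trans (root_x2_lt_xe hs hC a0).
    rewrite active_driftE// !mulNr -mulrN opprB mulr_gt0 ?subr_gt0//.
    by rewrite mulr_gt0 ?subr_gt0// (lt_le_trans x10).
  have /hjb_eqP E1 := h1.2 u u0; have /hjb_eqP E2 := h2.2 u u0.
  by rewrite -E1 -E2.
move=> S0; rewrite le_eqVlt => /predU1P[->|]; last exact: low.
apply: (eq_left_limit h1.1 h2.1 (lexx 0) x20) => u u0 ux2.
by apply: low => //; exact: ltW.
Qed.

Lemma hjb_eq_high (d1 d2 : R -> R) (S : R) : hjb s lam gam d1 -> hjb s lam gam d2 ->
  dynA s < 0 -> point_xe s < S -> d1 S = d2 S.
Proof.
move=> h1 h2 a0 xeS; have S0 : 0 <= S by rewrite ltW// (lt_trans (point_xe_gt0 hs a0)).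
apply: (@min_affine_inj (passive_drift s S) (active_drift s S) m).
  rewrite nmulr_rgt0; first last.
    rewrite passive_driftE// pmulr_rlt0 ?subr_lt0//.
    by rewrite mulr_gt0// normr_gt0 lt_eqF.
  by apply: active_drift_lt0 => //; exact: lt_trans (root_x2_lt_xe hs hC a0) xeS.
have /hjb_eqP E1 := h1.2 S S0; have /hjb_eqP E2 := h2.2 S S0.
by rewrite -E1 -E2.
Qed.

(* Outside [root_x2, xe] the drifts have the same sign and the equation
   determines [d]; inside, it has a passive and an active branch, which can
   meet only at zeros of the gap. *)
Lemma hjb_eq_glue (d1 d2 : R -> R) : hjb s lam gam d1 -> hjb s lam gam d2 ->
  (forall S : R, root_x2 s < S -> (dynA s < 0 -> S < point_xe s) -> d1 S = d2 S) ->
  forall S : R, 0 <= S -> d1 S = d2 S.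
Proof.
move=> h1 h2 mid S S0; have [Sx2|x2S] := leP S (root_x2 s); first exact: hjb_eq_low.
have [a0|a0] := ltP (dynA s) 0; last by apply: mid => //; rewrite ltNge a0.
have [Sxe|xeS|->] := ltgtP S (point_xe s); [exact: mid|exact: hjb_eq_high|].
apply: (eq_left_limit h1.1 h2.1 (ltW x20) (root_x2_lt_xe hs hC a0)) => u x2u uxe.
exact: mid.
Qed.

(** The active drift vanishes at [x2], so the active branch would force [gam = T x2 + kappa + lam],
    for which the gap at [x2] is zero. *)
Lemma active_excess_root_x2 (d : R -> R) : hjb s lam gam d ->
  0 < hjb_gap s lam gam (root_x2 s) -> e d (root_x2 s) < 0.
Proof.
move=> hd gap; have x2_0 := ltW x20.
have gx2 : 0 < gain_ratio s * root_x2 s ^+ 2 by rewrite mulr_gt0// exprn_gt0.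
rewrite ltNge; apply/negP => ex2.
have := hjb_active hd x2_0 ex2; rewrite active_drift_root_x2// mul0r addr0 => E.
move: gap; rewrite /hjb_gap -E passive_drift_root_x2// /m.
by rewrite mulrC subrr ltxx.
Qed.

(** A positive gap forbids a change of action on either side of [Y]. To the left every solution is
    passive, because it is so at [x2]. To the right it is active: a passive choice would persist up
    to [xe], where it forces [gam = T xe] and a zero gap, or up to infinity, against the lower bound
    on [h]. The same branch equations thus determine both solutions. *)
Lemma hjb_unique_threshold (d1 d2 h1 h2 : R -> R) (lb1 lb2 Y : R) :
  weightT s != 0 -> hjb s lam gam d1 -> hjb s lam gam d2 ->
  (forall S : R, 0 < S -> is_derive S (1 : R) h1 (d1 S)) ->
  (forall S : R, 0 < S -> is_derive S (1 : R) h2 (d2 S)) ->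
  (forall S : R, 0 <= S -> lb1 <= h1 S) -> (forall S : R, 0 <= S -> lb2 <= h2 S) ->
  root_x2 s <= Y ->
  (forall S : R, root_x2 s <= S -> S < Y -> 0 < hjb_gap s lam gam S) ->
  (forall S : R, Y < S -> (dynA s < 0 -> S <= point_xe s) -> 0 < hjb_gap s lam gam S) ->
  forall S : R, 0 <= S -> d1 S = d2 S.
Proof.
move=> hT hd1 hd2 dh1 dh2 hlb1 hlb2 x2Y gapl gapr; have T0 := weightT_gt0 hs hT.
have left (d : R -> R) : hjb s lam gam d ->
    forall S : R, root_x2 s <= S -> S < Y -> e d S < 0.
  move=> hd S x2S SY; rewrite -(@active_excess_sign d hd (root_x2 s) S) ?(ltW x20)//.
    by apply: active_excess_root_x2 => //; apply: gapl => //; exact: le_lt_trans SY.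
  move=> u x2u uS; apply: (active_excess_neq0 hd); first exact: le_trans (ltW x20) x2u.
  by rewrite gt_eqF// gapl// (le_lt_trans uS).
have right (d h : R -> R) (lb : R) : hjb s lam gam d ->
    (forall S : R, 0 < S -> is_derive S (1 : R) h (d S)) ->
    (forall S : R, 0 <= S -> lb <= h S) ->
    forall S : R, Y < S -> (dynA s < 0 -> S < point_xe s) -> 0 < e d S.
  move=> hd dh hlb S YS Sxe; have S0 : 0 < S by rewrite (lt_trans x20)// (le_lt_trans x2Y).
  have nz (u : R) : S <= u -> (dynA s < 0 -> u <= point_xe s) -> e d u != 0.
    move=> Su uxe; apply: (active_excess_neq0 hd); first exact: le_trans (ltW S0) Su.
    by rewrite gt_eqF// gapr// (lt_le_trans YS).
  have SN : e d S != 0 by apply: nz => // /Sxe/ltW.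
  rewrite ltNge; apply/negP; rewrite le_eqVlt (negPf SN)/= => eS.
  have pas (u : R) : S <= u -> (dynA s < 0 -> u < point_xe s) ->
      passive_drift s u * d u = gam - weightT s * u.
    move=> Su uxe; apply: (hjb_passive hd); first exact: le_trans (ltW S0) Su.
    apply: ltW; rewrite -(@active_excess_sign d hd S u) ?(ltW S0)// => v Sv vu.
    by apply: nz => // /uxe/ltW; exact: le_trans.
  have [a0|a0] := ltP (dynA s) 0; last first.
    apply: (@hjb_not_eventually_passive d h lb S a0 T0 (ltW S0) dh hlb) => u Su.
    by apply: pas => //; rewrite ltNge a0.
  (* The passive relation, known strictly below [xe], is carried to [xe] by continuity; there the
     drift vanishes and only [T xe = gam] is left. *)
  have cp : {within `[0, +oo[, continuous (fun u : R => passive_drift s u * d u + weightT s * u)}.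
    apply: within_continuousD.
      apply: within_continuousM; last exact: hd.1.
      apply: continuous_subspaceT => u; apply: cvgD; last exact: cvg_cst.
      by apply: cvgM; [exact: cvg_cst|exact: cvg_id].
    by apply: continuous_subspaceT => u; apply: cvgM; [exact: cvg_cst|exact: cvg_id].
  have cg : {within `[0, +oo[, continuous (fun _ : R => gam)}.
    exact: (continuous_subspaceT (@cst_continuous _ _ _)).
  have := @eq_left_limit _ _ S (point_xe s) cp cg (ltW S0) (Sxe a0).
  rewrite passive_drift_xe// mul0r add0r => E.
  have {}E : weightT s * point_xe s = gam.
    by apply: E => u Su uxe; rewrite pas ?subrK// ltW.
  have := gapr (point_xe s) (lt_trans YS (Sxe a0)) (fun=> lexx _).
  by rewrite /hjb_gap passive_drift_xe// E subrr !mulr0 subrr ltxx.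
apply: (hjb_eq_glue hd1 hd2) => S x2S Sxe; have S0 : 0 < S by exact: lt_trans x2S.
have pn : passive_drift s S != 0 by rewrite gt_eqF// passive_drift_gt0// ltW.
have qn : active_drift s S != 0 by rewrite lt_eqF// active_drift_lt0.
have leftE (u : R) : root_x2 s <= u -> u < Y -> passive_drift s u != 0 -> d1 u = d2 u.
  move=> x2u uY pu; have u0 := le_trans (ltW x20) x2u.
  apply: (mulfI pu).
  rewrite (hjb_passive hd1 u0 (ltW (left _ hd1 _ x2u uY))).
  by rewrite (hjb_passive hd2 u0 (ltW (left _ hd2 _ x2u uY))).
have [SY|YS|SY] := ltgtP S Y; first exact: leftE (ltW x2S) SY pn.
  apply: (mulfI qn); apply: (@addrI _ m).
  rewrite (hjb_active hd1 (ltW S0) (ltW (right _ _ _ hd1 dh1 hlb1 S YS Sxe))).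
  by rewrite (hjb_active hd2 (ltW S0) (ltW (right _ _ _ hd2 dh2 hlb2 S YS Sxe))).
apply: (eq_left_limit hd1.1 hd2.1 (ltW x20) x2S) => u x2u uS.
apply: leftE; [exact: ltW|by rewrite -SY|].
rewrite gt_eqF// passive_drift_gt0//; first exact: ltW (lt_trans x20 x2u).
by move=> /Sxe; exact: lt_trans.
Qed.

(** The zero function is a solution and [d] agrees with it at [x2], so the excess there is [- m].
    For [m != 0] its sign is preserved, and the selected branch gives [d = 0]; for [m = 0] the
    equation is [min (p d) (q d) = 0] with [p > 0 > q], which also forces [d = 0]. *)
Lemma hjb_unique_unweighted (d : R -> R) : weightT s = 0 -> gam = Num.min 0 m ->
  hjb s lam gam d -> forall S : R, 0 <= S -> d S = 0.
Proof.
move=> T0 gamE hd; have h0 : hjb s lam gam (fun=> 0).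
  by rewrite gamE; have [] := hjb_unweighted lam hC T0.
apply: (hjb_eq_glue hd h0) => S x2S Sxe; have S0 : 0 < S by exact: lt_trans x2S.
have p0 : 0 < passive_drift s S by rewrite passive_drift_gt0// ltW.
have q0 : active_drift s S < 0 by exact: active_drift_lt0.
have dx2 : d (root_x2 s) = 0 := hjb_eq_low hd h0 (ltW x20) (lexx _).
have ex2 : e d (root_x2 s) = - m by rewrite /e dx2 mulr0 sub0r.
have gapE (u : R) : hjb_gap s lam gam u =
    m * passive_drift s u - gain_ratio s * u ^+ 2 * gam.
  by rewrite /hjb_gap T0 mul0r subr0.
have signE : m != 0 -> (- m < 0) = (e d S < 0).
  move=> m0; rewrite -ex2; apply: (active_excess_sign hd) (ltW x20) (ltW x2S) _.
  move=> u x2u uS; have [->|ux2] := eqVneq u (root_x2 s); first by rewrite ex2 oppr_eq0.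
  have u0 : 0 <= u by exact: le_trans (ltW x20) x2u.
  apply: (active_excess_neq0 hd) => //; rewrite gapE gamE.
  have [m_lt0|m_gt0|mE] := ltgtP m 0.
  - rewrite mulrC -mulrBl -drift_diff opprB subrKC mulf_neq0// lt_eqF//.
    by apply: active_drift_lt0 => //; rewrite lt_neqAle eq_sym ux2.
  - rewrite mulr0 subr0 mulf_neq0// gt_eqF// passive_drift_gt0//.
    by move=> /Sxe; exact: le_lt_trans.
  - by rewrite mE eqxx in m0.
have [m_lt0|m_gt0|mE] := ltgtP m 0.
- have eS : 0 <= e d S.
    by rewrite leNgt -signE ?lt_eqF// oppr_lt0 -leNgt ltW.
  have := hjb_active hd (ltW S0) eS; rewrite T0 mul0r subr0 gamE min_r ?(ltW m_lt0)//.
  rewrite -[RHS]addr0 => /addrI/eqP; rewrite mulf_eq0 lt_eqF//= => /eqP.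
  by [].
- have eS : e d S < 0 by rewrite -signE ?gt_eqF// oppr_lt0.
  have := hjb_passive hd (ltW S0) (ltW eS); rewrite T0 mul0r subr0 gamE min_l ?(ltW m_gt0)//.
  by move=> /eqP; rewrite mulf_eq0 gt_eqF//= => /eqP.
- have /hjb_eqP := hd.2 S (ltW S0).
  rewrite T0 mul0r subr0 gamE -[kappa s + lam]/m mE minxx add0r.
  have [d0|d0|//] := ltgtP (d S) 0; rewrite /Num.min; case: ifP => _ /eqP;
    by rewrite eq_sym mulf_eq0 (gt_eqF p0, lt_eqF q0)/= (lt_eqF d0, gt_eqF d0).
Qed.

End Observed.

Lemma hjb_unique_unobservable (d : R -> R) : gainC s = 0 -> dynA s < 0 ->
  gam = weightT s * point_xe s + Num.min 0 m ->
  hjb s lam gam d -> forall S : R, 0 <= S -> d S = weightT s / (2 * `|dynA s|).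
Proof.
move=> hC a0 gamE hd; have gE : gain_ratio s = 0 by rewrite /gain_ratio hC expr0n/= mul0r.
have an0 : 2 * `|dynA s| != 0 by rewrite mulf_neq0// normr_eq0 lt_eqF.
have xe0 := point_xe_gt0 hs a0.
have off (S : R) : 0 <= S -> S != point_xe s -> d S = weightT s / (2 * `|dynA s|).
  move=> S0 Sxe; have := hd.2 S S0; rewrite active_termE gE !mul0r subr0.
  rewrite -[X in Num.min X _]addr0 -!addr_minr gamE => /addIr.
  rewrite /passive_term passive_driftE// => /eqP.
  rewrite [X in _ == X]addrC -subr_eq -mulrBr => /eqP E.
  apply: (mulfI an0); rewrite [RHS]mulrC divfK//.
  have xS : point_xe s - S != 0 by rewrite subr_eq0 eq_sym.
  by apply: (mulIf xS); rewrite E; ring.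
move=> S S0; have [->|] := eqVneq S (point_xe s); last exact: off.
have cc : {within `[0, +oo[, continuous (fun _ : R => weightT s / (2 * `|dynA s|))}.
  exact: (continuous_subspaceT (@cst_continuous _ _ _)).
apply: (eq_left_limit hd.1 cc (lexx 0) xe0) => u u0 uxe.
by apply: off; [exact: ltW|rewrite lt_eqF].
Qed.

End Uniqueness.

(** * The single-site problem *)

Section SiteSolution.
Context {R : realType}.
Variable s : site R.
Hypothesis (hs : standing_assumptions s).
Local Notation wv := (whittle_value s).

(** One package for all parameter regimes: indexability uses the unique slope, the dual bound the
    certificate, and concavity the near-optimal levels. The levels are restricted to a nonzero gain
    because [hold_cost] divides by it. *)
Definition site_solved (lam gam : R) : Prop :=
  [/\ single_site_value s lam = gam%:E, lower_certified s lam gam,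
      gainC s != 0 -> hold_approximable s lam gam &
      exists d, hjb_threshold s lam gam d /\
        forall h' d', relative_value_function s lam h' d' ->
          forall S : R, 0 <= S -> d' S = d S].

Lemma hjb_of_relative_value (lam gam : R) (h d : R -> R) :
  single_site_value s lam = gam%:E -> relative_value_function s lam h d ->
  hjb s lam gam d.
Proof.
by move=> E [_ cd _ _ H]; split => // S S0; have := H S S0; rewrite E => -[].
Qed.

Lemma hjb_threshold_certified (lam gam : R) (d : R -> R) :
  hjb_threshold s lam gam d -> lower_certified s lam gam.
Proof. by move=> [hd d0 dT _]; exact: lower_certified_hjb hs hd d0 dT. Qed.

Lemma single_site_value_eq (lam gam : R) (d : R -> R) :
  hjb_threshold s lam gam d -> (single_site_value s lam <= gam%:E)%E ->
  single_site_value s lam = gam%:E.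
Proof.
move=> hd le; apply/eqP; rewrite eq_le le/=.
exact: single_site_value_ge (hjb_threshold_certified hd).
Qed.

Lemma site_solved_unobservable (lam : R) : gainC s = 0 -> dynA s < 0 ->
  site_solved lam (weightT s * point_xe s + Num.min 0 (kappa s + lam)).
Proof.
move=> hC a0; have hd := hjb_unobservable hs lam hC a0.
have E := single_site_value_eq hd.
have {}E : single_site_value s lam =
    (weightT s * point_xe s + Num.min 0 (kappa s + lam))%:E.
  apply: E; rewrite /Num.min; case: ifP => _.
    by have := single_site_value_le_unobserved hs lam false hC a0; rewrite mulr0.
  by have := single_site_value_le_unobserved hs lam true hC a0; rewrite mulr1.
split => //; first exact: hjb_threshold_certified hd.
  by rewrite hC eqxx.
exists (fun=> weightT s / (2 * `|dynA s|)); split => // h d hr.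
exact: hjb_unique_unobservable (hjb_of_relative_value E hr).
Qed.

Section Observed.
Hypothesis (hC : gainC s != 0).
Let g0 := gain_ratio_gt0 hs hC.
Let x20 := root_x2_gt0 hs hC.

Lemma site_solved_unweighted (lam : R) : weightT s = 0 ->
  site_solved lam (Num.min 0 (kappa s + lam)).
Proof.
move=> T0; have hd := hjb_unweighted lam hC T0.
have app : hold_approximable s lam (Num.min 0 (kappa s + lam)).
  have [m0|/ltW m0] := leP 0 (kappa s + lam).
    have [a0|a0] := ltP (dynA s) 0; last exact: hold_approximable_infty.
    by have := hold_approximable_xe hs lam hC a0; rewrite T0 mul0r.
  by have := hold_approximable_root_x2 hs lam hC; rewrite T0 mul0r add0r.
have E := single_site_value_eq hd (single_site_value_le_approx hs hC app).
split => //; first exact: hjb_threshold_certified hd.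
exists (fun=> 0); split => // h d hr.
exact: (hjb_unique_unweighted hs hC T0 erefl (hjb_of_relative_value E hr)).
Qed.

Hypothesis (hT : weightT s != 0).
Let T0 := weightT_gt0 hs hT.

Lemma site_solved_threshold (lam gam Y : R) :
  (exists d, hjb_threshold s lam gam d) -> hold_approximable s lam gam ->
  root_x2 s <= Y ->
  (forall S : R, root_x2 s <= S -> S < Y -> 0 < hjb_gap s lam gam S) ->
  (forall S : R, Y < S -> (dynA s < 0 -> S <= point_xe s) -> 0 < hjb_gap s lam gam S) ->
  site_solved lam gam.
Proof.
move=> [d hd] app x2Y gapl gapr.
have E := single_site_value_eq hd (single_site_value_le_approx hs hC app).
split => //; first exact: hjb_threshold_certified hd.
exists d; split => // h' d' hr; have hd' := hjb_of_relative_value E hr.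
case: (hd) => hjbd d0 _ _.
(* The constructed slope is nonnegative, so its antiderivative is bounded below by its value at 0,
   as the uniqueness argument demands of both solutions. *)
have [h [ch dh]] := antiderivative hjbd.1.
have hlb (S : R) : 0 <= S -> h 0 <= h S.
  rewrite le_eqVlt => /predU1P[<-//|S0].
  have [||c] := @MVT _ h d 0 S S0.
  - by move=> u; rewrite in_itv/= => /andP[u0 _]; exact: dh.
  - apply: continuous_subspaceW ch => u /=.
    by rewrite !in_itv/= => /andP[->].
  rewrite in_itv/= subr0 => /andP[c0 _] H; rewrite -subr_ge0 H mulr_ge0 ?(ltW S0)//.
  exact/d0/ltW.
case: hr => _ _ dh' [lb' hlb'] _.
exact: (hjb_unique_threshold hs hC hT hd' hjbd dh' dh hlb' hlb x2Y gapl gapr).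
Qed.

Lemma site_solved_always_active (lam : R) : kappa s + lam <= wv (root_x2 s) ->
  site_solved lam (weightT s * root_x2 s + (kappa s + lam)).
Proof.
move=> m2; apply: (@site_solved_threshold _ _ (root_x2 s)) => //.
- exact: hjb_always_active.
- exact: hold_approximable_root_x2.
- by move=> S x2S /lt_geF; rewrite x2S.
move=> S x2S _; have S0 : 0 < S by exact: lt_trans x2S.
have Sx1 : 0 < S - root_x1 s by rewrite subr_gt0 (lt_trans (root_x1_lt0 hs hC)).
(* The gap vanishes at [x2]; the cofactor is positive because the price is at most the index of
   [x2], itself below [T S^2 / (S - x1)]. *)
have -> : hjb_gap s lam (weightT s * root_x2 s + (kappa s + lam)) S =
    gain_ratio s * (S - root_x2 s) *
    (weightT s * S ^+ 2 - (kappa s + lam) * (S - root_x1 s)).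
  rewrite /hjb_gap -(subrK (active_drift s S) (passive_drift s S)) drift_diff.
  by rewrite active_driftE//; ring.
apply: mulr_gt0; first by rewrite mulr_gt0 ?subr_gt0.
rewrite subr_gt0 -ltr_pdivlMr// (le_lt_trans m2)// whittle_value_low//.
exact: (low_value_lt hs hC hT (ltW x20) x2S).
Qed.

Lemma site_solved_intermediate (lam X : R) : root_x2 s < X ->
  (dynA s < 0 -> X < point_xe s) -> kappa s + lam = wv X ->
  site_solved lam (hold_cost s lam X).
Proof.
move=> x2X Xxe XE; apply: (@site_solved_threshold _ _ X) => //.
- exact: hjb_intermediate.
- move=> e e0; exists X; split => //; last by rewrite lerDl ltW.
  by rewrite passive_drift_gt0// ltW// (lt_trans x20).
- exact: ltW.
- move=> S x2S SX; apply: hjb_gap_intermediate_gt0 => //; last by rewrite lt_eqF.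
  exact: le_trans (ltW x20) x2S.
- move=> S XS _; apply: hjb_gap_intermediate_gt0 => //; last by rewrite gt_eqF.
  by rewrite ltW// (lt_trans _ XS)// (lt_trans x20).
Qed.

Lemma site_solved_passive_below (lam : R) : dynA s < 0 ->
  wv (point_xe s) <= kappa s + lam -> site_solved lam (weightT s * point_xe s).
Proof.
move=> a0 mxe; have xe0 := point_xe_gt0 hs a0.
apply: (@site_solved_threshold _ _ (point_xe s)) => //.
- exact: hjb_passive_below.
- exact: hold_approximable_xe.
- exact/ltW/root_x2_lt_xe.
- move=> S x2S Sxe; have S0 : 0 < S by exact: lt_le_trans x2S.
  rewrite /hjb_gap -mulrBr passive_driftE//.
  have -> : (kappa s + lam) * (2 * `|dynA s| * (point_xe s - S)) -
      gain_ratio s * S ^+ 2 * (weightT s * (point_xe s - S)) =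
      2 * `|dynA s| * (point_xe s - S) * ((kappa s + lam) -
      weightT s * gain_ratio s * S ^+ 2 / (2 * `|dynA s|)).
    by field; rewrite normr_eq0 lt_eqF.
  have a_gt0 : 0 < 2 * `|dynA s| by rewrite mulr_gt0// normr_gt0 lt_eqF.
  apply: mulr_gt0; first by rewrite mulr_gt0 ?subr_gt0.
  rewrite subr_gt0 (lt_le_trans _ mxe)// whittle_value_high//.
  rewrite ltr_pM2r ?invr_gt0// ltr_pM2l; first by rewrite ltr_pXn2r// nnegrE ltW.
  exact: mulr_gt0.
- by move=> S xeS /(_ a0); rewrite leNgt xeS.
Qed.

Lemma threshold_exists (lam : R) : wv (root_x2 s) < kappa s + lam ->
  (dynA s < 0 -> kappa s + lam < wv (point_xe s)) ->
  exists X, [/\ root_x2 s < X, dynA s < 0 -> X < point_xe s & kappa s + lam = wv X].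
Proof.
set m := kappa s + lam => m2 mxe; have W0 : 0 < noiseW s by case: hs.
(* [psi] is the difference between index and price, cleared of its positive denominator; its zero is
   found by the intermediate value theorem. *)
pose psi (X : R) := gain_ratio s * weightT s * X ^+ 3 - 2 * m * (dynA s * X + noiseW s).
have psiE (X : R) : root_x2 s <= X -> (dynA s < 0 -> X <= point_xe s) ->
    psi X = 2 * (dynA s * X + noiseW s) * (wv X - m) /\ 0 < dynA s * X + noiseW s.
  move=> x2X Xxe; have DX := half_drift_gt0 hs (le_trans (ltW x20) x2X) Xxe.
  by split => //; rewrite whittle_value_mid// /psi; field; rewrite gt_eqF.
have x2xe : dynA s < 0 -> root_x2 s <= point_xe s by move=> /(root_x2_lt_xe hs hC)/ltW.
have psi2 : psi (root_x2 s) < 0.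
  have [-> D] := psiE _ (lexx _) x2xe.
  by rewrite pmulr_rlt0 ?subr_lt0// mulr_gt0.
have [b [x2b bxe psib]] : exists b, [/\ root_x2 s < b, dynA s < 0 -> b <= point_xe s &
    0 <= psi b /\ (dynA s < 0 -> b = point_xe s)].
  have [a0|a0] := ltP (dynA s) 0.
    exists (point_xe s); split => //; first exact: root_x2_lt_xe.
    have [-> D] := psiE _ (x2xe a0) (fun=> lexx _); split => //.
    by rewrite mulr_ge0// ?mulr_ge0// ?(ltW D)// subr_ge0 ltW// mxe.
  have m0 : 0 < m.
    apply: lt_trans m2; rewrite whittle_value_low//.
    apply: divr_gt0; first by rewrite mulr_gt0// exprn_gt0.
    by rewrite subr_gt0 (lt_trans (root_x1_lt0 hs hC)).
  have gT0 : 0 < gain_ratio s * weightT s by rewrite mulr_gt0.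
  (* For [b >= 1] and [b >= D] the cubic term dominates: [2 m (A b + W) <= 2 m (A + W) b <= g T b^2
     <= g T b^3]. *)
  pose D := 2 * m * (dynA s + noiseW s) / (gain_ratio s * weightT s).
  pose b := Num.max 1 (Num.max (root_x2 s + 1) D).
  have b1 : 1 <= b by rewrite le_max lexx.
  have bD : D <= b by rewrite !le_max lexx !orbT.
  have b0 : 0 < b by exact: lt_le_trans b1.
  exists b; split; [|by []|split; last by []].
    by rewrite (@lt_le_trans _ _ (root_x2 s + 1)) ?ltrDl// !le_max lexx !orbT.
  rewrite subr_ge0 (@le_trans _ _ (2 * m * ((dynA s + noiseW s) * b)))//.
    rewrite ler_wpM2l ?mulr_ge0 ?(ltW m0)//.
    rewrite (_ : (dynA s + noiseW s) * b = dynA s * b + noiseW s * b); last by ring.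
    by rewrite lerD2l ler_pMr.
  rewrite mulrA (@le_trans _ _ (gain_ratio s * weightT s * b * b))//.
    by apply: ler_wpM2r; [exact: ltW|rewrite [leRHS]mulrC -ler_pdivrMr].
  rewrite -mulrA ler_wpM2l ?(ltW gT0)// exprS expr2.
  by rewrite -[leLHS]mul1r ler_wpM2r// mulr_ge0 ?ltW.
have cpsi : {within `[root_x2 s, b], continuous psi}.
  apply: continuous_subspaceT => X; apply: cvgB.
    by apply: cvgM; [exact: cvg_cst|exact: (@exprn_continuous _ 3)].
  apply: cvgM; first exact: cvg_cst.
  by apply: cvgD; [apply: cvgM; [exact: cvg_cst|exact: cvg_id]|exact: cvg_cst].
have [|X + psiX] := @IVT _ psi _ b 0 (ltW x2b) cpsi.
  by rewrite ge_min le_max (ltW psi2) psib.1 orbT.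
rewrite in_itv/= => /andP[x2X Xb].
have Xxe : dynA s < 0 -> X <= point_xe s by move=> /bxe; exact: le_trans.
have [E D] := psiE X x2X Xxe.
have mE : m = wv X.
  move: E; rewrite psiX => /esym/eqP; rewrite mulf_eq0 mulf_eq0 (gt_eqF D) orbF.
  by rewrite pnatr_eq0/= subr_eq0 => /eqP.
exists X; split => //.
  by rewrite lt_neqAle x2X andbT; apply: contraTneq m2 => ->; rewrite mE ltxx.
move=> a0; rewrite lt_neqAle Xxe// andbT.
by apply: contraTneq (mxe a0) => <-; rewrite mE ltxx.
Qed.

End Observed.

Lemma site_solved_exists (lam : R) : exists gam, site_solved lam gam.
Proof.
have [hC|hC] := eqVneq (gainC s) 0.
  have a0 : dynA s < 0 by case: hs => _ _ _ _ []//; rewrite hC eqxx.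
  by eexists; exact: site_solved_unobservable.
have [hT|hT] := eqVneq (weightT s) 0; first by eexists; exact: site_solved_unweighted.
have [m2|m2] := leP (kappa s + lam) (wv (root_x2 s)).
  by eexists; exact: site_solved_always_active.
have [/andP[a0 mxe]|] := boolP ((dynA s < 0) && (wv (point_xe s) <= kappa s + lam)).
  by eexists; exact: site_solved_passive_below.
rewrite negb_and => nmxe.
have [|X [x2X Xxe XE]] := threshold_exists hC hT m2.
  by move=> a0; move: nmxe; rewrite a0/= -ltNge.
by eexists; exact: site_solved_intermediate XE.
Qed.

Lemma has_relative_value_function_site (lam : R) : has_relative_value_function s lam.
Proof.
have [gam [E _ _ [d [hd uniq]]]] := site_solved_exists lam; split.
  case: hd => -[cd hd] d0 _ _; have [h [ch dh]] := antiderivative cd.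
  exists h, d; split => //; last by move=> S S0; rewrite E -hd.
  exists (h 0) => S; rewrite le_eqVlt => /predU1P[<-//|S0].
  have [||c] := @MVT _ h d 0 S S0.
  - by move=> u; rewrite in_itv/= => /andP[u0 _]; exact: dh.
  - by apply: continuous_subspaceW ch => u /=; rewrite !in_itv/= => /andP[->].
  rewrite in_itv/= subr0 => /andP[c0 _] H; rewrite -subr_ge0 H mulr_ge0 ?(ltW S0)//.
  exact/d0/ltW.
move=> h1 d1 h2 d2 r1 r2; exists (h1 0 - h2 0) => S S0.
split; last by rewrite (uniq _ _ r1)// (uniq _ _ r2).
have [<-|S_neq0] := eqVneq 0 S; first by rewrite subrKC.
have S_gt0 : 0 < S by rewrite lt_neqAle S_neq0.
case: (r1) => c1 _ dh1 _ _; case: (r2) => c2 _ dh2 _ _.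
have [||c _] := @MVT _ (h1 - h2) (fun=> 0) 0 S S_gt0.
- move=> u; rewrite in_itv/= => /andP[u0 _].
  apply: (is_derive_eq (is_deriveB (dh1 u u0) (dh2 u u0))).
  by rewrite (uniq _ _ r1) ?(ltW u0)// (uniq _ _ r2) ?(ltW u0)// subrr.
- have c12 : {within `[0, +oo[, continuous (h1 - h2)}.
    move/subspace_continuousP : c1 => c1; move/subspace_continuousP : c2 => c2.
    by apply/subspace_continuousP => u u0; apply: cvgB; [exact: c1|exact: c2].
  by apply: continuous_subspaceW c12 => u /=; rewrite !in_itv/= => /andP[->].
rewrite mul0r => /eqP; rewrite subr_eq0 => /eqP H.
have {}H : h1 S - h2 S = h1 0 - h2 0 := H.
by rewrite -H subrKC.
Qed.

(** [passive_set] asks for some relative value function; uniqueness of the slope turns this into a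
    condition on the explicit one. *)
Lemma passive_setE (lam S : R) :
  passive_set s lam S <-> 0 <= S /\ wv S <= kappa s + lam.
Proof.
have [gam [E _ _ [d [hd uniq]]]] := site_solved_exists lam.
case: (hd) => _ _ _ thr; split.
  move=> [S0 [h' [d' [hr]]]]; rewrite le_passive_active (uniq _ _ hr S S0) thr//.
move=> [S0 H]; split => //.
have [[h' [d' hr]] _] := has_relative_value_function_site lam.
by exists h', d'; split => //; rewrite le_passive_active (uniq _ _ hr S S0) thr.
Qed.

Lemma site_indexable : indexable s.
Proof.
split.
- move=> l1 l2 l12 S /passive_setE[S0 H]; apply/passive_setE; split => //.
  by rewrite (le_trans H)// lerD2l.
- apply/seteqP; split => // S /(_ (wv S - kappa s - 1) I) /passive_setE[_].
  by rewrite leNgt (_ : _ + _ = wv S - 1) ?gtrBl ?ltr01//; ring.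
- apply/seteqP; split => S /=; first by move=> [lam _ /passive_setE[]].
  move=> S0; exists (wv S - kappa s) => //; apply/passive_setE; split => //.
  by rewrite addrC subrK.
Qed.

Lemma whittle_indexE (S : R) : 0 <= S ->
  whittle_index s S = (wv S - kappa s)%:E.
Proof.
move=> S0; apply/eqP; rewrite eq_le; apply/andP; split.
  apply: ereal_inf_lbound => /=; exists (wv S - kappa s) => //.
  by apply/passive_setE; rewrite addrC subrK.
apply: le_ereal_inf_tmp => _ [lam /= /passive_setE[_ H] <-].
by rewrite lee_fin lerBlDl.
Qed.

(* [gamma] is concave as an infimum of functions affine in [lam]. *)
Lemma site_value_concave (a b t ga gb gc : R) : 0 <= t -> t <= 1 ->
  site_solved a ga -> site_solved b gb -> site_solved (t * a + (1 - t) * b) gc ->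
  t * ga + (1 - t) * gb <= gc.
Proof.
move=> t0 t1 [Ea _ _ _] [Eb _ _ _] [Ec _ app _].
have t10 : 0 <= 1 - t by rewrite subr_ge0.
have [hC|hC] := eqVneq (gainC s) 0.
  have a0 : dynA s < 0 by case: hs => _ _ _ _ []//; rewrite hC eqxx.
  have [E _ _ _] := site_solved_unobservable (t * a + (1 - t) * b) hC a0.
  move: E; rewrite Ec => -[->].
  have bound (l gl : R) (c : bool) : single_site_value s l = gl%:E ->
      gl <= weightT s * point_xe s + (kappa s + l) * c%:R.
    move=> El; have := single_site_value_le_unobserved hs l c hC a0.
    by rewrite El lee_fin.
  have key (c : bool) : t * ga + (1 - t) * gb <=
      weightT s * point_xe s + (kappa s + (t * a + (1 - t) * b)) * c%:R.
    rewrite (_ : _ + _ * c%:R =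
      t * (weightT s * point_xe s + (kappa s + a) * c%:R) +
      (1 - t) * (weightT s * point_xe s + (kappa s + b) * c%:R)); last by ring.
    by rewrite lerD// ler_wpM2l// bound.
  rewrite /Num.min; case: ifP => _; first by have := key false; rewrite mulr0.
  by have := key true; rewrite mulr1.
apply/ler_addgt0Pr => e e0; have [X [x2X pX HX]] := app hC e e0.
rewrite (le_trans _ HX)//.
have X0 : 0 < X by exact: lt_trans (root_x2_gt0 hs hC) x2X.
have bound (l gl : R) : single_site_value s l = gl%:E -> gl <= hold_cost s l X.
  move=> El; have := single_site_value_le_hold hs l hC X0 pX x2X.
  by rewrite El lee_fin.
rewrite (_ : hold_cost s _ X = t * hold_cost s a X + (1 - t) * hold_cost s b X).
  by rewrite lerD// ler_wpM2l// bound.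
by rewrite /hold_cost; ring.
Qed.

Lemma threshold_cubicE (lam X : R) : gainC s != 0 -> weightT s != 0 ->
  (threshold_cubic s lam X = 0) <->
  (gain_ratio s * weightT s * X ^+ 3 = 2 * (kappa s + lam) * (dynA s * X + noiseW s)).
Proof.
move=> hC hT; case: hs => _ _ V0 _ _; have Vn := lt0r_neq0 V0.
have gT : gain_ratio s * weightT s != 0.
  by rewrite mulf_neq0// gt_eqF// gain_ratio_gt0.
have -> : threshold_cubic s lam X = (gain_ratio s * weightT s)^-1 *
    (gain_ratio s * weightT s * X ^+ 3 - 2 * (kappa s + lam) * (dynA s * X + noiseW s)).
  by rewrite /threshold_cubic /gain_ratio; field; rewrite Vn hC hT.
split=> [/eqP|->]; last by rewrite subrr mulr0.
by rewrite mulf_eq0 invr_eq0 (negPf gT)/= subr_eq0 => /eqP.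
Qed.

(** For [A < 0] a positive root [Y] could a priori lie where [A Y + W <= 0], but the equation itself
    excludes this, as its cubic term and the price are positive. The factorization behind the
    monotonicity of the index then leaves only [Y = X]. *)
Lemma threshold_cubic_unique (lam X : R) : gainC s != 0 -> weightT s != 0 ->
  root_x2 s < X -> (dynA s < 0 -> X < point_xe s) -> kappa s + lam = wv X ->
  unique (fun Y : R => 0 < Y /\ threshold_cubic s lam Y = 0) X.
Proof.
move=> hC hT x2X Xxe XE; have W0 : 0 < noiseW s by case: hs.
have X0 : 0 < X by exact: lt_trans (root_x2_gt0 hs hC) x2X.
have g0 := gain_ratio_gt0 hs hC; have T0 := weightT_gt0 hs hT.
have Xxe' : dynA s < 0 -> X <= point_xe s by move=> /Xxe/ltW.
have DX := half_drift_gt0 hs (ltW X0) Xxe'.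
have cX : gain_ratio s * weightT s * X ^+ 3 =
    2 * (kappa s + lam) * (dynA s * X + noiseW s).
  by rewrite XE whittle_value_mid ?(ltW x2X)//; field; rewrite gt_eqF.
split; first by split => //; exact/threshold_cubicE.
move=> Y [Y0 /threshold_cubicE -/(_ hC hT) cY].
have gT0 : 0 < gain_ratio s * weightT s by rewrite mulr_gt0.
have m0 : 0 < 2 * (kappa s + lam).
  by rewrite -(pmulr_lgt0 _ DX) -cX mulr_gt0// exprn_gt0.
have DY : 0 < dynA s * Y + noiseW s.
  by rewrite -(pmulr_rgt0 _ m0) -cY mulr_gt0// exprn_gt0.
have E : (X - Y) * (X ^+ 2 * (dynA s * Y + noiseW s) +
    Y ^+ 2 * (dynA s * X + noiseW s) + noiseW s * (X * Y)) = 0.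
  apply: (mulfI (lt0r_neq0 gT0)); rewrite mulr0.
  rewrite [LHS](_ : _ = gain_ratio s * weightT s * X ^+ 3 * (dynA s * Y + noiseW s) -
    gain_ratio s * weightT s * Y ^+ 3 * (dynA s * X + noiseW s)); last by ring.
  by rewrite cX cY; ring.
move/eqP: E; rewrite mulf_eq0 subr_eq0 => /orP[/eqP//|].
by rewrite gt_eqF// !addr_gt0// mulr_gt0// ?exprn_gt0// mulr_gt0.
Qed.

End SiteSolution.

(** * The dual bound *)

Section DualFunction.
Context {R : realType} (N M : nat) (s : 'I_N -> site R).
Hypothesis (hs : forall i, standing_assumptions (s i)).

Lemma dual_functionE (lam : R) (gam : 'I_N -> R) :
  (forall i, site_solved (s i) lam (gam i)) ->
  dual_function M s lam = (\sum_(i < N) gam i - lam * M%:R)%:E.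
Proof.
move=> H; rewrite /dual_function EFinB -sumEFin; congr (_ - _)%E.
by apply: eq_bigr => i _; have [-> _ _ _] := H i.
Qed.

Lemma site_values (lam : R) :
  exists gam : 'I_N -> R, forall i, site_solved (s i) lam (gam i).
Proof. by have /choice[gam Hgam] := fun i => site_solved_exists (hs i) lam; exists gam. Qed.

Lemma dual_function_concave : econcave (dual_function M s).
Proof.
move=> a b t t0 t1.
have [ga Ha] := site_values a; have [gb Hb] := site_values b.
have [gc Hc] := site_values (t * a + (1 - t) * b).
rewrite (dual_functionE Ha) (dual_functionE Hb) (dual_functionE Hc).
rewrite -!EFinM -EFinD lee_fin.
rewrite [leLHS](_ : _ = t * (\sum_(i < N) ga i) + (1 - t) * (\sum_(i < N) gb i)
  - (t * a + (1 - t) * b) * M%:R); last by ring.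
rewrite lerD2r !mulr_sumr -big_split/=; apply: ler_sum => i _.
exact: (site_value_concave (hs i) t0 t1 (Ha i) (Hb i) (Hc i)).
Qed.

(** Exactly [M] systems are observed at each time, so charging [lam] per observation and refunding
    [lam * M] leaves the coupled cost unchanged. *)
Lemma dual_function_le (lam : R) :
  (dual_function M s lam <= achievable_performance M s)%E.
Proof.
have [gam Hgam] := site_values lam; rewrite (dual_functionE Hgam).
apply: le_ereal_inf_tmp => _ [pi [Sig [hpi hM hSig ->]]].
apply: (@average_cost_sum_ge _ _ s lam (- (lam * M%:R)) gam pi Sig) => //.
  by move=> i; have [] := Hgam i.
move=> t t0; rewrite -(hM t t0) natr_sum mulr_sumr -sumrB.
by apply: eq_bigr => i _; rewrite /running_cost; ring.
Qed.

End DualFunction.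

Unset Implicit Arguments.

Theorem theorem2 (R : realType) (N M : nat) (s : 'I_N -> site R)
    (ltMN : (M < N)%N) (hs : forall i, standing_assumptions (s i)) :
  (forall i : 'I_N,
    let A := dynA (s i) in let W := noiseW (s i) in
    let C := gainC (s i) in let V := noiseV (s i) in
    let T := weightT (s i) in let k := kappa (s i) in
    let x1 := root_x1 (s i) in let x2 := root_x2 (s i) in
    let xe := point_xe (s i) in
    [/\ forall lam : R, has_relative_value_function (s i) lam,
        indexable (s i),
        (* (a) *)
        C = 0 \/ T = 0 ->
          forall S : R, 0 <= S -> whittle_index (s i) S = (- k)%:E &
        (* (b) *)
        C <> 0 -> T <> 0 ->
          forall S : R, 0 <= S ->
          [/\ S <= x2 ->
                whittle_index (s i) S = (- k + T * S ^+ 2 / (S - x1))%:E,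
              x2 < S -> (A < 0 -> S < xe) ->
                whittle_index (s i) S =
                  (- k + C ^+ 2 / (2 * V) * (T * S ^+ 3 / (A * S + W)))%:E &
              A < 0 -> xe <= S ->
                whittle_index (s i) S =
                  (- k + T * C ^+ 2 * S ^+ 2 / (2 * `|A| * V))%:E]])
  /\ econcave (dual_function M s)
  /\ (ereal_sup (range (dual_function M s)) <= achievable_performance M s)%E
  /\ (forall (i : 'I_N) (lam : R),
    let A := dynA (s i) in let W := noiseW (s i) in
    let C := gainC (s i) in let V := noiseV (s i) in
    let T := weightT (s i) in let k := kappa (s i) in
    let x2 := root_x2 (s i) in let xe := point_xe (s i) in
    let gamma := single_site_value (s i) lam in
    [/\ (* (c) *)
        T = 0 -> gamma = (Num.min (lam + k) 0)%:E,
        (* (d) *)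
        T <> 0 -> C = 0 ->
          (A < 0 -> gamma = (T * W / (2 * `|A|) + Num.min (lam + k) 0)%:E) /\
          (0 <= A -> gamma = +oo%E) &
        (* (e) *)
        C <> 0 -> T <> 0 ->
          [/\ (lam%:E <= whittle_index (s i) x2)%E ->
                gamma = (T * x2 + k + lam)%:E,
              (whittle_index (s i) x2 < lam%:E)%E ->
              (A < 0 -> (lam%:E < whittle_index (s i) xe)%E) ->
                exists X : R,
                  unique (fun Y : R => 0 < Y /\ threshold_cubic (s i) lam Y = 0) X
                  /\ gamma = (T * X + V * (k + lam) * (2 * A * X + W)
                                        / (C ^+ 2 * X ^+ 2))%:E &
              A < 0 -> (whittle_index (s i) xe <= lam%:E)%E ->
                gamma = (T * xe)%:E]]).
Proof.
split=> [i A W C V T k x1 x2 xe|].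
  have indexE := whittle_indexE (hs i).
  split.
  - exact: has_relative_value_function_site.
  - exact: site_indexable.
  - move=> CT S S0; rewrite indexE// /whittle_value.
    by case: CT => E; [rewrite (E : gainC (s i) = 0)|rewrite (E : weightT (s i) = 0)];
      rewrite eqxx ?orbT sub0r.
  move=> /eqP hC /eqP hT S S0; rewrite indexE//.
  have V0 : V != 0 by rewrite gt_eqF//; have [] := hs i.
  split=> [Sx2|x2S Sxe|a0 xeS].
  - by rewrite whittle_value_low// addrC.
  - rewrite (whittle_value_mid (hs i) hC hT (ltW x2S)); last by move=> /Sxe/ltW.
    have DS : A * S + W != 0.
      by rewrite gt_eqF// (half_drift_gt0 (hs i))// => /Sxe/ltW.
    by congr EFin; rewrite /gain_ratio -/A -/W -/C -/V -/T -/k; field; rewrite DS V0.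
  - rewrite (whittle_value_high (hs i) hC hT a0 xeS).
    congr EFin; rewrite /gain_ratio -/A -/W -/C -/V -/T -/k; field.
    by rewrite V0 normr_eq0 lt_eqF.
split; first exact: dual_function_concave.
split; first by apply: ge_ereal_sup => _ [lam _ <-]; exact: dual_function_le.
move=> i lam A W C V T k x2 xe gamma.
have indexE := whittle_indexE (hs i).
have [S00 W0 V0 T0 det] := hs i.
have solved g : site_solved (s i) lam g -> gamma = g%:E by case.
split.
- move=> TE; rewrite minC addrC.
  have [hC|hC] := eqVneq C 0; last exact/solved/site_solved_unweighted.
  have a0 : A < 0 by case: det => //; rewrite -/C hC eqxx.
  have := solved _ (site_solved_unobservable (hs i) lam hC a0).
  by rewrite -/T TE mul0r add0r.
- move=> /eqP hT hC; split=> [a0|a0]; last first.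
    (* [A >= 0] together with [C = 0] contradicts detectability, so the infinite value holds
       vacuously. *)
    by case: det; rewrite ?ltNge -/A ?a0// -/C hC eqxx.
  rewrite (solved _ (site_solved_unobservable (hs i) lam hC a0)) minC [lam + k]addrC.
  by congr (_ + _)%:E; rewrite /point_xe -/A -/W -/T ltr0_norm//; field; rewrite lt_eqF.
move=> /eqP hC /eqP hT; have g0 := gain_ratio_gt0 (hs i) hC.
have x20 := root_x2_gt0 (hs i) hC.
split.
- rewrite indexE ?(ltW x20)// lee_fin lerBrDr addrC => m2.
  by rewrite (solved _ (site_solved_always_active (hs i) hC hT m2)) addrA.
- rewrite indexE ?(ltW x20)// lte_fin ltrBlDr addrC => m2 mxe.
  have [|X [x2X Xxe XE]] := threshold_exists (hs i) hC hT m2.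
    move=> a0; have := mxe a0; rewrite indexE ?(ltW (point_xe_gt0 (hs i) a0))//.
    by rewrite lte_fin ltrBrDr addrC.
  exists X; split; first exact: threshold_cubic_unique.
  rewrite (solved _ (site_solved_intermediate (hs i) hC hT x2X Xxe XE)).
  congr EFin; rewrite /hold_cost /gain_ratio /passive_drift -/A -/W -/C -/V -/T -/k.
  by field; rewrite hC !gt_eqF// (lt_trans x20).
- move=> a0; rewrite indexE ?(ltW (point_xe_gt0 (hs i) a0))// lee_fin lerBlDr addrC => mxe.
  exact: (solved _ (site_solved_passive_below (hs i) hC hT a0 mxe)).
Qed.
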